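(* Let $R$ be a principal ideal domain. Let $G$ and $H$ be directed graphs, and suppose that there is $s\geq 1$ such that for each $0\leq r<s$ each term of $E^r(G)$ is a flat $R$-module. Then for $1\leq r<s$ the map $\nabla^r$ is an isomorphism $$\bigoplus_{\substack{m+u=p\\ n+v=q}} E^r_{m,n}(G)\otimes E^r_{u,v}(H)\xrightarrow{\ \cong\ }E^r_{p,q}(G\square H)$$ for all $p,q$, while $\nabla^s$ fits, for all $p,q$, into a short exact sequence $$0\to\bigoplus_{\substack{m+u=p\\ n+v=q}} E^s_{m,n}(G)\otimes E^s_{u,v}(H)\xrightarrow{\nabla^s}E^s_{p,q}(G\square H)\to\bigoplus_{\substack{m+u=p\\ n+v=q}}\mathrm{Tor}\bigl(E^s_{m,n}(G),E^s_{u-s+1,\,v+s-2}(H)\bigr)\to 0$$ which is natural in $H$ and with respect to maps $G\to G'$ for $G'$ satisfying the same flatness property as $G$.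
   Context: A directed graph $G$ has a vertex set $V(G)$ and edge set $E(G)\subseteq V(G)\times V(G)$ (loops allowed). A map of directed graphs $G\to H$ is a function $f\colon V(G)\to V(H)$ such that for each edge $x\to y$ of $G$ either $f(x)=f(y)$ or $f(x)\to f(y)$ is an edge of $H$. The distance $d(x,y)\in\{0,1,\dots,\infty\}$ is the minimal number of edges in a directed path from $x$ to $y$. The box product $G\square H$ has vertex set $V(G)\times V(H)$, with an edge $(g_1,h_1)\to(g_2,h_2)$ if either $g_1=g_2$ and $(h_1,h_2)\in E(H)$, or $h_1=h_2$ and $(g_1,g_2)\in E(G)$. All modules, tensor products and Tor are over $R$. The reachability complex $\mathrm{RC}_*(G)$ has in degree $k$ the free $R$-module on tuples $(x_0,\dots,x_k)$ of vertices with consecutive entries distinct and with $d(x_{i},x_{i+1})<\infty$ for all $i$; its differential is $\partial(x_0,\dots,x_k)=\sum_{i=0}^k(-1)^i(x_0,\dots,\widehat{x_i},\dots,x_k)$, omitting terms with repeated consecutive entries. The length of a tuple is $\ell(x_0,\dots,x_k)=\sum_i d(x_i,x_{i+1})$, and $F_\ell\mathrm{RC}_*(G)$ is the subcomplex spanned by tuples of length at most $\ell$. The magnitude-path spectral sequence (MPSS) $\{E^r_{*,*}(G),d^r\}_{r\geq 0}$ is the spectral sequence of this filtered complex, with $E^0_{i,j}(G)=F_i\mathrm{RC}_{i+j}(G)/F_{i-1}\mathrm{RC}_{i+j}(G)$ and $d^r$ of bidegree $(-r,r-1)$. The maps $\nabla^r\colon E^r(G)\otimes E^r(H)\to E^r(G\square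 H)$ are those induced by the filtered chain map $\nabla\colon \mathrm{RC}(G)\otimes\mathrm{RC}(H)\to\mathrm{RC}(G\square H)$ (the tensor product being filtered by $F_\ell(A\otimes B)=\sum_{s+t=\ell}F_sA\otimes F_tB$), which is the Eilenberg–Zilber shuffle map $$\nabla\bigl((g_0,\dots,g_p)\otimes(h_0,\dots,h_q)\bigr)=\sum_\sigma\mathrm{sign}(\sigma)\bigl((g_{i_0},h_{j_0}),\dots,(g_{i_{p+q}},h_{j_{p+q}})\bigr),$$ where $\sigma=((i_0,j_0),\dots,(i_{p+q},j_{p+q}))$ runs over lattice paths from $(0,0)$ to $(p,q)$ each step of which increases exactly one coordinate by $1$, and $\mathrm{sign}(\sigma)=(-1)^n$ with $n$ the number of lattice points on or above the horizontal axis and strictly below the path. The map $\nabla^0$ is the induced map on filtration quotients, and $\nabla^{r+1}$ is the composite of the homology product $H(E^r(G))\otimes H(E^r(H))\to H(E^r(G)\otimes E^r(H))$, $[x]\otimes[y]\mapsto[x\otimes y]$, with $H(\nabla^r)$. *)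

(* Defs.v *)
From HB Require Import structures.
From mathcomp Require Import all_boot all_order all_algebra.
From mathcomp Require Import finmap monalg.
From mathcomp Require Import boolp classical_sets cardinality fsbigop.

Set Implicit Arguments.
Unset Strict Implicit.
Unset Printing Implicit Defensive.

Import Order.TTheory GRing.Theory Num.Theory.
Local Open Scope ring_scope.
Local Open Scope quotient_scope.

Section Submodules.
Variables (R : comNzRingType) (V : lmodType R).

Section Subtype.
Variable S : submodClosed V.

Record submodule := Submodule { sm_val : V; sm_valP : sm_val \in S }.

HB.instance Definition _ := [isSub for sm_val].
HB.instance Definition _ := [Choice of submodule by <:].
HB.instance Definition _ := [SubChoice_isSubLmodule of submodule by <:].

Lemma sm_val_is_linear : linear sm_val. Proof. exact: (linearP \val). Qed.
HB.instance Definition _ :=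
  GRing.isLinear.Build R submodule V *:%R sm_val sm_val_is_linear.
End Subtype.

Lemma submod_ofP (P : V -> Prop) :
  P 0 -> (forall a x y, P x -> P y -> P (a *: x + y)) ->
  submod_closed (fun x => `[< P x >]).
Proof.
move=> P0 PD; split; first exact/asboolP.
by move=> a x y /asboolP Px /asboolP Py; apply/asboolP/PD.
Qed.

Definition lspan (X : V -> Prop) : {pred V} :=
  fun x => `[< forall S : submodClosed V, (forall y, X y -> y \in S) -> x \in S >].

Lemma lspan_submod X : submod_closed (lspan X).
Proof.
apply: submod_ofP => [S _|a x y Sx Sy S XS]; first exact: rpred0.
by rewrite rpredD ?rpredZ ?Sx ?Sy.
Qed.
HB.instance Definition _ X := GRing.isSubmodClosed.Build R V (lspan X) (lspan_submod X).

End Submodules.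

Section Quotient.
Variables (R : comNzRingType) (V : lmodType R) (S : submodClosed V).

(* A [submodClosed] predicate over a ring is closed under opposites, but the
   library does not infer the [zmodClosed] structure that its additive quotient
   requires. *)
Definition quot_pred : {pred V} := S.
HB.instance Definition _ := GRing.isSubmodClosed.Build R V quot_pred (submodClosedP S).

Definition quotmod : Type := Quotient.quot quot_pred.
HB.instance Definition _ := GRing.Zmodule.on quotmod.
HB.instance Definition _ := EqQuotient.on quotmod.


Definition quot_class (x : V) : quotmod := \pi_(Quotient.quot quot_pred) x.

Lemma quot_class_eq (x y : V) : (quot_class x == quot_class y) = (x - y \in S).
Proof. by rewrite -(Quotient.idealrBE quot_pred). Qed.

Lemma quot_reprK (x : quotmod) : quot_class (repr x) = x.
Proof. exact: reprK. Qed.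

Lemma quot_classB : zmod_morphism quot_class.
Proof. exact: (raddfB (\pi_(Quotient.quot quot_pred))). Qed.
HB.instance Definition _ := GRing.isZmodMorphism.Build V quotmod quot_class quot_classB.

Definition quot_scale (a : R) (x : quotmod) : quotmod := quot_class (a *: repr x).

Lemma quot_scale_pi a x : quot_scale a (quot_class x) = quot_class (a *: x).
Proof.
by apply/eqP; rewrite quot_class_eq -scalerBr rpredZ // -quot_class_eq quot_reprK.
Qed.

Lemma quot_scalerA a b x : quot_scale a (quot_scale b x) = quot_scale (a * b) x.
Proof. by rewrite -[x]quot_reprK !quot_scale_pi scalerA. Qed.
Lemma quot_scale1r : left_id 1 quot_scale.
Proof. by move=> x; rewrite -[x]quot_reprK quot_scale_pi scale1r. Qed.
Lemma quot_scalerDr : right_distributive quot_scale +%R.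
Proof.
move=> a x y; rewrite -[x]quot_reprK -[y]quot_reprK -raddfD !quot_scale_pi.
by rewrite scalerDr raddfD.
Qed.
Lemma quot_scalerDl x : {morph quot_scale^~ x : a b / a + b}.
Proof.
by move=> a b; rewrite -[x]quot_reprK !quot_scale_pi scalerDl raddfD.
Qed.

HB.instance Definition _ := GRing.Zmodule_isLmodule.Build R quotmod
  quot_scalerA quot_scale1r quot_scalerDr quot_scalerDl.

Lemma quot_classZ : scalable quot_class.
Proof. by move=> a x; rewrite -quot_scale_pi. Qed.
HB.instance Definition _ := GRing.isScalable.Build R V quotmod *:%R quot_class quot_classZ.

End Quotient.

Section Subquotient.
Variables (R : comNzRingType) (V : lmodType R) (Z B : submodClosed V).

Definition sub_preim : {pred submodule Z} := fun x => sm_val x \in B.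
Lemma sub_preim_submod : submod_closed sub_preim.
Proof.
split=> [|a x y Bx By]; rewrite /sub_preim unfold_in ?linear0 ?rpred0 //.
by rewrite linearP rpredD ?rpredZ.
Qed.
HB.instance Definition _ :=
  GRing.isSubmodClosed.Build R (submodule Z) sub_preim sub_preim_submod.

(* Z / (Z n B) *)
Definition subquot := quotmod sub_preim.
HB.instance Definition _ := GRing.Lmodule.on subquot.

(* The class of [v] when [v] lies in [Z], and [0] otherwise. *)
Definition sq_class (v : V) : subquot := quot_class sub_preim (insubd 0 v).
Definition sq_repr (x : subquot) : V := sm_val (repr x).

End Subquotient.

Section SubquotientMap.
Variables (R : comNzRingType) (V V' : lmodType R).
Variables (Z B : submodClosed V) (Z' B' : submodClosed V').

(* The map of subquotients induced by [phi], defined on representatives. *)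
Definition sq_map (phi : V -> V') (x : subquot Z B) : subquot Z' B' :=
  sq_class Z' B' (phi (sq_repr x)).
End SubquotientMap.
Arguments sq_map {R V V' Z B Z' B'} phi x.

Section KernelImage.
Variables (R : comNzRingType) (U V : lmodType R) (f : {linear U -> V}).

Definition kerp : {pred U} := fun x => f x == 0.
Lemma kerp_submod : submod_closed kerp.
Proof.
split=> [|a x y /eqP fx /eqP fy]; rewrite unfold_in /kerp ?linear0 //.
by rewrite linearP fx fy scaler0 addr0.
Qed.
HB.instance Definition _ := GRing.isSubmodClosed.Build R U kerp kerp_submod.

Definition imp : {pred V} := fun y => `[< exists x, y = f x >].
Lemma imp_submod : submod_closed imp.
Proof.
apply: submod_ofP => [|a _ _ [x ->] [y ->]]; first by exists 0; rewrite linear0.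
by exists (a *: x + y); rewrite linearP.
Qed.
HB.instance Definition _ := GRing.isSubmodClosed.Build R V imp imp_submod.

End KernelImage.

Section FreeModule.
Variables (R : comNzRingType) (K : choiceType) (M : lmodType R) (f : K -> M).

Definition free_lift (g : {malg R[K]}) : M := \sum_(k <- msupp g) g@_k *: f k.

Lemma free_liftEw (d : {fset K}) g :
  (msupp g `<=` d)%fset -> free_lift g = \sum_(k <- d) g@_k *: f k.
Proof.
move=> le; rewrite /free_lift (big_fset_incl _ le) // => k _ kN.
by rewrite mcoeff_outdom ?scale0r.
Qed.

Lemma free_lift_is_linear : linear free_lift.
Proof.
move=> a x y; set d := (msupp (a *: x + y) `|` msupp x `|` msupp y)%fset.
rewrite (@free_liftEw d) ?(@free_liftEw d x) ?(@free_liftEw d y) /d //; last first.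
- by rewrite -fsetUA fsubsetUl.
- by rewrite fsetUAC fsubsetUr.
- by rewrite fsubsetUr.
rewrite scaler_sumr -big_split /=; apply: eq_bigr => k _.
by rewrite mcoeffD mcoeffZ scalerDl scalerA.
Qed.
HB.instance Definition _ :=
  GRing.isLinear.Build R {malg R[K]} M *:%R free_lift free_lift_is_linear.

Lemma free_liftU k : free_lift << k >> = f k.
Proof. by rewrite /free_lift msuppU oner_eq0 big_seq_fset1 mcoeffUU scale1r. Qed.

End FreeModule.

Section Tensor.
Variables (R : comNzRingType) (M N : lmodType R).
Local Notation pure m n := (<< (m, n) >> : {malg R[(M * N)%type]}).

Definition bilin_relation (z : {malg R[(M * N)%type]}) : Prop :=
  (exists a m m' n, z = pure (a *: m + m') n - (a *: pure m n + pure m' n)) \/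
  (exists a m n n', z = pure m (a *: n + n') - (a *: pure m n + pure m n')).

Definition tensor := quotmod (lspan bilin_relation).
HB.instance Definition _ := GRing.Lmodule.on tensor.

Definition tens (m : M) (n : N) : tensor := quot_class _ (pure m n).

Variables (P : lmodType R) (b : M -> N -> P).

(* [b] is meant to be bilinear; see [tens_lift_linear] and [tens_liftE]. *)
Definition tens_lift (t : tensor) : P :=
  free_lift (fun mn : M * N => b mn.1 mn.2) (repr t).

Hypothesis bl : forall n, linear (b^~ n).
Hypothesis br : forall m, linear (b m).

Lemma tens_lift_class z :
  tens_lift (quot_class _ z) = free_lift (fun mn : M * N => b mn.1 mn.2) z.
Proof.
apply/eqP; rewrite -subr_eq0 -linearB /=.
have: repr (quot_class (lspan bilin_relation) z) - z \in lspan bilin_relation.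
  by rewrite -quot_class_eq quot_reprK.
move/asboolP => /(_ (kerp (free_lift (fun mn : M * N => b mn.1 mn.2)))); apply.
move=> y [[a [m [m' [n ->]]]]|[a [m [n [n' ->]]]]]; rewrite unfold_in /kerp.
all: by rewrite linearB linearP /= !free_liftU /= ?bl ?br subrr.
Qed.

Lemma tens_liftE m n : tens_lift (tens m n) = b m n.
Proof. by rewrite tens_lift_class free_liftU. Qed.

Lemma tens_lift_linear : linear tens_lift.
Proof.
move=> a x y; rewrite -[x]quot_reprK -[y]quot_reprK -linearP !tens_lift_class.
exact: linearP.
Qed.
End Tensor.
Arguments tens {R M N} m n.

Section TensorBilinear.
Variables (R : comNzRingType) (M N : lmodType R).

Lemma tens_linearl (n : N) : linear (tens^~ n : M -> tensor M N).
Proof.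
move=> a m m'; apply/eqP; rewrite /tens -linearP quot_class_eq.
by apply/asboolP => S XS; apply: XS; left; exists a, m, m', n.
Qed.

Lemma tens_linearr (m : M) : linear (tens m : N -> tensor M N).
Proof.
move=> a n n'; apply/eqP; rewrite /tens -linearP quot_class_eq.
by apply/asboolP => S XS; apply: XS; right; exists a, m, n, n'.
Qed.
End TensorBilinear.

Section TensorMap.
Variables (R : comNzRingType) (M M' N N' : lmodType R).

Definition tens_map (f : M -> M') (g : N -> N') : tensor M N -> tensor M' N' :=
  tens_lift (fun m n => tens (f m) (g n)).

Variables (f : {linear M -> M'}) (g : {linear N -> N'}).

Lemma tens_map_linear : linear (tens_map f g).
Proof.
by apply: tens_lift_linear => [n a m m'|m a n n'];
  rewrite linearP (tens_linearl, tens_linearr).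
Qed.
HB.instance Definition _ :=
  GRing.isLinear.Build R (tensor M N) (tensor M' N') *:%R (tens_map f g) tens_map_linear.

Lemma tens_mapE m n : tens_map f g (tens m n) = tens (f m) (g n).
Proof.
rewrite /tens_map tens_liftE // => [n' a x y|x a y y'];
  by rewrite linearP (tens_linearl, tens_linearr).
Qed.
End TensorMap.

Definition flat (R : comNzRingType) (M : lmodType R) : Prop :=
  forall (N N' : lmodType R) (f : {linear N -> N'}),
    injective f -> injective (tens_map (idfun : M -> M) f).

(* [Tor M N] is the degree-one Tor module: the first homology of M (x) P, where
   ... -> P2 -> P1 -> P0 -> N is the resolution of N in which each P is the free
   module on the underlying set of the preceding kernel. *)
Section Tor.
Variable R : comNzRingType.

Section Resolution.
Variable N : lmodType R.
Definition free_res0 : lmodType R := {malg R[N]}.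
Definition free_aug : free_res0 -> N := free_lift idfun.
HB.instance Definition _ := GRing.Linear.on free_aug.
Definition free_res1 : lmodType R := {malg R[submodule (kerp free_aug)]}.
Definition free_d1 : free_res1 -> free_res0 := free_lift (@sm_val _ _ _).
HB.instance Definition _ := GRing.Linear.on free_d1.
Definition free_res2 : lmodType R := {malg R[submodule (kerp free_d1)]}.
Definition free_d2 : free_res2 -> free_res1 := free_lift (@sm_val _ _ _).
HB.instance Definition _ := GRing.Linear.on free_d2.
End Resolution.

Definition Tor (M N : lmodType R) : lmodType R :=
  subquot (kerp (tens_map (idfun : M -> M) (@free_d1 N)))
          (imp (tens_map (idfun : M -> M) (@free_d2 N))).

Variables (M M' N N' : lmodType R).

Definition free_res0_map (g : N -> N') : free_res0 N -> free_res0 N' :=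
  free_lift (fun n => << g n >>).
Definition free_res1_map (g : N -> N') : free_res1 N -> free_res1 N' :=
  free_lift (fun k => << insubd 0 (free_res0_map g (sm_val k)) >>).

Definition Tor_map (f : M -> M') (g : N -> N') : Tor M N -> Tor M' N' :=
  sq_map (tens_map f (free_res1_map g)).

End Tor.

Section DirectSum.
Variables (R : comNzRingType) (I : choiceType) (M : I -> lmodType R).
Local Open Scope classical_set_scope.

Record dsum := Dsum {
  dsum_val :> forall i, M i;
  dsum_finP : `[< finite_set [set i | dsum_val i != 0] >]
}.

HB.instance Definition _ := [isSub for dsum_val].
HB.instance Definition _ := [Choice of dsum by <:].

Lemma dsumP (x y : dsum) : (forall i, x i = y i) -> x = y.
Proof. by move=> xy; apply: val_inj; apply: functional_extensionality_dep. Qed.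

Lemma dsum_fin (x : dsum) : finite_set [set i | x i != 0].
Proof. exact/asboolP/dsum_finP. Qed.

Lemma dsum_zeroP : `[< finite_set [set i | (0 : M i) != 0] >].
Proof.
by apply/asboolP; rewrite (_ : mkset _ = set0) //; apply/seteqP; split=> i /=; rewrite ?eqxx.
Qed.
Definition dsum_zero := @Dsum (fun i => 0) dsum_zeroP.

Lemma dsum_addP (x y : dsum) : `[< finite_set [set i | x i + y i != 0] >].
Proof.
apply/asboolP/(sub_finite_set _ (_ : finite_set ([set i | x i != 0] `|` [set i | y i != 0]))).
  move=> i /=; case: (eqVneq (x i) 0) => [->|]; last by left.
  by rewrite add0r; right.
by rewrite finite_setU; split; apply: dsum_fin.
Qed.
Definition dsum_add (x y : dsum) := @Dsum (fun i => x i + y i) (dsum_addP x y).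

Lemma dsum_scaleP (a : R) (x : dsum) : `[< finite_set [set i | a *: x i != 0] >].
Proof.
apply/asboolP/(sub_finite_set _ (dsum_fin x)) => i /=.
by apply: contraNN => /eqP ->; rewrite scaler0.
Qed.
Definition dsum_scale a (x : dsum) := @Dsum (fun i => a *: x i) (dsum_scaleP a x).

Lemma dsum_addA : associative dsum_add.
Proof. by move=> x y z; apply: dsumP => i /=; rewrite addrA. Qed.
Lemma dsum_addC : commutative dsum_add.
Proof. by move=> x y; apply: dsumP => i /=; rewrite addrC. Qed.
Lemma dsum_add0 : left_id dsum_zero dsum_add.
Proof. by move=> x; apply: dsumP => i /=; rewrite add0r. Qed.
Lemma dsum_addN : left_inverse dsum_zero (dsum_scale (-1)) dsum_add.
Proof. by move=> x; apply: dsumP => i /=; rewrite scaleN1r addNr. Qed.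
HB.instance Definition _ :=
  GRing.isZmodule.Build dsum dsum_addA dsum_addC dsum_add0 dsum_addN.

Lemma dsum_scaleA a b x : dsum_scale a (dsum_scale b x) = dsum_scale (a * b) x.
Proof. by apply: dsumP => i /=; rewrite scalerA. Qed.
Lemma dsum_scale1 : left_id 1 dsum_scale.
Proof. by move=> x; apply: dsumP => i /=; rewrite scale1r. Qed.
Lemma dsum_scaleDr : right_distributive dsum_scale +%R.
Proof. by move=> a x y; apply: dsumP => i /=; rewrite scalerDr. Qed.
Lemma dsum_scaleDl x : {morph dsum_scale^~ x : a b / a + b}.
Proof. by move=> a b; apply: dsumP => i /=; rewrite scalerDl. Qed.
HB.instance Definition _ := GRing.Zmodule_isLmodule.Build R dsum
  dsum_scaleA dsum_scale1 dsum_scaleDr dsum_scaleDl.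

End DirectSum.

Definition dsum_lift (R : comNzRingType) (I : choiceType) (M : I -> lmodType R)
    (P : lmodType R) (phi : forall i, M i -> P) (x : dsum M) : P :=
  \sum_(i \in [set: I]) phi i (x i).

(* [insubd] only serves to discharge the finiteness of the support, which holds
   as soon as each [phi i] maps [0] to [0]. *)
Definition dsum_map (R : comNzRingType) (I : choiceType) (M N : I -> lmodType R)
    (phi : forall i, M i -> N i) (x : dsum M) : dsum N :=
  insubd (0 : dsum N) (fun i => phi i (x i)).

Definition linear_iso (R : comNzRingType) (M N : lmodType R) (f : M -> N) : Prop :=
  linear f /\ bijective f.

Definition short_exact (R : comNzRingType) (L M N : lmodType R)
    (f : L -> M) (g : M -> N) : Prop :=
  [/\ linear f /\ linear g, injective f,
      forall y, g y = 0 <-> exists x, y = f x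
    & forall z, exists y, g y = z].

Definition is_pid (R : idomainType) : Prop :=
  forall I : R -> Prop,
    I 0 -> (forall a x y, I x -> I y -> I (a * x + y)) ->
    exists a, forall x, I x <-> exists b, x = b * a.

(* Directed graphs *)

Record digraph := Digraph { vertex :> choiceType; edge : rel vertex }.

Record dimap (G H : digraph) := Dimap {
  dimap_fun :> G -> H;
  dimapP : forall x y, edge x y -> dimap_fun x = dimap_fun y \/
                                   edge (dimap_fun x) (dimap_fun y)
}.

Definition box (G H : digraph) : digraph :=
  @Digraph (G * H)%type (fun u v =>
    ((u.1 == v.1) && edge u.2 v.2) || ((u.2 == v.2) && edge u.1 v.1)).

Lemma id_dimapP (G : digraph) (x y : G) : edge x y -> idfun x = idfun y \/ edge (idfun x) (idfun y).
Proof. by right. Qed.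
Definition id_dimap (G : digraph) : dimap G G := Dimap (@id_dimapP G).

Section BoxMap.
Variables (G G' H H' : digraph) (f : dimap G G') (g : dimap H H').
Definition box_map_fun (u : box G H) : box G' H' := (f u.1, g u.2).
Lemma box_mapP (u v : box G H) :
  edge u v -> box_map_fun u = box_map_fun v \/ edge (box_map_fun u) (box_map_fun v).
Proof.
rewrite /box_map_fun /=; case/orP => /andP[/eqP eq_uv].
  by rewrite eq_uv => /(dimapP g)[->|e]; [left|right; rewrite eqxx e].
by rewrite eq_uv => /(dimapP f)[->|e]; [left|right; rewrite eqxx e orbT].
Qed.
Definition box_map : dimap (box G H) (box G' H') := Dimap box_mapP.
End BoxMap.

Section Distance.
Variable G : digraph.
Implicit Types (x y : G) (t : seq G).

Definition walk x y (n : nat) : Prop :=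
  exists p, [/\ path (@edge G) x p, last x p = y & size p = n].

(* [None] stands for infinity. *)
Definition dist x y : option nat :=
  if pselect (exists n, `[< walk x y n >]) is left e then Some (ex_minn e) else None.

(* A tuple (x_0, ..., x_k) is encoded as a sequence of size k + 1. *)
Definition nondegen t : bool :=
  if t is x :: s then path (fun a b => a != b) x s else false.

Definition reachable_tuple t : bool :=
  if t is x :: s then path (fun a b => (a != b) && (dist a b != None)) x s else false.

Definition tuple_length t : nat :=
  if t is x :: s then sumn (pairmap (fun a b => odflt 0%N (dist a b)) x s) else 0%N.
End Distance.

Section ReachabilityComplex.
Variable R : comNzRingType.

(* Chains of all degrees live in the free module on all finite sequences of
   vertices; [FRC l k] is the part F_l RC_k of it. *)
Definition chain (G : digraph) : lmodType R := {malg R[seq G]}.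

Section OneGraph.
Variable G : digraph.

Definition FRC (l k : int) : {pred chain G} := fun c =>
  all (fun t => [&& reachable_tuple t, (size t)%:Z == k + 1 & (tuple_length t)%:Z <= l])
      (msupp c).

Lemma FRC_submod l k : submod_closed (FRC l k).
Proof.
split=> [|a x y /allP Fx /allP Fy]; apply/allP => t; first by rewrite msupp0.
move/(fsubsetP (msuppD_le _ _)); rewrite in_fsetU => /orP[|/Fy //].
by move/(fsubsetP (msuppZ_le _ _))/Fx.
Qed.
HB.instance Definition _ l k :=
  GRing.isSubmodClosed.Build R (chain G) (FRC l k) (FRC_submod l k).

Definition tuple_chain (t : seq G) : chain G := if nondegen t then << t >> else 0.

Definition face (i : nat) (t : seq G) : seq G := take i t ++ drop i.+1 t.

Definition bd : chain G -> chain G :=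
  free_lift (fun t => \sum_(i < size t) (-1) ^+ i *: tuple_chain (face i t)).
HB.instance Definition _ := GRing.Linear.on bd.
End OneGraph.

Definition chain_map (G H : digraph) (f : dimap G H) : chain G -> chain H :=
  free_lift (fun t => tuple_chain (map f t)).
HB.instance Definition _ G H f := GRing.Linear.on (@chain_map G H f).

(* A lattice path is encoded by its steps: [true] increases the first
   coordinate, [false] the second one. *)
Section LatticePaths.
Implicit Types w : seq bool.
Definition lpoint w (k : nat) : nat * nat :=
  (count id (take k w), count negb (take k w)).

Definition strictly_below w (a b : nat) : bool :=
  all (fun k => ((lpoint w k).1 == a) ==> (b < (lpoint w k).2)%N) (iota 0 (size w).+1).

Definition below_count (p q : nat) w : nat :=
  \sum_(a < p.+1) \sum_(b < q.+1) strictly_below w a b.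
End LatticePaths.

Section Shuffle.
Variables G H : digraph.

Definition path_tuple (w : seq bool) (g0 : G) (gs : seq G) (h0 : H) (hs : seq H)
    : seq (box G H) :=
  [seq (nth g0 (g0 :: gs) (lpoint w k).1, nth h0 (h0 :: hs) (lpoint w k).2)
     | k <- iota 0 (size w).+1].

Definition shuffle (s : seq G) (t : seq H) : chain (box G H) :=
  match s, t with
  | g0 :: gs, h0 :: hs =>
      \sum_(w : (size gs + size hs).-tuple bool | count id w == size gs)
        (-1) ^+ below_count (size gs) (size hs) w *: << path_tuple w g0 gs h0 hs >>
  | _, _ => 0
  end.

Definition nabla_chain (a : chain G) (b : chain H) : chain (box G H) :=
  free_lift (fun s => free_lift (fun t => shuffle s t) b) a.
End Shuffle.

End ReachabilityComplex.
Arguments chain_map R {G H} f c.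

Section MPSS.
Variable R : comNzRingType.

Section Pages.
Variable G : digraph.
Local Notation C := (chain R G).

(* Z^r_{p,q}: the chains in F_p RC_{p+q} whose boundary lies in F_{p-r}. *)
Definition Zcyc (r p q : int) : {pred C} := fun x =>
  (x \in FRC p (p + q)) && (bd x \in FRC (p - r) (p + q - 1)).

Lemma Zcyc_submod r p q : submod_closed (Zcyc r p q).
Proof.
split=> [|a x y /andP[Fx dx] /andP[Fy dy]]; apply/andP; rewrite ?linear0 ?linearP.
  by rewrite !rpred0.
by rewrite !rpredD ?rpredZ.
Qed.
HB.instance Definition _ r p q :=
  GRing.isSubmodClosed.Build R C (Zcyc r p q) (Zcyc_submod r p q).

(* Z^{r-1}_{p-1,q+1} + bd Z^{r-1}_{p+r-1,q-r+2}; for r = 0 this is F_{p-1} RC_{p+q}. *)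
Definition Bcyc (r p q : int) : {pred C} := fun x =>
  `[< exists y z, [/\ y \in Zcyc (r - 1) (p - 1) (q + 1),
                      z \in Zcyc (r - 1) (p + r - 1) (q - r + 2)
                    & x = y + bd z] >].

Lemma Bcyc_submod r p q : submod_closed (Bcyc r p q).
Proof.
apply: submod_ofP => [|a _ _ [y [z [Zy Zz ->]]] [y' [z' [Zy' Zz' ->]]]].
  by exists 0, 0; rewrite !rpred0 linear0 addr0.
exists (a *: y + y'), (a *: z + z'); rewrite !rpredD ?rpredZ //; split=> //.
by rewrite linearP scalerDr addrACA.
Qed.
HB.instance Definition _ r p q :=
  GRing.isSubmodClosed.Build R C (Bcyc r p q) (Bcyc_submod r p q).

Definition mpss (r : nat) (p q : int) : lmodType R :=
  subquot (Zcyc r p q) (Bcyc r p q).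

Definition flat_below (s : nat) : Prop :=
  forall (r : nat) (p q : int), (r < s)%N -> flat (mpss r p q).
End Pages.

Definition mpss_map (G H : digraph) (f : dimap G H) (r : nat) (p q : int) :
  mpss G r p q -> mpss H r p q := sq_map (chain_map R f).

Arguments mpss_map {G H} f {r p q}.

Section Product.
Variables (G H : digraph) (r : nat).

(* The summand E^r_{m,n}(G) (x) E^r_{u,v}(H) with m + u = p and n + v = q is
   indexed by (m, n). *)
Definition mpss_tensor (p q : int) : lmodType R :=
  dsum (fun mn : int * int =>
    tensor (mpss G r mn.1 mn.2) (mpss H r (p - mn.1) (q - mn.2))).

Definition nabla_pair (m n u v p q : int) (x : mpss G r m n) (y : mpss H r u v) :
    mpss (box G H) r p q :=
  sq_class _ _ (nabla_chain (sq_repr x) (sq_repr y)).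

Definition nabla (p q : int) : mpss_tensor p q -> mpss (box G H) r p q :=
  dsum_lift (fun mn : int * int => tens_lift (@nabla_pair mn.1 mn.2 _ _ p q)).

(* The sum of the Tor(E^r_{m,n}(G), E^r_{u-r+1,v+r-2}(H)) with m + u = p, n + v = q. *)
Definition mpss_tor (p q : int) : lmodType R :=
  dsum (fun mn : int * int =>
    Tor (mpss G r mn.1 mn.2)
        (mpss H r (p - mn.1 - r%:Z + 1) (q - mn.2 + r%:Z - 2))).
End Product.

Section ProductMaps.
Variables (G G' H H' : digraph) (f : dimap G G') (g : dimap H H') (r : nat) (p q : int).

Definition mpss_tensor_map : mpss_tensor G H r p q -> mpss_tensor G' H' r p q :=
  dsum_map (fun mn : int * int => tens_map (mpss_map f) (mpss_map g)).

Definition mpss_tor_map : mpss_tor G H r p q -> mpss_tor G' H' r p q :=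
  dsum_map (fun mn : int * int => Tor_map (mpss_map f) (mpss_map g)).
End ProductMaps.

End MPSS.
Arguments flat_below R G s : clear implicits.
Arguments nabla R G H r p q : clear implicits.
Arguments mpss R G r p q : clear implicits.
Arguments mpss_tor R G H r p q : clear implicits.

(* Main.v *)
Require Import Defs.
From HB Require Import structures.
From mathcomp Require Import all_boot all_order all_algebra.
From mathcomp Require Import finmap monalg ring zify.
From mathcomp Require Import boolp classical_sets cardinality fsbigop.

(* Write E(G) for the total module of a page, graded by (p, q).  Over a principal
   ideal domain flat means torsion-free, so when E^r(G) is flat its submodules of
   cycles and boundaries are flat as well, and the classical Kunneth argument
   computes the homology of E^r(G) (x) E^r(H): it is an extension of
   Tor(E^(r+1)(G), E^(r+1)(H)) by E^(r+1)(G) (x) E^(r+1)(H).  By induction on r,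
   nabla^r identifies this homology with that of E^r(G [] H), that is with
   E^(r+1)(G [] H), and nabla^(r+1) becomes the inclusion of the extension.  As long
   as E^(r+1)(G) is flat the Tor term vanishes, nabla^(r+1) is an isomorphism and the
   induction continues.  It starts at r = 0 with the Eilenberg-Zilber theorem: the
   Alexander-Whitney map inverts the shuffle map up to a homotopy that prepends
   vertices to tuples, and neither increases lengths. *)

Set Implicit Arguments.
Unset Strict Implicit.
Unset Printing Implicit Defensive.

Import Order.TTheory GRing.Theory Num.Theory.
Local Open Scope ring_scope.

(** * Linear algebra and tensor products *)

(** Only [G] is flat, so cycles and homology of [H] are arbitrary modules, and for an arbitrary [N]
    the injectivity of [hZ (x) N -> M (x) N] has to come from the flatness of the quotient [M / hZ],
    which is the module [hB] of boundaries. The induction cannot carry bijectivity of nabla^r, which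
    fails in general for r = 0. It carries [kunneth_page]: the total map is injective on homology,
    and every homogeneous class of the product comes from a homogeneous cycle. Homogeneity puts the
    Tor term in its degree: a boundary component has been moved by d^(s-1), whose bidegree (1-s,
    s-2) is the shift in the statement. The connecting map depends on chosen cycles and chosen lifts
    to a resolution. It is therefore a relation first, shown to be linear, total and single-valued;
    naturality then means transporting witnesses. It passes through the kernel of
    [hB (x) E^s(H) -> hZ (x) E^s(H)]: [kun_rel] leads there from the product, and [tor_rel]
    identifies this kernel with Tor. All this happens on total modules, where a differential is an
    endomorphism; the part of degree k is extracted at the end. *)

Definition mklin (R : comNzRingType) (U V : lmodType R) (f : U -> V) (fl : linear f) :
    {linear U -> V} :=
  HB.pack f (GRing.isLinear.Build R U V *:%R f fl).

Section Submodule.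
Variables (R : comNzRingType) (U V : lmodType R).

Definition corestrict (f : {linear U -> V}) (S : submodClosed V)
    (fS : forall x, f x \in S) (x : U) : submodule S := Submodule (fS x).

Lemma corestrict_linear f S fS : linear (@corestrict f S fS).
Proof. by move=> a x y; apply: val_inj; rewrite /= !linearP. Qed.
HB.instance Definition _ f S fS :=
  GRing.isLinear.Build R U (submodule S) *:%R (@corestrict f S fS)
    (@corestrict_linear f S fS).

Lemma sm_val_inj (S : submodClosed V) : injective (@sm_val R V S).
Proof. exact: val_inj. Qed.

Lemma smN (S : submodClosed V) x : x \in S -> - x \in S.
Proof. by move=> xS; rewrite -scaleN1r rpredZ. Qed.

Lemma smB (S : submodClosed V) x y : x \in S -> y \in S -> x - y \in S.
Proof. by move=> xS yS; rewrite rpredD ?smN. Qed.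

Lemma mem_kerp (f : {linear U -> V}) x : (x \in kerp f) = (f x == 0).
Proof. by []. Qed.

Lemma mem_imp (f : {linear U -> V}) y : (y \in imp f) <-> exists x, y = f x.
Proof. by split=> [/asboolP|?]; last exact/asboolP. Qed.

Lemma injP0 (f : {linear U -> V}) : (forall x, f x = 0 -> x = 0) -> injective f.
Proof.
move=> f0 x y fxy; apply/eqP; rewrite -subr_eq0; apply/eqP/f0.
by rewrite linearB fxy subrr.
Qed.

End Submodule.

Section FreeModuleTheory.
Variables (R : comNzRingType) (K : choiceType).

Lemma malgUZ (a : R) (k : K) : << a *g k >> = a *: << k >> :> {malg R[K]}.
Proof.
by apply/malgP => k'; rewrite mcoeffZ !mcoeffU mulrnAr mulr1.
Qed.

Lemma malg_expand (g : {malg R[K]}) : g = \sum_(k <- msupp g) g@_k *: << k >>.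
Proof. by rewrite {1}[g]monalgE; apply: eq_bigr => k _; rewrite malgUZ. Qed.

Lemma malg_ind (P : {malg R[K]} -> Prop) :
  P 0 -> (forall a x y, P x -> P y -> P (a *: x + y)) -> (forall k, P << k >>) ->
  forall g, P g.
Proof.
move=> P0 PD PU g; rewrite [g]malg_expand; elim/big_rec: _ => // k x _.
exact: PD.
Qed.

Lemma malg_ext (M : lmodType R) (f g : {linear {malg R[K]} -> M}) :
  (forall k, f << k >> = g << k >>) -> f =1 g.
Proof.
by move=> fg; apply: malg_ind => [|a x y e1 e2|//]; rewrite ?linear0 // !linearP e1 e2.
Qed.

Lemma malg_ext0 (M : lmodType R) (f : {linear {malg R[K]} -> M}) :
  (forall k, f << k >> = 0) -> forall g, f g = 0.
Proof.
by move=> f0; apply: malg_ind => [|a x y e1 e2|//];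
  rewrite ?linear0 // linearP e1 e2 scaler0 addr0.
Qed.

End FreeModuleTheory.

Section SubquotTheory.
Variables (R : comNzRingType) (V : lmodType R) (Z B : submodClosed V).
Implicit Types (x : subquot Z B) (v w : V).

Lemma sq_reprP x : sq_repr x \in Z.
Proof. exact: sm_valP. Qed.

Lemma sm_val_insubd v : v \in Z -> sm_val (insubd (0 : submodule Z) v) = v.
Proof. by move=> vZ; rewrite -[LHS]/(val _) val_insubd vZ. Qed.

Lemma sq_reprK x : sq_class Z B (sq_repr x) = x.
Proof.
rewrite /sq_class /sq_repr -[RHS]quot_reprK; congr quot_class.
by apply: val_inj; rewrite val_insubd sq_reprP.
Qed.

Lemma sq_class_eq v w : v \in Z -> w \in Z ->
  sq_class Z B v = sq_class Z B w <-> v - w \in B.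
Proof.
move=> vZ wZ; have -> : (v - w \in B) = (sq_class Z B v == sq_class Z B w).
  rewrite quot_class_eq -[in RHS]topredE /= /sub_preim.
  by rewrite linearB /= !sm_val_insubd.
by split=> /eqP.
Qed.

Lemma sq_class_lin a v w : v \in Z -> w \in Z ->
  sq_class Z B (a *: v + w) = a *: sq_class Z B v + sq_class Z B w.
Proof.
move=> vZ wZ; rewrite /sq_class -linearP; congr quot_class; apply: val_inj.
rewrite linearP /= -![sm_val _]/(val _) !val_insubd vZ wZ.
by rewrite rpredD ?rpredZ.
Qed.

Lemma sq_class0 : sq_class Z B 0 = 0.
Proof.
have := @sq_class_lin 1 0 0 (rpred0 _) (rpred0 _).
by rewrite !scale1r add0r => /eqP; rewrite -[X in X == _]addr0 (inj_eq (addrI _)) => /eqP.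
Qed.

Lemma sq_class_eq0 v : v \in Z -> sq_class Z B v = 0 <-> v \in B.
Proof. by move=> vZ; rewrite -sq_class0 sq_class_eq ?rpred0 // subr0. Qed.

Lemma sq_repr_class v : v \in Z -> v - sq_repr (sq_class Z B v) \in B.
Proof. by move=> vZ; rewrite -sq_class_eq // ?sq_reprK // sq_reprP. Qed.

Lemma sq_ind (P : subquot Z B -> Prop) :
  (forall v, v \in Z -> P (sq_class Z B v)) -> forall x, P x.
Proof. by move=> PZ x; rewrite -[x]sq_reprK; apply/PZ/sq_reprP. Qed.

End SubquotTheory.

Section SubquotMapTheory.
Variables (R : comNzRingType) (V V' : lmodType R).
Variables (Z B : submodClosed V) (Z' B' : submodClosed V').
Variable phi : {linear V -> V'}.
Hypothesis phiZ : forall v, v \in Z -> phi v \in Z'.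
Hypothesis phiB : forall v, v \in Z -> v \in B -> phi v \in B'.

Lemma sq_mapE v : v \in Z -> sq_map phi (sq_class Z B v) = sq_class Z' B' (phi v).
Proof.
move=> vZ; apply/sq_class_eq; rewrite ?phiZ ?sq_reprP // -linearB phiB //.
  by rewrite smB ?sq_reprP.
by rewrite -opprB smN ?sq_repr_class.
Qed.

Lemma sq_map_linear : linear (sq_map phi : subquot Z B -> subquot Z' B').
Proof.
move=> a x y; elim/sq_ind: x => v vZ; elim/sq_ind: y => w wZ.
by rewrite -sq_class_lin // !sq_mapE ?rpredD ?rpredZ // linearP sq_class_lin ?phiZ.
Qed.

End SubquotMapTheory.

Definition idl (R : comNzRingType) (M : lmodType R) : {linear M -> M} := idfun.

(* The tensor product of [Defs] is used through this interface: as a variable,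
   it does not get unfolded by unification. *)
Record tensor_theory (R : comNzRingType) := TensorTheory {
  ten : lmodType R -> lmodType R -> lmodType R;
  tm_of : forall M N : lmodType R, M -> N -> ten M N;
  tmap_of : forall (M M' N N' : lmodType R), {linear M -> M'} -> {linear N -> N'} ->
    {linear ten M N -> ten M' N'};
  tlift_of : forall (M N P : lmodType R) (b : M -> N -> P),
    (forall n, linear (b^~ n)) -> (forall m, linear (b m)) -> {linear ten M N -> P};
  tm_linearl : forall (M N : lmodType R) (n : N), linear ((@tm_of M N)^~ n);
  tm_linearr : forall (M N : lmodType R) (m : M), linear (@tm_of M N m);
  ten_ind : forall (M N : lmodType R) (Q : ten M N -> Prop),
    Q 0 -> (forall x y, Q x -> Q y -> Q (x + y)) -> (forall m n, Q (tm_of m n)) ->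
    forall t, Q t;
  tm_mapE : forall (M M' N N' : lmodType R) (f : {linear M -> M'}) (g : {linear N -> N'}) m n,
    tmap_of f g (tm_of m n) = tm_of (f m) (g n);
  tm_liftE : forall (M N P : lmodType R) (b : M -> N -> P)
    (bl : forall n, linear (b^~ n)) (br : forall m, linear (b m)) m n,
    tlift_of bl br (tm_of m n) = b m n
}.

Section StandardTensor.
Variable R : comNzRingType.

(** A scalar multiple of a pure tensor is again pure, so sums of pure tensors already exhaust the
    module and no case for scalars is needed. *)
Lemma tensor_ind (M N : lmodType R) (Q : tensor M N -> Prop) :
  Q 0 -> (forall x y, Q x -> Q y -> Q (x + y)) -> (forall m n, Q (tens m n)) ->
  forall t, Q t.
Proof.
move=> Q0 QD Qt t; rewrite -[t]quot_reprK [repr t]malg_expand linear_sum.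
elim/big_rec: _ => // -[m n] x _; apply: QD; rewrite linearZZ.
have := Qt ((repr t)@_(m, n) *: m) n.
by rewrite (_ : tens _ _ = (repr t)@_(m, n) *: tens m n) //;
   apply: (linearZZ (mklin (tens_linearl n))).
Qed.

Definition std_tensor : tensor_theory R :=
  @TensorTheory R (fun M N => tensor M N) (fun M N => @tens R M N)
    (fun M M' N N' f g => tens_map f g)
    (fun M N P b bl br => mklin (tens_lift_linear bl br))
    (@tens_linearl R) (@tens_linearr R) tensor_ind (@tens_mapE R)
    (fun M N P b bl br => tens_liftE bl br).
End StandardTensor.

Section Tensors.
Variables (R : comNzRingType) (T : tensor_theory R).
Implicit Types M N P : lmodType R.
Local Notation TT := (ten T).
Local Notation tm := (tm_of T).
Local Notation tmap := (tmap_of T).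
Local Notation tlift := (tlift_of T).

Section Bilinear.
Variables (M N : lmodType R).

Definition tml (n : N) : {linear M -> TT M N} := mklin (@tm_linearl R T M N n).
Definition tmr (m : M) : {linear N -> TT M N} := mklin (@tm_linearr R T M N m).

Lemma tm0l n : tm 0 n = 0 :> TT M N. Proof. exact: (linear0 (tml n)). Qed.
Lemma tm0r m : tm m 0 = 0 :> TT M N. Proof. exact: (linear0 (tmr m)). Qed.
Lemma tmDl m m' n : tm (m + m') n = tm m n + tm m' n :> TT M N.
Proof. exact: (linearD (tml n)). Qed.
Lemma tmDr m n n' : tm m (n + n') = tm m n + tm m n' :> TT M N.
Proof. exact: (linearD (tmr m)). Qed.
Lemma tmNl m n : tm (- m) n = - tm m n :> TT M N.
Proof. exact: (linearN (tml n)). Qed.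
Lemma tmNr m n : tm m (- n) = - tm m n :> TT M N.
Proof. exact: (linearN (tmr m)). Qed.
Lemma tmZl a m n : tm (a *: m) n = a *: tm m n :> TT M N.
Proof. exact: (linearZZ (tml n)). Qed.
Lemma tmZr a m n : tm m (a *: n) = a *: tm m n :> TT M N.
Proof. exact: (linearZZ (tmr m)). Qed.
Lemma tm_suml (J : Type) (r : seq J) (f : J -> M) n :
  tm (\sum_(i <- r) f i) n = \sum_(i <- r) tm (f i) n :> TT M N.
Proof. exact: (linear_sum (tml n)). Qed.
Lemma tm_sumr (J : Type) (r : seq J) (f : J -> N) m :
  tm m (\sum_(i <- r) f i) = \sum_(i <- r) tm m (f i) :> TT M N.
Proof. exact: (linear_sum (tmr m)). Qed.
End Bilinear.

(** The main rewriting rule for tensor products of maps. Its hypotheses are pointwise, so that no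
    equality between bundled compositions of linear maps is ever required. *)
Lemma tmap_sq M M1 M2 M' N N1 N2 N' (f : {linear M -> M1}) (f' : {linear M1 -> M'})
    (g : {linear N -> N1}) (g' : {linear N1 -> N'})
    (h : {linear M -> M2}) (h' : {linear M2 -> M'})
    (k : {linear N -> N2}) (k' : {linear N2 -> N'}) :
  (forall m, f' (f m) = h' (h m)) -> (forall n, g' (g n) = k' (k n)) ->
  forall t, tmap f' g' (tmap f g t) = tmap h' k' (tmap h k t).
Proof.
move=> e1 e2; apply: ten_ind => [|x y exy e|m n]; first by rewrite !linear0.
  by rewrite !linearD exy e.
by rewrite !tm_mapE e1 e2.
Qed.

Lemma tmap_id M N (f : {linear M -> M}) (g : {linear N -> N}) :
  (forall m, f m = m) -> (forall n, g n = n) -> forall t, tmap f g t = t.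
Proof.
move=> ff gg; apply: ten_ind => [|x y e1 e2|m n]; first by rewrite linear0.
  by rewrite linearD e1 e2.
by rewrite tm_mapE ff gg.
Qed.

Lemma tmap_comp M M1 M' N N1 N' (f : {linear M -> M1}) (f' : {linear M1 -> M'})
    (g : {linear N -> N1}) (g' : {linear N1 -> N'})
    (h : {linear M -> M'}) (k : {linear N -> N'}) :
  (forall m, f' (f m) = h m) -> (forall n, g' (g n) = k n) ->
  forall t, tmap f' g' (tmap f g t) = tmap h k t.
Proof.
move=> e1 e2 t; rewrite (@tmap_sq _ _ _ _ _ _ _ _ f f' g g' (idl _) h (idl _) k) //.
by rewrite tmap_id.
Qed.

Lemma tmap_0l M M' N N' (f : {linear M -> M'}) (g : {linear N -> N'}) :
  (forall m, f m = 0) -> forall t, tmap f g t = 0.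
Proof.
move=> f0; apply: ten_ind => [|x y e1 e2|m n]; first by rewrite linear0.
  by rewrite linearD e1 e2 addr0.
by rewrite tm_mapE f0 tm0l.
Qed.

Lemma tmap_0r M M' N N' (f : {linear M -> M'}) (g : {linear N -> N'}) :
  (forall n, g n = 0) -> forall t, tmap f g t = 0.
Proof.
move=> f0; apply: ten_ind => [|x y e1 e2|m n]; first by rewrite linear0.
  by rewrite linearD e1 e2 addr0.
by rewrite tm_mapE f0 tm0r.
Qed.

Lemma tmap_surj M M' N N' (f : {linear M -> M'}) (g : {linear N -> N'}) :
  (forall y, exists x, f x = y) -> (forall y, exists x, g x = y) ->
  forall y, exists x, tmap f g x = y.
Proof.
move=> fs gs; apply: ten_ind => [|_ _ [x <-] [y <-]|m n].
- by exists 0; rewrite linear0.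
- by exists (x + y); rewrite linearD.
have [x <-] := fs m; have [y <-] := gs n.
by exists (tm x y); rewrite tm_mapE.
Qed.

Section Swap.
Variables M N : lmodType R.
Let sw (m : M) (n : N) := tm n m.
Lemma swap_linl n : linear (sw^~ n).
Proof. by move=> a m m'; rewrite /sw tmDr tmZr. Qed.
Lemma swap_linr m : linear (sw m).
Proof. by move=> a n n'; rewrite /sw tmDl tmZl. Qed.
Definition tswap : {linear TT M N -> TT N M} := tlift swap_linl swap_linr.
Lemma tswapE m n : tswap (tm m n) = tm n m. Proof. exact: tm_liftE. Qed.
End Swap.

Lemma tswapK M N : cancel (@tswap M N) (@tswap N M).
Proof.
apply: ten_ind => [|x y e1 e2|m n]; first by rewrite !linear0.
  by rewrite !linearD e1 e2.
by rewrite !tswapE.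
Qed.

Lemma tswap_map M M' N N' (f : {linear M -> M'}) (g : {linear N -> N'}) t :
  tswap _ _ (tmap f g t) = tmap g f (tswap _ _ t).
Proof.
elim/(@ten_ind R T): t => [|x y e1 e2|m n]; first by rewrite !linear0.
  by rewrite !linearD e1 e2.
by rewrite !(tm_mapE, tswapE).
Qed.

Section RightExact.
Variables (M N1 N N2 : lmodType R) (f : {linear N1 -> N}) (g : {linear N -> N2}).
Hypothesis gs : forall y, exists x, g x = y.
Hypothesis gf : forall x, g x = 0 -> exists y, x = f y.

(* The inverse of [M (x) N / im (1 (x) f) -> M (x) N2] sends [m (x) n2] to the
   class of [m (x) n] for any lift [n] of [n2]. *)
Lemma tens_right_exactr t :
  tmap (idl M) g t = 0 -> exists u, t = tmap (idl M) f u.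
Proof.
pose lift y := projT1 (cid (gs y)).
have liftK y : g (lift y) = y by rewrite /lift; case: cid.
pose Q := imp (tmap (idl M) f).
pose b (m : M) y : quotmod Q := quot_class Q (tm m (lift y)).
(* The chosen [lift] is not linear, but its failure to be linear lies in the kernel of [g], and
   tensors with such elements vanish modulo [Q]. *)
have kerQ (m : M) n : g n = 0 -> tm m n \in Q.
  by move=> /gf[y ->]; apply/mem_imp; exists (tm m y); rewrite tm_mapE.
have bl y : linear (b^~ y).
  by move=> a m m'; rewrite /b tmDl tmZl linearP.
have br m : linear (b m).
  move=> a y y'; rewrite /b -linearP /= -tmZr -tmDr; apply/eqP.
  rewrite quot_class_eq -tmNr -tmDr kerQ //.
  by rewrite linearB linearP /= !liftK subrr.
have E u : tlift bl br (tmap (idl M) g u) = quot_class Q u.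
  elim/(@ten_ind R T): u => [|x y e1 e2|m n]; first by rewrite !linear0.
    by rewrite !linearD e1 e2.
  rewrite tm_mapE tm_liftE /b; apply/eqP.
  by rewrite quot_class_eq -tmNr -tmDr kerQ // linearB liftK subrr.
move=> t0; apply/mem_imp; rewrite -[t]subr0 -quot_class_eq -E t0.
by rewrite !linear0.
Qed.

Lemma tens_right_exactl (t : TT N M) :
  tmap g (idl M) t = 0 -> exists u, t = tmap f (idl M) u.
Proof.
move=> t0; have /tens_right_exactr[u tu] : tmap (idl M) g (tswap _ _ t) = 0.
  by rewrite -tswap_map t0 linear0.
by exists (tswap _ _ u); rewrite -tswap_map -tu tswapK.
Qed.
End RightExact.

End Tensors.

(** * Flat modules over a principal ideal domain *)

Definition smv (R : comNzRingType) (V : lmodType R) (S : submodClosed V) :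
  {linear submodule S -> V} := @sm_val R V S.

Section SubmodPreds.
Variables (R : comNzRingType) (V : lmodType R).

Definition cap_pred (S S' : submodClosed V) : {pred V} := fun x => (x \in S) && (x \in S').
Lemma cap_submod S S' : submod_closed (cap_pred S S').
Proof.
split=> [|a x y /andP[Sx S'x] /andP[Sy S'y]]; apply/andP; first by rewrite !rpred0.
by rewrite !rpredD ?rpredZ.
Qed.
HB.instance Definition _ S S' :=
  GRing.isSubmodClosed.Build R V (cap_pred S S') (cap_submod S S').

Lemma mem_cap S S' x : (x \in cap_pred S S') = (x \in S) && (x \in S').
Proof. by []. Qed.

Definition preim_pred (U : lmodType R) (f : {linear U -> V}) (S : submodClosed V) : {pred U} :=
  fun x => f x \in S.
Lemma preim_submod U f S : submod_closed (@preim_pred U f S).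
Proof.
split=> [|a x y fx fy]; rewrite -topredE /= /preim_pred ?linear0 ?rpred0 //.
by rewrite linearP rpredD ?rpredZ.
Qed.
HB.instance Definition _ U f S :=
  GRing.isSubmodClosed.Build R U (@preim_pred U f S) (@preim_submod U f S).

Lemma mem_preim U f S x : (x \in @preim_pred U f S) = (f x \in S).
Proof. by []. Qed.

Definition supp_pred (K : choiceType) (p : pred K) : {pred {malg R[K]}} :=
  fun g => all p (msupp g).
Lemma supp_submod K p : submod_closed (@supp_pred K p).
Proof.
split=> [|a x y /allP px /allP py]; apply/allP => k; first by rewrite msupp0.
move/(fsubsetP (msuppD_le _ _)); rewrite in_fsetU => /orP[|/py //].
by move/(fsubsetP (msuppZ_le _ _))/px.
Qed.
HB.instance Definition _ K p :=
  GRing.isSubmodClosed.Build R {malg R[K]} (@supp_pred K p) (@supp_submod K p).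

End SubmodPreds.

Lemma coef_linear (R : comNzRingType) (K : choiceType) (k : K) :
  linear (fun g : {malg R[K]} => g@_k : R^o).
Proof. by move=> a x y; rewrite mcoeffD mcoeffZ. Qed.

Definition coefl (R : comNzRingType) (K : choiceType) (k : K) : {linear {malg R[K]} -> R^o} :=
  mklin (@coef_linear R K k).

Section Flatness.
Variables (R : comNzRingType) (T : tensor_theory R).
Implicit Types M N P : lmodType R.
Local Notation TT := (ten T).
Local Notation tm := (tm_of T).
Local Notation tmap := (tmap_of T).
Local Notation tlift := (tlift_of T).

(** Over [std_tensor] this is convertible to [flat]. *)
Definition tflat M : Prop := forall N N' (f : {linear N -> N'}),
  injective f -> injective (tmap (idl M) f).

(** Factor [g] through its image: flatness makes the tensored inclusion of [imp g] injective, and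
    what remains is right exactness for the surjection onto [imp g]. *)
Lemma tflat_exact M N1 N N2 (f : {linear N1 -> N}) (g : {linear N -> N2}) :
  tflat M -> (forall x, g x = 0 -> exists y, x = f y) ->
  forall t, tmap (idl M) g t = 0 -> exists u, t = tmap (idl M) f u.
Proof.
move=> flM gf t gt0; have gI x : g x \in imp g by apply/mem_imp; exists x.
have := @tens_right_exactr R T M N1 N _ f (corestrict gI); apply.
- by case=> y yI; have /mem_imp[x yx] := yI; exists x; apply: val_inj.
- by move=> x [/gf].
apply: (flM _ _ (smv (imp g)) (@sm_val_inj _ _ _)).
by rewrite linear0 (@tmap_comp _ _ _ _ _ _ _ _ _ _ _ _ (idl M) g).
Qed.

Lemma tflat_injl M N N' (f : {linear N -> N'}) :
  tflat M -> injective f -> injective (tmap f (idl M)).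
Proof.
move=> flM finj x y /(congr1 (@tswap _ T _ _)); rewrite !tswap_map.
by move/(flM _ _ _ finj)/(can_inj (@tswapK _ T _ _)).
Qed.

Definition torsion_free M : Prop := forall (a : R) (m : M), a *: m = 0 -> a = 0 \/ m = 0.

Lemma torsion_free_sub M N (f : {linear N -> M}) :
  injective f -> torsion_free M -> torsion_free N.
Proof.
move=> finj tfM a n an0; have := tfM a (f n); rewrite -linearZZ an0 linear0.
case=> // [|fn0]; first by left.
by right; apply: finj; rewrite fn0 linear0.
Qed.

Section ScalarAction.
Variable M : lmodType R.
Let act (m : M) (r : R^o) := (r : R) *: m.
Lemma act_linl r : linear (act^~ r).
Proof. by move=> a m m'; rewrite /act scalerDr !scalerA mulrC. Qed.
Lemma act_linr m : linear (act m).
Proof. by move=> a r r'; rewrite /act scalerDl scalerA. Qed.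
(** This retraction of [m |-> m (x) 1] lets an equation between tensors with [R] be read in [M]. *)
Definition tact : {linear TT M R^o -> M} := tlift act_linl act_linr.
Lemma tactE m r : tact (tm m r) = (r : R) *: m. Proof. exact: tm_liftE. Qed.
End ScalarAction.

End Flatness.

Section PID.
Variables (R : idomainType) (T : tensor_theory R).
Hypothesis pidR : is_pid R.
Implicit Types M N P : lmodType R.
Local Notation TT := (ten T).
Local Notation tm := (tm_of T).
Local Notation tmap := (tmap_of T).
Local Notation tlift := (tlift_of T).

(** For [a != 0] multiplication by [a] on [R] is injective, hence so is its tensor product with [M],
    which sends [m (x) 1] to [a m (x) 1 = 0]. *)
Lemma tflat_torsion_free M : tflat T M -> torsion_free M.
Proof.
move=> flM a m am0; have [->|a0] := eqVneq a 0; [by left|right].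
have la : linear (fun r : R^o => a *: r : R^o).
  by move=> b x y; rewrite scalerDr !scalerA mulrC.
have ainj : injective (mklin la).
  by move=> x y; apply: (mulfI a0).
have e : tm m (1 : R^o) = 0.
  apply: (flM _ _ _ ainj); rewrite tm_mapE linear0 /=.
  by rewrite tmZr -tmZl am0 tm0l.
by rewrite -[m]scale1r -(tactE T m (1 : R^o)) e linear0.
Qed.

Lemma torsion_free_free (K : choiceType) : torsion_free {malg R[K]}.
Proof.
move=> a g ag0; have [->|a0] := eqVneq a 0; [by left|right].
apply/malgP => k; have := mcoeffZ a g k; rewrite ag0 mcoeff0 => /esym/eqP.
by rewrite mulf_eq0 (negPf a0) => /eqP.
Qed.

Section FiniteRank.
Variables (M : lmodType R) (K : choiceType).
Hypothesis tfM : torsion_free M.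
Local Notation F := ({malg R[K]} : lmodType R).

(* Induction on the support [k :: Y]: [A] is generated by the elements with
   vanishing [k]-coordinate together with one [a0] whose [k]-coordinate
   generates the ideal of all [k]-coordinates. *)
Lemma tens_sub_finite_rank (Y : seq K) (A : submodClosed F) :
  (forall a, a \in A -> forall k, k \notin Y -> a@_k = 0) ->
  forall t, tmap (idl M) (smv A) t = 0 -> t = 0.
Proof.
elim: Y A => [|k Y IH] A supA t t0.
  elim/(@ten_ind R T): t t0 => [//|x y IHx IHy _|m n _].
    have x0 (z : submodule A) : z = 0.
      by apply: val_inj; apply/malgP => k; rewrite mcoeff0 (supA _ (sm_valP z)).
    suff e0 (z : TT M (submodule A)) : z = 0 by rewrite [x]e0 [y]e0 addr0.
    elim/(@ten_ind R T): z => [//|u v -> ->|m n]; first by rewrite addr0.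
    by rewrite [n]x0 tm0r.
  suff -> : n = 0 by rewrite tm0r.
  by apply: val_inj; apply/malgP => k; rewrite mcoeff0 (supA _ (sm_valP n)).
pose A' := cap_pred A (kerp (coefl R k)).
have A'P a : (a \in A') = (a \in A) && (a@_k == 0) by [].
have A'A (a : submodule A') : smv A' a \in A by case: a => a /=; rewrite A'P => /andP[].
pose inc := corestrict A'A.
have [g gP] : exists g, forall r, (exists2 a, a \in A & r = a@_k) <-> exists b, r = b * g.
  apply: pidR => [|a _ _ [x Ax ->] [y Ay ->]]; first by exists 0; rewrite ?rpred0 ?mcoeff0.
  by exists (a *: x + y); rewrite ?rpredD ?rpredZ // mcoeffD mcoeffZ.
have [a0 Aa0 ga0] : exists2 a, a \in A & g = a@_k by apply/gP; exists 1; rewrite mul1r.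
pose e0 : submodule A := Submodule Aa0.
(* The quotient of [A] by [A'] is generated by [e0], so a single pure tensor with [e0] accounts for
   everything outside [A']. *)
have [t' [m tE]] : exists t' m, t = tmap (idl M) inc t' + tm m e0.
  elim/(@ten_ind R T): t {t0} => [|x y [t1 [m1 ->]] [t2 [m2 ->]]|m n].
  - by exists 0, 0; rewrite linear0 tm0l addr0.
  - by exists (t1 + t2), (m1 + m2); rewrite linearD tmDl addrACA.
  have [b nb] : exists b, (sm_val n)@_k = b * g by apply/gP; exists (sm_val n); rewrite ?sm_valP.
  have n'P : sm_val n - b *: a0 \in A'.
    by rewrite A'P smB ?rpredZ ?sm_valP //= mcoeffB mcoeffZ nb ga0 subrr.
  exists (tm m (Submodule n'P)), (b *: m); rewrite tm_mapE tmZl -tmZr -tmDr.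
  congr (tm _ _); apply: val_inj.
  by rewrite -![val _]/(smv A _) linearD [smv A (b *: _)]linearZZ /= subrK.
have incE u : tmap (idl M) (smv A) (tmap (idl M) inc u) = tmap (idl M) (smv A') u.
  exact: tmap_comp.
(* The [k]-coordinate kills the part over [A'] and sends [e0] to [g], so applied to [t0] it leaves
   [g *: m]. *)
have gm0 : g *: m = 0.
  have := congr1 (tmap (idl M) (coefl R k)) t0; rewrite tE linearD incE !linearD linear0.
  rewrite (@tmap_comp _ _ _ _ _ _ _ _ _ _ _ _ (idl M) (coefl R k \o smv A')) //.
  rewrite tmap_0r ?add0r => [|a]; last first.
    by have := sm_valP a; rewrite A'P => /andP[_ /eqP].
  rewrite !tm_mapE => /(congr1 (tact T M)); rewrite linear0 tactE.
  by rewrite [coefl R k _]/= -ga0.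
suff [u tu] : exists u, t = tmap (idl M) inc u.
  rewrite tu (IH A' _ u) ?linear0 // => [a|]; last by rewrite -incE -tu.
  rewrite A'P => /andP[Aa /eqP ak] z zY; have [->//|zk] := eqVneq z k.
  by rewrite supA // inE negb_or zk.
(* If [m = 0] the extra term is absent; if [g = 0] then [a0] itself lies in [A']. In both cases [t]
   comes from [A']. *)
have [g0|m0] := tfM gm0; last by exists t'; rewrite tE m0 tm0l addr0.
have a0P : a0 \in A' by rewrite A'P Aa0 -ga0 g0 eqxx.
exists (t' + tm m (Submodule a0P)); rewrite tE linearD tm_mapE; congr (_ + tm _ _).
exact: val_inj.
Qed.

(** A tensor involves finitely many elements of [A], hence finitely many basis elements [Y]; it
    comes from the elements of [A] supported in [Y], where the finite case applies. *)
Lemma tens_sub_free (A : submodClosed F) : injective (tmap (idl M) (smv A)).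
Proof.
apply: injP0 => t t0.
have capA (Y : seq K) (a : submodule (cap_pred A (supp_pred (mem Y)))) : smv _ a \in A.
  by case: a => a /=; rewrite mem_cap => /andP[].
pose inc Y := corestrict (capA Y).
have [Y [u tu]] : exists Y u, t = tmap (idl M) (inc Y) u.
  elim/(@ten_ind R T): t {t0} => [|_ _ [Y [u ->]] [Y' [u' ->]]|m n].
  - by exists nil, 0; rewrite linear0.
  - have le1 (a : submodule (cap_pred A (supp_pred (mem Y)))) :
        smv _ a \in cap_pred A (supp_pred (mem (Y ++ Y'))).
      case: a => a /=; rewrite !mem_cap => /andP[-> /allP aY] /=.
      by apply/allP => k /aY /=; rewrite mem_cat => ->.
    have le2 (a : submodule (cap_pred A (supp_pred (mem Y')))) :
        smv _ a \in cap_pred A (supp_pred (mem (Y ++ Y'))).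
      case: a => a /=; rewrite !mem_cap => /andP[-> /allP aY] /=.
      by apply/allP => k /aY /=; rewrite mem_cat orbC => ->.
    exists (Y ++ Y'), (tmap (idl M) (corestrict le1) u + tmap (idl M) (corestrict le2) u').
    rewrite linearD; congr (_ + _); apply/esym; apply: tmap_comp => // a;
      exact: val_inj.
  have nP : sm_val n \in cap_pred A (supp_pred (mem (msupp (sm_val n)))).
    by rewrite mem_cap sm_valP; apply/allP => k ?.
  exists (msupp (sm_val n)), (tm m (Submodule nP)).
  by rewrite tm_mapE; congr tm; apply: val_inj.
rewrite tu (@tens_sub_finite_rank Y _ _ u) ?linear0 //.
  move=> a; rewrite mem_cap => /andP[_ /allP aY] k; apply: contraNeq.
  by rewrite mcoeff_neq0 => /aY.
by rewrite -t0 tu; apply/esym; apply: tmap_comp.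
Qed.

End FiniteRank.

(** Reduction to submodules of free modules. Let [A] be the preimage of [imp f] under the free cover
    [fa] of [N']; it maps onto [N] by [pr]. A lift [u] of [t] to [M (x) A] becomes, in the tensor
    product with the free cover, an element coming from the kernel of [fa]. This kernel lies in [A],
    so by injectivity [u] itself comes from it, and [pr] kills the kernel. *)
Lemma torsion_free_tflat M : torsion_free M -> tflat T M.
Proof.
move=> tfM N N' f finj; apply: injP0 => t t0.
pose fa := @free_aug R N' : {linear free_res0 N' -> N'}.
have faS y : exists x, fa x = y by exists << y >>; apply: free_liftU.
pose A := preim_pred fa (imp f).
have AP (a : submodule A) : exists n, f n = fa (sm_val a).
  by have := sm_valP a; rewrite mem_preim => /mem_imp[n e]; exists n.
pose pr a := projT1 (cid (AP a)).
have prE a : f (pr a) = fa (sm_val a) by rewrite /pr; case: cid.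
have prL : linear pr.
  by move=> c x y; apply: finj; rewrite linearP !prE !linearP.
have prS n : exists a, mklin prL a = n.
  have [x xn] := faS (f n); have xA : x \in A.
    by rewrite mem_preim; apply/mem_imp; exists n.
  by exists (Submodule xA); apply: finj; rewrite prE.
have [u tu] := tmap_surj (fun m : M => ex_intro (fun x => idl M x = m) m erefl) prS t.
have kA (k : submodule (kerp fa)) : smv _ k \in A.
  by case: k => k /= /eqP fk; rewrite mem_preim fk rpred0.
have [k uk] : exists k, tmap (idl M) (smv A) u = tmap (idl M) (smv (kerp fa)) k.
  apply: (tens_right_exactr faS) => [x x0|].
    have xk : x \in kerp fa by apply/eqP.
    by exists (Submodule xk).
  rewrite (@tmap_sq _ _ _ _ _ _ _ _ _ _ _ _ _ _ (idl M) (idl M) (mklin prL) f) //.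
  by rewrite tu.
have uk' : u = tmap (idl M) (corestrict kA) k.
  apply: (tens_sub_free tfM); rewrite uk; apply/esym; exact: tmap_comp.
rewrite -tu uk' (@tmap_comp _ _ _ _ _ _ _ _ _ _ _ _ (idl M) (mklin prL \o corestrict kA)) //.
rewrite tmap_0r // => k'; apply: finj; rewrite prE linear0.
by have /eqP := sm_valP k'.
Qed.

Lemma tflat_sub M N (f : {linear N -> M}) : injective f -> tflat T M -> tflat T N.
Proof. by move=> fi /tflat_torsion_free /(torsion_free_sub fi) /torsion_free_tflat. Qed.

Lemma tflat_free (K : choiceType) : tflat T {malg R[K]}.
Proof. exact/torsion_free_tflat/torsion_free_free. Qed.

End PID.

(** * Tor *)

Section FreeResolution.
Variables (R : comNzRingType).

Section Objects.
Variable N : lmodType R.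
Definition fa : {linear free_res0 N -> N} := @free_aug R N.
Definition fd1 : {linear free_res1 N -> free_res0 N} := @free_d1 R N.
Definition fd2 : {linear free_res2 N -> free_res1 N} := @free_d2 R N.

Lemma fa_surj n : exists x, fa x = n.
Proof. by exists << n >>; apply: free_liftU. Qed.

Lemma fd1_exact x : fa x = 0 -> exists y, x = fd1 y.
Proof.
move=> x0; have xk : x \in kerp (@free_aug R N) by apply/eqP.
by exists << Submodule xk >>; apply/esym/free_liftU.
Qed.

Lemma fd2_exact x : fd1 x = 0 -> exists y, x = fd2 y.
Proof.
move=> x0; have xk : x \in kerp (@free_d1 R N) by apply/eqP.
by exists << Submodule xk >>; apply/esym/free_liftU.
Qed.

Lemma fa_fd1 x : fa (fd1 x) = 0.
Proof.
apply: (@malg_ext0 R _ _ (fa \o fd1)) => k.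
by rewrite /= /free_d1 free_liftU; apply/eqP/(sm_valP k).
Qed.

Lemma fd1_fd2 x : fd1 (fd2 x) = 0.
Proof.
apply: (@malg_ext0 R _ _ (fd1 \o fd2)) => k.
by rewrite /= /free_d2 free_liftU; apply/eqP/(sm_valP k).
Qed.
End Objects.

Section Maps.
Variables (N N' : lmodType R) (g : {linear N -> N'}).

Definition fr0 : {linear free_res0 N -> free_res0 N'} :=
  free_lift (fun n => << g n >> : free_res0 N').
Definition fr1 : {linear free_res1 N -> free_res1 N'} :=
  free_lift (fun k => << insubd 0 (free_res0_map g (sm_val k)) >> : free_res1 N').

Lemma fa_fr0 x : fa _ (fr0 x) = g (fa _ x).
Proof.
apply: (@malg_ext R N N' (fa N' \o fr0) (g \o fa N)) x => k /=.
by rewrite /free_aug !free_liftU.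
Qed.

Lemma fr0_ker (k : submodule (kerp (@free_aug R N))) :
  fr0 (sm_val k) \in kerp (@free_aug R N').
Proof.
have /eqP k0 := sm_valP k; apply/eqP/(etrans (fa_fr0 _)).
exact: etrans (congr1 g k0) (linear0 g).
Qed.

Lemma fd1_fr1 x : fd1 _ (fr1 x) = fr0 (fd1 _ x).
Proof.
apply: (@malg_ext R _ _ (fd1 N' \o fr1) (fr0 \o fd1 N)) x => k /=.
by rewrite /free_d1 !free_liftU sm_val_insubd //; apply: fr0_ker.
Qed.

Lemma fr1_ker (k : submodule (kerp (@free_d1 R N))) :
  fr1 (sm_val k) \in kerp (@free_d1 R N').
Proof.
have /eqP k0 := sm_valP k; apply/eqP/(etrans (fd1_fr1 _)).
exact: etrans (congr1 fr0 k0) (linear0 fr0).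
Qed.

(** [Tor_map] only uses the lift of [g] to [free_res1]; this further lift shows that it preserves
    boundaries. *)
Definition fr2 : {linear free_res2 N -> free_res2 N'} :=
  free_lift (fun k => << Submodule (fr1_ker k) >> : free_res2 N').

Lemma fd2_fr2 x : fd2 _ (fr2 x) = fr1 (fd2 _ x).
Proof.
apply: (@malg_ext R _ _ (fd2 N' \o fr2) (fr1 \o fd2 N)) x => k /=.
by rewrite /free_d2 !free_liftU.
Qed.
End Maps.

Lemma fr0_comp (N N' N'' : lmodType R) (g : {linear N -> N'}) (g' : {linear N' -> N''})
    (k : {linear N -> N''}) : (forall n, g' (g n) = k n) ->
  forall x, fr0 g' (fr0 g x) = fr0 k x.
Proof.
move=> e; apply: (@malg_ext R _ _ (fr0 g' \o fr0 g) (fr0 k)) => n.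
by rewrite /= !free_liftU e.
Qed.

Lemma fr1_comp (N N' N'' : lmodType R) (g : {linear N -> N'}) (g' : {linear N' -> N''})
    (k : {linear N -> N''}) : (forall n, g' (g n) = k n) ->
  forall x, fr1 g' (fr1 g x) = fr1 k x.
Proof.
move=> e; apply: (@malg_ext R _ _ (fr1 g' \o fr1 g) (fr1 k)) => n.
rewrite /= !free_liftU; congr << _ >>; congr insubd.
by rewrite sm_val_insubd ?fr0_ker //; apply: fr0_comp.
Qed.

Lemma fr1_id (N : lmodType R) (g : {linear N -> N}) : (forall n, g n = n) -> forall x, fr1 g x = x.
Proof.
move=> e; apply: (@malg_ext R _ _ (fr1 g) idfun) => k.
rewrite /= free_liftU; congr << _ >>; apply: val_inj.
rewrite -[LHS]/(sm_val _) sm_val_insubd ?fr0_ker //.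
apply: (@malg_ext R _ _ (fr0 g) idfun) => n.
by rewrite /= free_liftU e.
Qed.

End FreeResolution.

(* Like [tensor_theory], an interface that keeps the resolution of [Defs] from
   being unfolded. *)
Record resolution_theory (R : comNzRingType) := ResolutionTheory {
  res0 : lmodType R -> lmodType R;
  res1 : lmodType R -> lmodType R;
  res2 : lmodType R -> lmodType R;
  resa : forall N, {linear res0 N -> N};
  resd1 : forall N, {linear res1 N -> res0 N};
  resd2 : forall N, {linear res2 N -> res1 N};
  res0m : forall (N N' : lmodType R), {linear N -> N'} -> {linear res0 N -> res0 N'};
  res1m : forall (N N' : lmodType R), {linear N -> N'} -> {linear res1 N -> res1 N'};
  res2m : forall (N N' : lmodType R), {linear N -> N'} -> {linear res2 N -> res2 N'};
  resa_surj : forall N n, exists x, resa N x = n;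
  resd1_exact : forall N x, resa N x = 0 -> exists y, x = resd1 N y;
  resd2_exact : forall N x, resd1 N x = 0 -> exists y, x = resd2 N y;
  resa_d1 : forall N x, resa N (resd1 N x) = 0;
  resd1_d2 : forall N x, resd1 N (resd2 N x) = 0;
  resa_m : forall (N N' : lmodType R) (g : {linear N -> N'}) x, resa _ (res0m g x) = g (resa _ x);
  resd1_m : forall (N N' : lmodType R) (g : {linear N -> N'}) x, resd1 _ (res1m g x) = res0m g (resd1 _ x);
  resd2_m : forall (N N' : lmodType R) (g : {linear N -> N'}) x, resd2 _ (res2m g x) = res1m g (resd2 _ x);
  res1m_comp : forall (N N' N'' : lmodType R) (g : {linear N -> N'}) (g' : {linear N' -> N''})
    (k : {linear N -> N''}), (forall n, g' (g n) = k n) ->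
    forall x, res1m g' (res1m g x) = res1m k x;
  res1m_id : forall (N : lmodType R) (g : {linear N -> N}), (forall n, g n = n) ->
    forall x, res1m g x = x
}.

Definition std_resolution (R : comNzRingType) : resolution_theory R :=
  ResolutionTheory (@fa_surj R) (@fd1_exact R) (@fd2_exact R) (@fa_fd1 R) (@fd1_fd2 R)
    (@fa_fr0 R) (@fd1_fr1 R) (@fd2_fr2 R) (@fr1_comp R) (@fr1_id R).

Section TorTheory.
Variables (R : comNzRingType) (T : tensor_theory R) (Q : resolution_theory R).
Local Notation TT := (ten T).
Local Notation tm := (tm_of T).
Local Notation tmap := (tmap_of T).
Local Notation tlift := (tlift_of T).
Implicit Types M N : lmodType R.

Definition TorT M N : lmodType R :=
  subquot (kerp (tmap (idl M) (resd1 Q N))) (imp (tmap (idl M) (resd2 Q N))).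

Definition tor_class M N (u : TT M (res1 Q N)) : TorT M N :=
  sq_class (kerp (tmap (idl M) (resd1 Q N))) (imp (tmap (idl M) (resd2 Q N))) u.

Lemma tor_class_lin M N a (u v : TT M (res1 Q N)) :
  tmap (idl M) (resd1 Q N) u = 0 -> tmap (idl M) (resd1 Q N) v = 0 ->
  tor_class (a *: u + v) = a *: tor_class u + tor_class v.
Proof. by move=> u0 v0; apply: sq_class_lin; apply/eqP. Qed.

Lemma tor_class_eq0 M N (u : TT M (res1 Q N)) :
  tmap (idl M) (resd1 Q N) u = 0 ->
  tor_class u = 0 <-> exists v, u = tmap (idl M) (resd2 Q N) v.
Proof. by move=> u0; rewrite -mem_imp; apply: sq_class_eq0; apply/eqP. Qed.

Lemma tor_ind M N (P : TorT M N -> Prop) :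
  (forall u, tmap (idl M) (resd1 Q N) u = 0 -> P (tor_class u)) -> forall x, P x.
Proof. by move=> Pu; apply: sq_ind => u /eqP; apply: Pu. Qed.

Lemma tor_class_0 M N : tor_class (0 : TT M (res1 Q N)) = 0.
Proof. exact: sq_class0. Qed.

Definition tor_map M M' N N' (f : {linear M -> M'}) (g : {linear N -> N'})
    (x : TorT M N) : TorT M' N' := sq_map (tmap f (res1m Q g)) x.

Section TorMap.
Variables (M M' N N' : lmodType R) (f : {linear M -> M'}) (g : {linear N -> N'}).

Lemma tor_map_cycle (u : TT M (res1 Q N)) : tmap (idl M) (resd1 Q N) u = 0 ->
  tmap (idl M') (resd1 Q N') (tmap f (res1m Q g) u) = 0.
Proof.
move=> u0; rewrite (@tmap_sq _ _ _ _ _ _ _ _ _ _ _ _ _ _ (idl M) f (resd1 Q N) (res0m Q g)) //.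
  by rewrite u0 linear0.
by move=> n; rewrite resd1_m.
Qed.

Lemma tor_map_kerp u : u \in kerp (tmap (idl M) (resd1 Q N)) ->
  tmap f (res1m Q g) u \in kerp (tmap (idl M') (resd1 Q N')).
Proof. by move/eqP => u0; apply/eqP/tor_map_cycle. Qed.

Lemma tor_map_imp u : u \in kerp (tmap (idl M) (resd1 Q N)) ->
  u \in imp (tmap (idl M) (resd2 Q N)) -> tmap f (res1m Q g) u \in imp (tmap (idl M') (resd2 Q N')).
Proof.
move=> _ /mem_imp[v ->]; apply/mem_imp; exists (tmap f (res2m Q g) v).
by apply/esym; apply: tmap_sq => // n; rewrite resd2_m.
Qed.

Lemma tor_mapE (u : TT M (res1 Q N)) : tmap (idl M) (resd1 Q N) u = 0 ->
  tor_map f g (tor_class u) = tor_class (tmap f (res1m Q g) u).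
Proof. by move=> u0; apply: (sq_mapE tor_map_kerp tor_map_imp); apply/eqP. Qed.

Lemma tor_map_linear : linear (tor_map f g).
Proof. exact: (sq_map_linear tor_map_kerp tor_map_imp). Qed.

Definition tor_mapl : {linear TorT M N -> TorT M' N'} := mklin tor_map_linear.
End TorMap.

Lemma tor_map_comp M M1 M' N N1 N' (f : {linear M -> M1}) (f' : {linear M1 -> M'})
    (g : {linear N -> N1}) (g' : {linear N1 -> N'})
    (h : {linear M -> M'}) (k : {linear N -> N'}) :
  (forall m, f' (f m) = h m) -> (forall n, g' (g n) = k n) ->
  forall t, tor_map f' g' (tor_map f g t) = tor_map h k t.
Proof.
move=> e1 e2; apply: tor_ind => u u0; rewrite !tor_mapE ?tor_map_cycle //.
by congr tor_class; apply: tmap_comp => // n; apply: res1m_comp.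
Qed.

Lemma tor_map_id M N (f : {linear M -> M}) (g : {linear N -> N}) :
  (forall m, f m = m) -> (forall n, g n = n) -> forall t, tor_map f g t = t.
Proof.
move=> e1 e2; apply: tor_ind => u u0; rewrite !tor_mapE // tmap_id //.
exact: res1m_id.
Qed.

Lemma tor_map_0l M M' N N' (f : {linear M -> M'}) (g : {linear N -> N'}) :
  (forall m, f m = 0) -> forall t, tor_map f g t = 0.
Proof. by move=> f0; apply: tor_ind => u u0; rewrite tor_mapE // tmap_0l // tor_class_0. Qed.

(** Tensoring with a flat module keeps the resolution exact at [res1]. *)
Lemma tor_flat0 M N : tflat T M -> forall x : TorT M N, x = 0.
Proof.
move=> flM; apply: tor_ind => u u0; apply/tor_class_eq0 => //.
exact: (tflat_exact flM (@resd2_exact _ Q N)).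
Qed.

Section TorRelation.
Variables (B Z M : lmodType R) (j : {linear B -> Z}) (h : {linear Z -> M}).
Variables (N : lmodType R).

(* The snake lemma for [B >-> Z ->> M] tensored with [res1 Q -> res0 Q ->> N],
   as a relation from the kernel of [B (x) N -> Z (x) N] to [Tor M N]. *)
Definition tor_rel (b : TT B N) (x : TorT M N) : Prop :=
  exists b0 : TT B (res0 Q N), exists k : TT Z (res1 Q N),
  [/\ tmap (idl B) (resa Q N) b0 = b, tmap j (idl _) b0 = tmap (idl Z) (resd1 Q N) k
    & x = tor_class (tmap h (idl _) k)].

Hypothesis hj0 : forall b, h (j b) = 0.

Lemma tor_rel_cycle (b0 : TT B (res0 Q N)) (k : TT Z (res1 Q N)) :
  tmap j (idl _) b0 = tmap (idl Z) (resd1 Q N) k ->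
  tmap (idl M) (resd1 Q N) (tmap h (idl _) k) = 0.
Proof.
move=> bk; rewrite (@tmap_sq _ _ _ _ _ _ _ _ _ _ _ _ _ _ (idl Z) h (resd1 Q N) (idl _)) //.
by rewrite -bk (@tmap_comp _ _ _ _ _ _ _ _ _ _ _ _ (h \o j) (idl _)) // tmap_0l.
Qed.

Lemma tor_rel_lin a b x b' x' :
  tor_rel b x -> tor_rel b' x' -> tor_rel (a *: b + b') (a *: x + x').
Proof.
move=> [b0 [k [<- bk ->]]] [b0' [k' [<- bk' ->]]].
exists (a *: b0 + b0'), (a *: k + k'); rewrite !linearP bk bk'; split=> //.
by rewrite tor_class_lin ?(tor_rel_cycle bk) ?(tor_rel_cycle bk').
Qed.

Lemma tor_rel_ker b x : tor_rel b x -> tmap j (idl N) b = 0.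
Proof.
move=> [b0 [k [<- bk _]]].
rewrite (@tmap_sq _ _ _ _ _ _ _ _ _ _ _ _ _ _ j (idl _) (idl _) (resa Q N)) // bk.
rewrite (@tmap_comp _ _ _ _ _ _ _ _ _ _ _ _ (idl _) (resa Q N \o resd1 Q N)) // tmap_0r // => n.
exact: resa_d1.
Qed.

Lemma tor_rel_total b : tmap j (idl N) b = 0 -> exists x, tor_rel b x.
Proof.
move=> jb0; have [b0 b0b] :=
  tmap_surj (fun m : B => ex_intro (fun x => idl B x = m) m erefl) (@resa_surj _ Q N) b.
have [k bk] : exists k, tmap j (idl _) b0 = tmap (idl Z) (resd1 Q N) k.
  apply: (tens_right_exactr (@resa_surj _ Q N) (@resd1_exact _ Q N)).
  rewrite (@tmap_sq _ _ _ _ _ _ _ _ _ _ _ _ _ _ (idl _) j (resa Q N) (idl _)) //.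
  by rewrite b0b.
by exists (tor_class (tmap h (idl _) k)), b0, k.
Qed.

Hypothesis flZ : tflat T Z.

(** Together with linearity this makes the relation single-valued. Since [b0] dies in [B (x) N], it
    is the image of some [b1]; then [k] minus the image of [b1] is a cycle of [Z (x) res1], a
    boundary because [Z] is flat, and [h] kills the correction by [h \o j = 0]. *)
Lemma tor_rel_0 x : tor_rel 0 x -> x = 0.
Proof.
move=> [b0 [k [b00 bk ->]]]; apply/tor_class_eq0; first exact: tor_rel_cycle bk.
have [b1 b1E] := tens_right_exactr (@resa_surj _ Q N) (@resd1_exact _ Q N) b00.
have [v vE] : exists v, k - tmap j (idl _) b1 = tmap (idl Z) (resd2 Q N) v.
  apply: (tflat_exact flZ (@resd2_exact _ Q N)); rewrite linearB -bk b1E; apply/eqP.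
  by rewrite subr_eq0; apply/eqP/tmap_sq.
exists (tmap h (idl _) v); have -> : k = tmap (idl Z) (resd2 Q N) v + tmap j (idl _) b1.
  by rewrite -vE subrK.
rewrite linearD (@tmap_comp _ _ _ _ _ _ _ _ j h _ _ (h \o j) (idl _)) //.
by rewrite (@tmap_0l _ _ _ _ _ _ (h \o j)) // addr0; apply: tmap_sq.
Qed.

Hypothesis j_inj : injective j.
Hypothesis h_surj : forall m, exists z, h z = m.
Hypothesis h_ker : forall z, h z = 0 -> exists b, z = j b.
Hypothesis flP : tflat T (res0 Q N).

(** The chase of [tor_rel_0] in the opposite direction: after subtracting a lift of [v], the element
    [k] comes from [b1], and flatness of [res0] allows [j] to be cancelled. With [tor_rel_surj] the
    relation identifies Tor with the kernel of [B (x) N -> Z (x) N]. *)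
Lemma tor_rel_inj b : tor_rel b 0 -> b = 0.
Proof.
move=> [b0 [k [<- bk /esym/tor_class_eq0]]] []; first exact: tor_rel_cycle bk.
move=> v vE; have [v' v'v] :=
  tmap_surj h_surj (fun m : res2 Q N => ex_intro (fun x => idl _ x = m) m erefl) v.
have [b1 b1E] : exists b1, k - tmap (idl Z) (resd2 Q N) v' = tmap j (idl _) b1.
  apply: (tens_right_exactl h_surj h_ker).
  rewrite linearB vE -v'v; apply/eqP; rewrite subr_eq0; apply/eqP.
  exact: tmap_sq.
have e : b0 = tmap (idl B) (resd1 Q N) b1.
  apply: (tflat_injl flP j_inj); rewrite bk.
  have -> : k = tmap j (idl _) b1 + tmap (idl Z) (resd2 Q N) v' by rewrite -b1E subrK.
  rewrite linearD (@tmap_comp _ _ _ _ _ _ _ _ _ _ (resd2 Q N) (resd1 Q N) (idl _) (resd1 Q N \o resd2 Q N)) //.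
  rewrite (@tmap_0r _ _ _ _ _ _ _ (resd1 Q N \o resd2 Q N)) ?addr0 => [|n]; last exact: resd1_d2.
  exact: tmap_sq.
rewrite e (@tmap_comp _ _ _ _ _ _ _ _ _ _ _ _ (idl _) (resa Q N \o resd1 Q N)) //.
by apply: tmap_0r => n; apply: resa_d1.
Qed.

Lemma tor_rel_surj x : exists2 b, tmap j (idl N) b = 0 & tor_rel b x.
Proof.
elim/tor_ind: x => u u0; have [k ku] :=
  tmap_surj h_surj (fun m : res1 Q N => ex_intro (fun x => idl _ x = m) m erefl) u.
have [b0 b0E] : exists b0, tmap (idl Z) (resd1 Q N) k = tmap j (idl _) b0.
  apply: (tens_right_exactl h_surj h_ker).
  rewrite (@tmap_sq _ _ _ _ _ _ _ _ _ _ _ _ _ _ h (idl _) (idl _) (resd1 Q N)) //.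
  by rewrite ku.
have rl : tor_rel (tmap (idl B) (resa Q N) b0) (tor_class u).
  by exists b0, k; split=> //; rewrite ku.
by exists (tmap (idl B) (resa Q N) b0) => //; apply: tor_rel_ker rl.
Qed.
End TorRelation.

Lemma tor_rel_nat (B Z M B' Z' M' N N' : lmodType R) (j : {linear B -> Z}) (h : {linear Z -> M})
    (j' : {linear B' -> Z'}) (h' : {linear Z' -> M'})
    (fB : {linear B -> B'}) (fZ : {linear Z -> Z'}) (fM : {linear M -> M'})
    (g : {linear N -> N'}) :
  (forall b, h (j b) = 0) ->
  (forall b, fZ (j b) = j' (fB b)) -> (forall z, fM (h z) = h' (fZ z)) ->
  forall b x, tor_rel j h b x -> tor_rel j' h' (tmap fB g b) (tor_map fM g x).
Proof.
move=> hj0 ej eh b x [b0 [k [<- bk ->]]].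
exists (tmap fB (res0m Q g) b0), (tmap fZ (res1m Q g) k); split.
- by apply: tmap_sq => // n; rewrite resa_m.
- rewrite (@tmap_sq _ _ _ _ _ _ _ _ _ _ _ _ _ _ j fZ (idl _) (res0m Q g)) // bk.
  by apply: tmap_sq => // n; rewrite resd1_m.
rewrite tor_mapE; last exact: tor_rel_cycle bk.
by congr tor_class; apply: tmap_sq.
Qed.

End TorTheory.

(** * The Kunneth sequence of differential modules *)

(* A differential module [M] together with its cycles, boundaries and homology
   [M'], the differential being [M ->> hB >-> hZ >-> M]. *)
Record hdata (R : comNzRingType) (M M' : lmodType R) := HData {
  hZ : lmodType R;
  hB : lmodType R;
  hi : {linear hZ -> M};
  hj : {linear hB -> hZ};
  hd : {linear M -> hB};
  hh : {linear hZ -> M'};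
  hi_inj : injective hi;
  hj_inj : injective hj;
  hd_surj : forall b, exists m, hd m = b;
  hdi : forall z, hd (hi z) = 0;
  hd_ker : forall m, hd m = 0 -> exists z, m = hi z;
  hh_surj : forall x, exists z, hh z = x;
  hhj : forall b, hh (hj b) = 0;
  hh_ker : forall z, hh z = 0 -> exists b, z = hj b
}.

Definition hdiff (R : comNzRingType) (M M' : lmodType R) (X : hdata M M') : {linear M -> M} :=
  hi X \o (hj X \o hd X).

(** The Koszul sign [x |-> (-1)^|x| x], turned into an operator because an element of a total module
    has no degree to put in an exponent. That it anticommutes with the differential is the minus
    sign in [hs_d]. *)
Record hsign (R : comNzRingType) (M M' : lmodType R) (X : hdata M M') := HSign {
  hs : {linear M -> M};
  hsZ : {linear hZ X -> hZ X};
  hsB : {linear hB X -> hB X};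
  hs_i : forall z, hs (hi X z) = hi X (hsZ z);
  hs_j : forall b, hsZ (hj X b) = hj X (hsB b);
  hs_d : forall m, hd X (hs m) = - hsB (hd X m);
  hsBK : forall b, hsB (hsB b) = b;
  hsZK : forall z, hsZ (hsZ z) = z
}.

Record hmor (R : comNzRingType) (M M' M1 M1' : lmodType R) (X : hdata M M') (X1 : hdata M1 M1') :=
  HMor {
  hmM : {linear M -> M1};
  hmZ : {linear hZ X -> hZ X1};
  hmB : {linear hB X -> hB X1};
  hmH : {linear M' -> M1'};
  hm_i : forall z, hmM (hi X z) = hi X1 (hmZ z);
  hm_j : forall b, hmZ (hj X b) = hj X1 (hmB b);
  hm_d : forall m, hd X1 (hmM m) = hmB (hd X m);
  hm_h : forall z, hmH (hh X z) = hh X1 (hmZ z)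
}.

Lemma id_surj (R : comNzRingType) (M : lmodType R) (m : M) : exists x, idl M x = m.
Proof. by exists m. Qed.

Section Kunneth.
Variables (R : idomainType) (T : tensor_theory R) (pidR : is_pid R).
Local Notation TT := (ten T).
Local Notation tmap := (tmap_of T).
Local Notation "1" := (idl _).

(** Flatness of the quotient [B] makes Tor(B, N) vanish, hence injectivity for every [N]. The chase
    uses only a presentation [K >-> P ->> N] with [P] flat. *)
Lemma tflat_quotient_inj_res (Z M B N P K : lmodType R) (i : {linear Z -> M})
    (p : {linear M -> B}) (a : {linear P -> N}) (k : {linear K -> P}) :
  injective i -> (forall b, exists m, p m = b) -> (forall z, p (i z) = 0) ->
  (forall m, p m = 0 -> exists z, m = i z) -> tflat T B -> tflat T P ->
  injective k -> (forall n, exists x, a x = n) -> (forall x, a x = 0 -> exists y, x = k y) ->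
  (forall y, a (k y) = 0) ->
  injective (tmap i (idl N)).
Proof.
move=> iinj psurj pi pker flB flP kinj aS aK ak0; apply: injP0 => t it0.
have [u ut] := tmap_surj (@id_surj _ Z) aS t.
have [v vE] : exists v, tmap i 1 u = tmap 1 k v.
  apply: (tens_right_exactr aS aK).
  by rewrite (tmap_sq (h := 1) (h' := i) (k := a) (k' := 1)) // ut it0.
have pv0 : tmap p 1 v = 0.
  apply: (flB _ _ _ kinj); rewrite linear0.
  rewrite (tmap_sq (h := 1) (h' := p) (k := k) (k' := 1)) // -vE.
  by rewrite (tmap_comp (h := p \o i) (k := 1)) // tmap_0l.
have [w wE] := tens_right_exactl psurj pker pv0.
have e : u = tmap 1 k w.
  apply: (tflat_injl flP iinj); rewrite vE wE; exact: tmap_sq.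
by rewrite -ut e (tmap_comp (h := 1) (k := a \o k)) // tmap_0r.
Qed.

Lemma tflat_quotient_inj (Z M B N : lmodType R) (i : {linear Z -> M}) (p : {linear M -> B}) :
  injective i -> (forall b, exists m, p m = b) -> (forall z, p (i z) = 0) ->
  (forall m, p m = 0 -> exists z, m = i z) -> tflat T B -> injective (tmap i (idl N)).
Proof.
move=> iinj psurj pi pker flB.
have := @tflat_quotient_inj_res Z M B N (free_res0 N) _ i p (fa N) (smv (kerp (fa N))).
apply => //.
- exact: tflat_free.
- exact: sm_val_inj.
- exact: fa_surj.
- by move=> x x0; have xk : x \in kerp (fa N); [apply/eqP|exists (Submodule xk)].
- by move=> y; apply/eqP/(sm_valP y).
Qed.

Section Product.
Variables (M M' N N' P P' : lmodType R).
Variables (X : hdata M M') (s : hsign X) (Y : hdata N N') (W : hdata P P').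
Hypothesis flM : tflat T M.
Variables (nab : {linear TT M N -> P}) (nab' : {linear TT M' N' -> P'}).

Definition kdiff t : TT M N := tmap (hdiff X) 1 t + tmap (hs s) (hdiff Y) t.
Local Notation D := kdiff.

Hypothesis nab_d : forall t, nab (D t) = hdiff W (nab t).
Hypothesis nab_h : forall t, exists x,
  hi W x = nab (tmap (hi X) (hi Y) t) /\ hh W x = nab' (tmap (hh X) (hh Y) t).

Lemma kdiff_linear : linear D.
Proof. by move=> a x y; rewrite /D !linearP scalerDr addrACA. Qed.
Let Dl : {linear TT M N -> TT M N} := mklin kdiff_linear.
Lemma kdiffB x y : D (x - y) = D x - D y. Proof. exact: (linearB Dl). Qed.
Lemma kdiffD x y : D (x + y) = D x + D y. Proof. exact: (linearD Dl). Qed.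

Let flZ : tflat T (hZ X). Proof. exact: tflat_sub (@hi_inj _ _ _ X) flM. Qed.
Let flB : tflat T (hB X). Proof. exact: tflat_sub (@hj_inj _ _ _ X) flZ. Qed.

Let e n : hdiff Y n = hi Y (hj Y (hd Y n)). Proof. by []. Qed.
Let e0 n : hdiff Y n = 0 -> exists z, n = hi Y z.
Proof.
move=> /eqP; rewrite e -(linear0 (hi Y)) (inj_eq (@hi_inj _ _ _ Y)).
rewrite -(linear0 (hj Y)) (inj_eq (@hj_inj _ _ _ Y)) => /eqP; exact: hd_ker.
Qed.

Lemma kun_d_s m : hd X (hdiff X m) = 0. Proof. exact: hdi. Qed.

(** Modulo [hZ (x) N] the tensor complex is [hB (x) N], where only the second factor still has a
    differential, up to the sign that [hs_d] contributes. *)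
Lemma kun_hdD t : tmap (hd X) 1 (D t) = - tmap (hsB s) (hdiff Y) (tmap (hd X) 1 t).
Proof.
rewrite /D linearD (tmap_comp (h := hd X \o hdiff X) (k := 1)) //.
rewrite tmap_0l ?add0r; last exact: kun_d_s.
have lN : linear (fun b => - hsB s b) by move=> a x y; rewrite linearP opprD scalerN.
rewrite (tmap_sq (h := hd X) (h' := mklin lN) (k := 1) (k' := hdiff Y)) //; last first.
  by move=> m; rewrite hs_d.
elim/(@ten_ind R T): (tmap _ _ t) => [|x y ex ey|b n]; first by rewrite !linear0.
  by rewrite linearD ex ey [in RHS]linearD opprD.
by rewrite !tm_mapE -tmNl.
Qed.

Lemma kdiffK t : D (D t) = 0.
Proof.
rewrite {1}/D; have hdE (u : TT M N) : tmap (hdiff X) 1 u = tmap (hi X \o hj X) 1 (tmap (hd X) 1 u).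
  by apply/esym; apply: tmap_comp.
rewrite hdE kun_hdD linearN /D linearD [X in _ + (_ + X)](tmap_comp (h := hs s \o hs s)
  (k := hdiff Y \o hdiff Y)) //.
rewrite (@tmap_0r _ _ _ _ _ _ _ (hdiff Y \o hdiff Y)) => [|n]; last first.
  by rewrite /= hdi !linear0.
rewrite addr0 (tmap_comp (h := hsB s \o hd X) (k := hdiff Y)) //.
rewrite (tmap_comp (h := (hi X \o hj X) \o (hsB s \o hd X)) (k := hdiff Y)) //.
  apply/eqP; rewrite addrC subr_eq0; apply/eqP/esym; exact: tmap_comp.
by move=> m; rewrite /= hs_i hs_j.
Qed.

(** As [hB] is flat, the kernel of [1 (x) d] on [hB (x) N] comes from [hB (x) hZ]; the sign is
    removed by applying the involution once more. *)
Lemma kun_hd_cycle t : tmap (hd X) 1 (D t) = 0 ->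
  exists b, tmap (hd X) 1 t = tmap 1 (hi Y) b.
Proof.
rewrite kun_hdD => /eqP; rewrite oppr_eq0 => /eqP h0.
apply: (tflat_exact flB e0); have := congr1 (tmap (hsB s) 1) h0.
rewrite linear0 (tmap_comp (h := 1) (k := hdiff Y)) // => b; exact: hsBK.
Qed.

Lemma kdiff_i u : D (tmap (hi X) 1 u) = tmap (hi X) 1 (tmap (hsZ s) (hdiff Y) u).
Proof.
rewrite /D (tmap_comp (h := hdiff X \o hi X) (k := 1)) //.
rewrite (@tmap_0l _ _ _ _ _ _ (hdiff X \o hi X)) ?add0r => [|z]; last first.
  by rewrite /= hdi !linear0.
by apply: tmap_sq => // z; rewrite hs_i.
Qed.

(** Lift [b] to [w] in [M (x) hZ]; then [t] and [w] differ by an element killed by [hd], that is, by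
    some [u] from [hZ (x) N]. Both parts have their differential in the tensor product of the cycle
    modules, where [kun_ii_inj] permits a comparison. *)
Lemma kun_lift t b : tmap (hd X) 1 t = tmap 1 (hi Y) b ->
  exists u : TT (hZ X) N, exists w, t = tmap 1 (hi Y) w + tmap (hi X) 1 u /\
    D t = tmap (hi X) (hi Y) (tmap (hj X) 1 b + tmap (hsZ s) (hj Y \o hd Y) u).
Proof.
move=> tb; have [w wb] := tmap_surj (@hd_surj _ _ _ X) (@id_surj _ (hZ Y)) b.
have [u uE] : exists u, t - tmap 1 (hi Y) w = tmap (hi X) 1 u.
  apply: (tens_right_exactl (@hd_surj _ _ _ X) (@hd_ker _ _ _ X)).
  apply/eqP; rewrite linearB subr_eq0 tb -wb; apply/eqP; exact: tmap_sq.
have tE : t = tmap 1 (hi Y) w + tmap (hi X) 1 u by rewrite -uE addrC subrK.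
exists u, w; split=> //; rewrite tE /D !linearD.
rewrite [X in (_ + X) + _](tmap_comp (h := hdiff X \o hi X) (k := 1)) //.
rewrite (@tmap_0l _ _ _ _ _ _ (hdiff X \o hi X)) ?addr0 => [|z]; last first.
  by rewrite /= hdi !linear0.
rewrite [X in _ + (X + _)](tmap_comp (h := hs s) (k := hdiff Y \o hi Y)) //.
rewrite (@tmap_0r _ _ _ _ _ _ _ (hdiff Y \o hi Y)) ?add0r => [|z]; last first.
  by rewrite /= hdi !linear0.
rewrite -wb; congr (_ + _).
  rewrite (tmap_comp (h := hj X \o hd X) (k := 1)) //.
  by apply: tmap_sq.
by apply: tmap_sq => // z; rewrite hs_i.
Qed.

(** The second inclusion is cancelled by flatness of [hZ X], the first by flatness of the quotient
    [hB X]. *)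
Lemma kun_ii_inj : injective (tmap (hi X) (hi Y)).
Proof.
move=> x y exy; apply: (flZ (@hi_inj _ _ _ Y)).
apply: (@tflat_quotient_inj _ _ _ N (hi X) (hd X)) => //.
- exact: hi_inj.
- exact: hd_surj.
- exact: hdi.
- exact: hd_ker.
by rewrite !(tmap_comp (h := hi X) (k := hi Y)).
Qed.

(* The connecting relation of the Kunneth sequence: [t] is a cycle of the tensor
   product representing [x], and [b] the class of its boundary component. *)
Definition kun_rel (x : P') (b : TT (hB X) N') : Prop :=
  exists z t v c, [/\ hh W z = x, D t = 0, hi W z = nab t + hdiff W v,
    tmap (hd X) 1 t = tmap 1 (hi Y) c & b = tmap 1 (hh Y) c].

Lemma kun_rel_lin a x b x' b' :
  kun_rel x b -> kun_rel x' b' -> kun_rel (a *: x + x') (a *: b + b').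
Proof.
move=> [z [t [v [c [<- t0 zt tc ->]]]]] [z' [t' [v' [c' [<- t'0 zt' tc' ->]]]]].
exists (a *: z + z'), (a *: t + t'), (a *: v + v'), (a *: c + c').
rewrite !linearP tc tc' zt zt'; split=> //.
  by rewrite -[D _]/(Dl _) linearP /= t0 t'0 scaler0 addr0.
by rewrite scalerDr addrACA.
Qed.

(** For a cycle the formula of [kun_lift] equates the image of [c] with an element whose second
    factor is a boundary, and such elements vanish in [hZ (x) N']. *)
Lemma kun_total t : D t = 0 ->
  exists2 c, tmap (hd X) 1 t = tmap 1 (hi Y) c & tmap (hj X) 1 (tmap 1 (hh Y) c) = 0.
Proof.
move=> t0; have [c tc] : exists c, tmap (hd X) 1 t = tmap 1 (hi Y) c.
  by apply: kun_hd_cycle; rewrite t0 linear0.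
exists c => //; have [u [w [tE Dt]]] := kun_lift tc.
move: Dt; rewrite t0 -(linear0 (tmap (hi X) (hi Y))) => /kun_ii_inj/esym jc.
rewrite (tmap_sq (h := hj X) (h' := 1) (k := 1) (k' := hh Y)) //.
rewrite -[tmap (hj X) 1 c](addrK (tmap (hsZ s) (hj Y \o hd Y) u)) jc sub0r linearN.
rewrite (tmap_comp (h := hsZ s) (k := hh Y \o (hj Y \o hd Y))) // tmap_0r ?oppr0 // => n.
exact: hhj.
Qed.

Lemma kun_rel_im t : kun_rel (nab' t) 0.
Proof.
have [t1 t1t] := tmap_surj (@hh_surj _ _ _ X) (@hh_surj _ _ _ Y) t.
have [z [zi zh]] := nab_h t1.
exists z, (tmap (hi X) (hi Y) t1), 0, 0; rewrite !linear0 addr0 -t1t; split=> //.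
- rewrite /D (tmap_comp (h := hdiff X \o hi X) (k := hi Y)) // tmap_0l => [|x]; last first.
    by rewrite /= hdi !linear0.
  rewrite (tmap_comp (h := hs s \o hi X) (k := hdiff Y \o hi Y)) // tmap_0r ?addr0 // => x.
  by rewrite /= hdi !linear0.
rewrite (tmap_comp (h := hd X \o hi X) (k := hi Y)) // tmap_0l // => x; exact: hdi.
Qed.

(** Lifting [c] to [w] gives an element whose differential lies in cycles tensor boundaries, because
    [b] dies in [hZ (x) N']; a correction [u] from [hZ (x) N] makes it a cycle without changing its
    image under [hd]. *)
Lemma kun_surj b : tmap (hj X) (idl N') b = 0 -> exists x, kun_rel x b.
Proof.
move=> jb0; have [c cb] := tmap_surj (@id_surj _ (hB X)) (@hh_surj _ _ _ Y) b.
have [c' cE] : exists c', tmap (hj X) 1 c = tmap 1 (hj Y) c'.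
  apply: (tens_right_exactr (@hh_surj _ _ _ Y) (@hh_ker _ _ _ Y)).
  by rewrite (tmap_sq (h := 1) (h' := hj X) (k := hh Y) (k' := 1)) // cb.
(* On [hZ (x) N] the differential is [hsZ (x) d]. The factor [hsZ] inserted here meets that one and
   cancels by [hsZK], so the correction contributes exactly minus the image of [c']. *)
have [u uE] := tmap_surj (@id_surj _ (hZ X)) (@hd_surj _ _ _ Y) (- tmap (hsZ s) 1 c').
have [w wc] := tmap_surj (@hd_surj _ _ _ X) (@id_surj _ (hZ Y)) c.
pose t := tmap 1 (hi Y) w + tmap (hi X) 1 u.
have Dt : D t = 0.
  rewrite kdiffD /D (tmap_sq (h := hd X) (h' := hi X \o hj X) (k := 1) (k' := hi Y)) // wc.
  rewrite (tmap_comp (h := hs s) (k := hdiff Y \o hi Y)) //.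
  rewrite (@tmap_0r _ _ _ _ _ _ _ (hdiff Y \o hi Y)) ?addr0 => [|z]; last first.
    by rewrite /= hdi !linear0.
  rewrite (tmap_comp (h := hdiff X \o hi X) (k := 1)) //.
  rewrite (@tmap_0l _ _ _ _ _ _ (hdiff X \o hi X)) ?add0r => [|z]; last first.
    by rewrite /= hdi !linear0.
  rewrite (tmap_sq (h := 1) (h' := hi X \o hsZ s) (k := hd Y) (k' := hi Y \o hj Y)) //;
    last by move=> m; rewrite /= hs_i.
  rewrite uE linearN (tmap_comp (h := hi X) (k := hi Y \o hj Y)) // => [|z]; last first.
    by rewrite /= hsZK.
  rewrite -(tmap_comp (f := 1) (f' := hi X) (g := hj Y) (g' := hi Y)) // -cE.
  by rewrite (tmap_comp (h := hi X \o hj X) (k := hi Y)) // subrr.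
have [z zE] : exists z, nab t = hi W z.
  apply: hd_ker; apply: (@hj_inj _ _ _ W); apply: (@hi_inj _ _ _ W).
  by rewrite -[LHS]nab_d Dt !linear0.
exists (hh W z), z, t, 0, c; split=> //; first by rewrite linear0 addr0.
rewrite linearD (tmap_comp (h := hd X) (k := hi Y)) //.
rewrite (tmap_comp (h := hd X \o hi X) (k := 1)) // (@tmap_0l _ _ _ _ _ _ (hd X \o hi X)) //.
  by rewrite addr0 -wc; apply/esym; apply: tmap_comp.
exact: hdi.
Qed.

(** If the boundary component is zero in homology, some [D r] has the same image under [hd] as [t].
    The difference is a cycle of [hZ (x) N], hence a tensor of cycles, and its class under [nab'] is
    [x]. *)
Lemma kun_ker x : kun_rel x 0 -> exists t, x = nab' t.
Proof.
move=> [z [t [v [c [<- t0 zt tc /esym c0]]]]].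
have [c' cE] := tens_right_exactr (@hh_surj _ _ _ Y) (@hh_ker _ _ _ Y) c0.
have [r rE] := tmap_surj (@hd_surj _ _ _ X) (@hd_surj _ _ _ Y) (- tmap (hsB s) 1 c').
have [u uE] : exists u, t - D r = tmap (hi X) 1 u.
  apply: (tens_right_exactl (@hd_surj _ _ _ X) (@hd_ker _ _ _ X)).
  apply/eqP; rewrite linearB subr_eq0 kun_hdD tc cE; apply/eqP.
  rewrite (tmap_sq (h := hd X) (h' := hsB s) (k := hd Y) (k' := hi Y \o hj Y)) //.
  rewrite rE linearN opprK; apply: tmap_sq => // b; by rewrite hsBK.
(* Since [hi (x) 1] is injective, being a cycle can be tested in [hZ (x) N], where the differential
   is [hsZ (x) d]; then [hsZ] is undone. *)
have u0 : tmap 1 (hdiff Y) u = 0.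
  have Du : D (tmap (hi X) 1 u) = 0 by rewrite -uE kdiffB t0 kdiffK subrr.
  have : tmap (hi X) 1 (tmap (hsZ s) (hdiff Y) u) = 0.
    by rewrite -kdiff_i.
  rewrite -(linear0 (tmap (hi X) (idl N))) => /(@tflat_quotient_inj _ _ _ N (hi X) (hd X)
    (@hi_inj _ _ _ X) (@hd_surj _ _ _ X) (@hdi _ _ _ X) (@hd_ker _ _ _ X) flB).
  move=> /(congr1 (tmap (hsZ s) 1)); rewrite linear0.
  by rewrite (tmap_comp (h := 1) (k := hdiff Y)) // => z'; rewrite hsZK.
have [q qE] := tflat_exact flZ e0 u0.
have [z' [z'i z'h]] := nab_h q.
exists (tmap (hh X) (hh Y) q); rewrite -z'h.
have zz' : z = z' + hj W (hd W (nab r + v)).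
  apply: (@hi_inj _ _ _ W); rewrite linearD z'i zt.
  rewrite -[hi W (hj W _)]/(hdiff W _) linearD -nab_d addrA; congr (_ + _).
  rewrite -linearD; congr (nab _).
  rewrite -[t](subrK (D r)) uE qE; congr (_ + _); exact: tmap_comp.
by rewrite zz' linearD hhj addr0.
Qed.

(** Injectivity of [nab] on homology, the source of single-valuedness and of the injectivity of
    [nab']. Surjectivity enters later, in a graded form. *)
Hypothesis q1 : forall t x, D t = 0 -> nab t = hdiff W x -> exists v, t = D v.

(** A representing cycle of the zero class is [D r] for some [r], so its boundary component has a
    boundary in the second factor. *)
Lemma kun_rel_0 b : kun_rel 0 b -> b = 0.
Proof.
move=> [z [t [v [c [z0 t0 zt tc ->]]]]].
have [z' zE] := hh_ker z0; have [v' v'z] := hd_surj z'.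
have [r tr] : exists r, t = D r.
  apply: (q1 (x := v' - v)) => //; rewrite linearB -[hdiff W v']/(hi W (hj W (hd W v'))).
  by rewrite v'z -zE zt addrK.
have -> : c = tmap 1 (hj Y) (- tmap (hsB s) (hd Y) (tmap (hd X) 1 r)).
  apply: (flB (@hi_inj _ _ _ Y)); rewrite -tc tr kun_hdD !linearN; congr (- _).
  rewrite (tmap_comp (h := 1) (k := hi Y \o hj Y)) //.
  rewrite (tmap_comp (h := hsB s) (k := hdiff Y)) //.
rewrite (tmap_comp (h := 1) (k := hh Y \o hj Y)) // tmap_0r // => b'; exact: hhj.
Qed.

(** If a tensor of cycles maps to a boundary, it is [D r] by [q1]. Then [kun_lift] writes it as
    boundaries tensor cycles plus cycles tensor boundaries, and both parts vanish in [M' (x) N']. *)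
Lemma kun_inj : injective nab'.
Proof.
apply: injP0 => t nt0; have [t1 t1t] := tmap_surj (@hh_surj _ _ _ X) (@hh_surj _ _ _ Y) t.
have [z [zi zh]] := nab_h t1; move: zh; rewrite t1t nt0 => /hh_ker[z' zE].
have [v vz'] := hd_surj z'.
have D0 : D (tmap (hi X) (hi Y) t1) = 0.
  rewrite /D (tmap_comp (h := hdiff X \o hi X) (k := hi Y)) // tmap_0l => [|x]; last first.
    by rewrite /= hdi !linear0.
  rewrite (tmap_comp (h := hs s \o hi X) (k := hdiff Y \o hi Y)) // tmap_0r ?addr0 // => x.
  by rewrite /= hdi !linear0.
have [r rE] : exists r, tmap (hi X) (hi Y) t1 = D r.
  by apply: (q1 (x := v)) => //; rewrite -zi zE -vz'.
have [c rc] : exists c, tmap (hd X) 1 r = tmap 1 (hi Y) c.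
  apply: kun_hd_cycle; rewrite -rE (tmap_comp (h := hd X \o hi X) (k := hi Y)) // tmap_0l //.
  exact: hdi.
have [u [w [_ Dr]]] := kun_lift rc.
move: rE; rewrite Dr => /kun_ii_inj t1E.
rewrite -t1t t1E linearD (tmap_comp (h := hh X \o hj X) (k := hh Y)) // tmap_0l ?add0r.
  rewrite (tmap_comp (h := hh X \o hsZ s) (k := hh Y \o (hj Y \o hd Y))) // tmap_0r // => n.
  exact: hhj.
exact: hhj.
Qed.

End Product.

Lemma kun_rel_nat (M M' N N' P P' M1 M1' N1 N1' P1 P1' : lmodType R)
    (X : hdata M M') (s : hsign X) (Y : hdata N N') (W : hdata P P')
    (X1 : hdata M1 M1') (s1 : hsign X1) (Y1 : hdata N1 N1') (W1 : hdata P1 P1')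
    (nab : {linear TT M N -> P}) (nab1 : {linear TT M1 N1 -> P1})
    (f : hmor X X1) (g : hmor Y Y1) (k : hmor W W1) :
  (forall m, hs s1 (hmM f m) = hmM f (hs s m)) ->
  (forall t, hmM k (nab t) = nab1 (tmap (hmM f) (hmM g) t)) ->
  forall x b, kun_rel s Y W nab x b ->
    kun_rel s1 Y1 W1 nab1 (hmH k x) (tmap (hmB f) (hmH g) b).
Proof.
move=> fs kn x b [z [t [v [c [<- t0 zt tc ->]]]]].
exists (hmZ k z), (tmap (hmM f) (hmM g) t), (hmM k v), (tmap (hmB f) (hmZ g) c); split.
- by rewrite hm_h.
- transitivity (tmap (hmM f) (hmM g) (kdiff s Y t)); last by rewrite t0 linear0.
  rewrite /kdiff linearD; congr (_ + _); apply: tmap_sq => // m.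
    by rewrite /= hm_d -hm_j -hm_i.
  by rewrite /= hm_d -hm_j -hm_i.
- by rewrite -hm_i zt linearD kn /= hm_i hm_j -hm_d.
- rewrite (tmap_sq (h := hd X) (h' := hmB f) (k := 1) (k' := hmM g)) ?tc //.
    by apply: tmap_sq => // n; rewrite hm_i.
  by move=> m; rewrite hm_d.
by apply: tmap_sq => // n; rewrite hm_h.
Qed.

End Kunneth.

(** * Chains and cones *)

(* Sealing keeps unification from unfolding the linear maps below. *)
Fact tt_key : unit. Proof. exact: tt. Qed.

Section Support.
Variables (R : comNzRingType) (K : choiceType) (p : pred K).

Lemma supp_ind (P : {malg R[K]} -> Prop) :
  P 0 -> (forall a x y, P x -> P y -> P (a *: x + y)) -> (forall k, p k -> P << k >>) ->
  forall g, g \in supp_pred p -> P g.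
Proof.
move=> P0 PD PU g /allP pg; rewrite [g]malg_expand big_seq.
by elim/big_rec: _ => // k x kg; apply: PD; apply/PU/pg.
Qed.

Lemma supp_ext (V : lmodType R) (f h : {linear {malg R[K]} -> V}) :
  (forall k, p k -> f << k >> = h << k >>) -> forall g, g \in supp_pred p -> f g = h g.
Proof.
move=> fh; apply: supp_ind => [|a x y e1 e2|//]; first by rewrite !linear0.
by rewrite !linearP e1 e2.
Qed.

Lemma supp_ext0 (V : lmodType R) (f : {linear {malg R[K]} -> V}) :
  (forall k, p k -> f << k >> = 0) -> forall g, g \in supp_pred p -> f g = 0.
Proof.
move=> f0; apply: supp_ind => [|a x y e1 e2|//]; first by rewrite linear0.
by rewrite linearP e1 e2 scaler0 addr0.
Qed.

Lemma supp_lin (V : lmodType R) (f : {linear {malg R[K]} -> V}) (S : submodClosed V) :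
  (forall k, p k -> f << k >> \in S) -> forall g, g \in supp_pred p -> f g \in S.
Proof.
move=> fS; apply: supp_ind => [|a x y e1 e2|//]; first by rewrite linear0 rpred0.
by rewrite linearP rpredD ?rpredZ.
Qed.

Lemma supp_predU k : (<< k >> \in supp_pred (R := R) p) = p k.
Proof.
have sk k' : (k' \in msupp (<< k >> : {malg R[K]})) = (k' == k).
  by rewrite msuppU oner_eq0 in_fset1.
by apply/allP/idP => [|pk k']; [apply; rewrite sk|rewrite sk => /eqP ->].
Qed.

Lemma supp_predS (p' : pred K) g : {subset p <= p'} -> g \in supp_pred (R := R) p ->
  g \in supp_pred p'.
Proof. by move=> pp /allP pg; apply/allP => k /pg; apply: pp. Qed.
End Support.

Section Chains.
Variables (R : comNzRingType) (G : digraph).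
Implicit Types (x y : G) (t u : seq G) (c : chain R G).
Local Notation C := (chain R G).
Local Notation "[ 't' t ]" := (<< t >> : C) (format "[ 't'  t ]").

Definition nd : {pred C} := supp_pred (@nondegen G).
HB.instance Definition _ := GRing.SubmodClosed.on nd.

(** The cone with apex [x], normalized like [tuple_chain]. All maps below are described by their
    effect on cones, so that [nd_ind] can replace sums over faces or lattice paths. *)
Definition ccons_tuple x t : C :=
  if t is y :: _ then (if x == y then 0 else << x :: t >>) else 0.
Definition ccons x : {linear C -> C} :=
  @locked_with tt_key {linear C -> C} (free_lift (ccons_tuple x)).
Definition ceps : {linear C -> R^o} :=
  @locked_with tt_key {linear C -> R^o} (free_lift (fun t : seq G => (size t == 1)%:R : R^o)).
(** The exponent is the size, which is the degree plus one: [- csgn] is the Koszul sign. With this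
    choice [csgn] is the sign in the shuffle recursion [nabcc]. *)
Definition csgn : {linear C -> C} :=
  @locked_with tt_key {linear C -> C} (free_lift (fun t : seq G => (-1) ^+ size t *: << t >> : C)).
Definition cbd : {linear C -> C} :=
  @locked_with tt_key {linear C -> C} (@bd R G).

Lemma cconsE x t : ccons x << t >> = ccons_tuple x t.
Proof. rewrite /ccons locked_withE. exact: free_liftU. Qed.
Lemma cepsE t : ceps << t >> = (size t == 1)%:R.
Proof. rewrite /ceps locked_withE; exact: free_liftU. Qed.
Lemma csgnE t : csgn << t >> = (-1) ^+ size t *: << t >>.
Proof. rewrite /csgn locked_withE; exact: free_liftU. Qed.
Lemma cbd_bd c : cbd c = bd c.
Proof. by rewrite /cbd locked_withE. Qed.

Lemma tuple_chain_cons x t : t != [::] -> tuple_chain R (x :: t) = ccons x (tuple_chain R t).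
Proof.
case: t => // y t _; rewrite /tuple_chain /=; case: ifP => [/andP[xy yt]|].
  by rewrite yt cconsE /= (negPf xy).
case: ifP => [yt|]; last by rewrite linear0.
by rewrite andbT => /negbFE /eqP ->; rewrite cconsE /= eqxx.
Qed.

Lemma cbdE t : cbd << t >> = \sum_(i < size t) (-1) ^+ i *: tuple_chain R (face i t).
Proof. by rewrite cbd_bd; apply: free_liftU. Qed.

Lemma cbd1 x : cbd << [:: x] >> = 0.
Proof. by rewrite cbdE big_ord1 /face /= scaler0. Qed.

Lemma tuple_chainE t : nondegen t -> tuple_chain R t = << t >>.
Proof. by rewrite /tuple_chain => ->. Qed.

(** Every face other than the zeroth keeps [x] and is a cone. The exception is the last face of a
    pair, whose cone would be over the empty tuple; the augmentation term accounts for it. *)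
Lemma cbd_cons x t : nondegen t ->
  cbd << x :: t >> = << t >> - ccons x (cbd << t >>) - ceps << t >> *: << [:: x] >>.
Proof.
move=> ndt; rewrite cbdE big_ord_recl expr0 scale1r.
rewrite {1}/face /= drop0 tuple_chainE // -addrA; congr (_ + _).
rewrite -opprD cbdE linear_sum cepsE.
case: t ndt => // y [|z t] ndt.
  rewrite !big_ord1 /face /= expr0 scale1r expr1 scaleN1r scale1r.
  by rewrite [tuple_chain R [::]]/= linear0 add0r.
rewrite [X in X *: _](_ : _ = 0) // scale0r addr0 -sumrN; apply: eq_bigr => i _.
rewrite [X in _ ^+ X]/= exprS mulN1r scaleNr (linearZZ (ccons x)); congr (- (_ *: _)).
by rewrite -tuple_chain_cons //; case: i => -[|i].
Qed.

Lemma mem_ndU t : (<< t >> \in nd) = nondegen t. Proof. exact: supp_predU. Qed.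

Definition cepsv (V : lmodType R) (v : V) : {linear C -> V} :=
  @locked_with tt_key {linear C -> V}
    (free_lift (fun t : seq G => if size t == 1 then v else 0)).
Lemma cepsvE (V : lmodType R) (v : V) c : cepsv v c = (ceps c : R) *: v.
Proof.
have lv : linear (fun d : C => (ceps d : R) *: v).
  by move=> a d d'; rewrite linearP /= scalerDl scalerA.
apply: (@malg_ext R _ _ (cepsv v) (mklin lv)) => t.
rewrite [RHS]/= cepsE /cepsv locked_withE.
apply: etrans (free_liftU _ _) _.
by case: ifP => _; rewrite ?scale1r ?scale0r.
Qed.

Lemma ccons1 x : ccons x << [:: x] >> = 0.
Proof. by rewrite cconsE /= eqxx. Qed.

Lemma ccons_neq x y t : x != y -> ccons x << y :: t >> = << x :: y :: t >>.
Proof. by rewrite cconsE /= => /negPf ->. Qed.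

Lemma cconsK x c : ccons x (ccons x c) = 0.
Proof.
apply: (@malg_ext0 R _ _ (ccons x \o ccons x)) => -[|y t] /=; rewrite cconsE /= ?linear0 //.
by case: eqP; rewrite ?linear0 // cconsE /= eqxx.
Qed.

Lemma ceps_ccons x c : ceps (ccons x c) = 0.
Proof.
apply: (@malg_ext0 R _ _ (ceps \o ccons x)) => -[|y t] /=; rewrite cconsE /= ?linear0 //.
by case: eqP; rewrite ?linear0 // cepsE.
Qed.

Lemma nd_ccons x c : c \in nd -> ccons x c \in nd.
Proof.
apply: supp_lin => -[|y t] //= yt; rewrite cconsE /=; case: eqP => [_|/eqP xy].
  by rewrite rpred0.
by rewrite mem_ndU /= xy.
Qed.

Lemma nd_cons x t : nondegen (x :: t) -> t != [::] -> nondegen t /\ << x :: t >> = ccons x << t >>.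
Proof. by case: t => //= y t /andP[xy yt] _; rewrite ccons_neq. Qed.

Lemma nd_ind (P : C -> Prop) :
  P 0 -> (forall a c d, P c -> P d -> P (a *: c + d)) -> (forall x, P << [:: x] >>) ->
  (forall x t, nondegen t -> P << t >> -> P (ccons x << t >>)) ->
  forall c, c \in nd -> P c.
Proof.
move=> P0 PD P1 Pc; apply: supp_ind => //.
elim=> // x [|y t] IH xt; first exact: P1.
have [ndt ->] := nd_cons xt isT; exact/Pc/IH.
Qed.

(** This extends [cbd_cons] to tuples that begin with [x]. Their cone is zero, and the right side
    cancels because a second cone with the same apex vanishes. *)
Lemma cbd_ccons x c : c \in nd ->
  cbd (ccons x c) = c - ccons x (cbd c) - (ceps c : R) *: << [:: x] >>.
Proof.
rewrite -cepsvE => cn.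
apply: (@supp_ext R _ _ _ (cbd \o ccons x)
  ((idfun \- (ccons x \o cbd)) \- cepsv (<< [:: x] >> : C)) _ _ cn) => -[|y t] // yt.
rewrite /= cepsvE /= cconsE /=; case: eqP => [exy|/eqP xy]; last by rewrite cbd_cons.
rewrite linear0 -{y}exy in yt *; case: t yt => [|z t] yt.
  by rewrite cbd1 linear0 subr0 cepsE scale1r subrr.
have [zt _] := nd_cons yt isT; rewrite (cbd_cons _ zt) !(linearB (ccons x)) cconsK.
rewrite (linearZZ (ccons x)) ccons1 scaler0 !subr0 ccons_neq; last by case/andP: yt.
by rewrite cepsE scale0r subrr subr0.
Qed.

Lemma nd_tuple_chain t : tuple_chain R t \in nd.
Proof. by rewrite /tuple_chain; case: ifP => [|_]; rewrite ?mem_ndU ?rpred0. Qed.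

Lemma nd_cbd c : cbd c \in nd.
Proof.
elim/malg_ind: c => [|a c d cn dn|t]; first by rewrite linear0 rpred0.
  by rewrite linearP rpredD ?rpredZ.
by rewrite cbdE rpred_sum // => i _; rewrite rpredZ // nd_tuple_chain.
Qed.

Lemma ceps_cbd c : c \in nd -> ceps (cbd c) = 0.
Proof.
elim/nd_ind => [|a u v e1 e2|x|x t ndt _]; rewrite ?linear0 //.
- by rewrite !linearP e1 e2 scaler0 addr0.
- by rewrite cbd1 linear0.
rewrite cbd_ccons ?mem_ndU // !(linearB ceps) ceps_ccons subr0 (linearZZ ceps) (cepsE [:: x]).
by rewrite [_ *: _]mulr1 subrr.
Qed.

Lemma cbdK c : c \in nd -> cbd (cbd c) = 0.
Proof.
elim/nd_ind => [|a u v e1 e2|x|x t ndt IH]; rewrite ?linear0 //.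
- by rewrite !linearP e1 e2 scaler0 addr0.
- by rewrite cbd1 linear0.
rewrite cbd_ccons ?mem_ndU // !(linearB cbd) cbd_ccons ?nd_cbd // IH linear0 subr0.
by rewrite ceps_cbd ?mem_ndU // scale0r subr0 subrr (linearZZ cbd) cbd1 scaler0 subr0.
Qed.

Lemma csgnK c : csgn (csgn c) = c.
Proof.
apply: (@malg_ext R _ _ (csgn \o csgn) idfun) => t /=.
by rewrite csgnE linearZZ csgnE scalerA -exprD addnn -mul2n exprM sqrrN expr1n expr1n scale1r.
Qed.

Lemma csgn_ccons x c : csgn (ccons x c) = - ccons x (csgn c).
Proof.
apply: (@malg_ext R _ _ (csgn \o ccons x) (\- (ccons x \o csgn))) => -[|y t] /=.
  by rewrite csgnE linearZZ cconsE /= scaler0 linear0 oppr0.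
rewrite csgnE linearZZ cconsE /=; case: eqP; rewrite ?scaler0 ?oppr0 ?linear0 //.
by rewrite csgnE /= exprS mulN1r scaleNr.
Qed.

Lemma ceps_csgn c : ceps (csgn c) = - ceps c.
Proof.
apply: (@malg_ext R _ _ (ceps \o csgn) (\- ceps)) => t /=.
rewrite csgnE linearZZ cepsE; case: eqP => [->|_]; last by rewrite scaler0 oppr0.
by rewrite expr1 scaleN1r.
Qed.

Lemma nd_csgn c : c \in nd -> csgn c \in nd.
Proof. by apply: supp_lin => t ndt; rewrite csgnE rpredZ // mem_ndU. Qed.

Lemma csgn1 x : csgn << [:: x] >> = - << [:: x] >>.
Proof. by rewrite csgnE expr1 scaleN1r. Qed.

Lemma cbd_csgn c : c \in nd -> cbd (csgn c) = - csgn (cbd c).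
Proof.
elim/nd_ind => [|a u v e1 e2|x|x t ndt IH]; rewrite ?linear0 ?oppr0 //.
- by rewrite !linearP e1 e2.
- by rewrite csgn1 (linearN cbd) cbd1 (linear0 csgn).
rewrite csgn_ccons (linearN cbd) !cbd_ccons ?nd_csgn ?mem_ndU // !(linearB csgn).
rewrite csgn_ccons IH (linearN (ccons x)) ceps_csgn scaleNr (linearZZ csgn) csgn1 scalerN.
by rewrite !opprK.
Qed.

End Chains.

(** * Shuffles *)

Section Words.

(** The index set of [shuffle] as plain lists, which split on the first step of the lattice path. *)
Fixpoint words n : seq (seq bool) :=
  if n is m.+1 then map (cons true) (words m) ++ map (cons false) (words m) else [:: [::]].

Lemma mem_words n w : (w \in words n) = (size w == n).
Proof.
elim: n w => [|n IH] [|b w] //=.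
  by apply/negP; rewrite mem_cat => /orP[] /mapP[].
rewrite mem_cat eqSS -IH; case: b.
  rewrite mem_map; last by move=> ? ? [].
  by rewrite (_ : _ \in map (cons false) _ = false) ?orbF //; apply/negP => /mapP[].
rewrite (mem_map (f := cons false)); last by move=> ? ? [].
by rewrite (_ : _ \in map (cons true) _ = false) //; apply/negP => /mapP[].
Qed.

Lemma uniq_words n : uniq (words n).
Proof.
elim: n => //= n IH; rewrite cat_uniq !map_inj_uniq ?IH; try by move=> ? ? [].
by rewrite andbT /=; apply/hasPn => _ /mapP[w _ ->]; apply/negP => /mapP[].
Qed.

Lemma big_words (V : zmodType) n (P : pred (seq bool)) (F : seq bool -> V) :
  \sum_(w : n.-tuple bool | P w) F w = \sum_(w <- words n | P w) F w.
Proof.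
have e : perm_eq (map val (enum {: n.-tuple bool})) (words n).
  apply: uniq_perm; rewrite ?(map_inj_uniq val_inj) ?enum_uniq ?uniq_words // => w.
  rewrite mem_words; apply/mapP/eqP => [[t _ ->]|sw]; first by rewrite size_tuple.
  by exists (Tuple (introT eqP sw)); rewrite ?mem_enum.
by rewrite -(perm_big _ e) big_map big_enum_cond.
Qed.

Lemma iota0S n : iota 0 n.+1 = 0%N :: map S (iota 0 n).
Proof. by rewrite /= (iotaDl 1 0). Qed.

Lemma lpoint0 w : lpoint w 0 = (0, 0)%N.
Proof. by rewrite /lpoint take0. Qed.

Lemma strictly_below0 w b : strictly_below w 0 b = false.
Proof. by rewrite /strictly_below /= take0. Qed.

Lemma strictly_below_cons c w a b : strictly_below (c :: w) a.+1 b =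
  all (fun k => (c + (lpoint w k).1 == a.+1) ==> (b < ~~ c + (lpoint w k).2))%N
    (iota 0 (size w).+1).
Proof.
rewrite /strictly_below iota0S /= take0 /=.
by rewrite all_map.
Qed.

Lemma strictly_below_true w a b : strictly_below (true :: w) a.+1 b = strictly_below w a b.
Proof. by rewrite strictly_below_cons; apply: eq_all. Qed.

Lemma strictly_below_false w a b :
  strictly_below (false :: w) a.+1 b = if b is b'.+1 then strictly_below w a.+1 b' else true.
Proof.
rewrite strictly_below_cons; case: b => [|b]; last exact: eq_all.
by apply/allP => k _ /=; rewrite implybT.
Qed.

Lemma below_count_true p q w : below_count p.+1 q (true :: w) = below_count p q w.
Proof.
rewrite /below_count big_ord_recl [X in (X + _)%N]big1 ?add0n => [|b _]; last by rewrite strictly_below0.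
by apply: eq_bigr => a _; apply: eq_bigr => b _; rewrite strictly_below_true.
Qed.

(** A vertical first step lifts the rest of the path and puts the [p] points [(a, 0)] with
    [1 <= a <= p] below it. Column zero never counts, since the path starts at the origin. *)
Lemma below_count_false p q w :
  below_count p q.+1 (false :: w) = (p + below_count p q w)%N.
Proof.
rewrite /below_count big_ord_recl [X in (X + _)%N]big1 ?add0n => [|b _]; last by rewrite strictly_below0.
rewrite [in RHS]big_ord_recl [X in (_ + (X + _))%N]big1 ?add0n => [|b _]; last by rewrite strictly_below0.
rewrite -[X in (X + _)%N](card_ord p) -sum1_card -big_split /=; apply: eq_bigr => a _.
by rewrite big_ord_recl strictly_below_false; congr addn; apply: eq_bigr => b _;
   rewrite strictly_below_false.
Qed.

Lemma below_count_nil p q : below_count p q [::] = 0%N \/ (0 < p)%N.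
Proof.
case: p => [|p]; [left|by right].
by rewrite /below_count big_ord1 big1 // => b _; rewrite strictly_below0.
Qed.

Variables G H : digraph.
Implicit Types (g : G) (h : H).

Lemma path_tuple_true w g g' s h t : count id w = size s -> size w = (size s + size t)%N ->
  path_tuple (true :: w) g (g' :: s) h t = (g, h) :: path_tuple w g' s h t.
Proof.
move=> cw sw; rewrite /path_tuple iota0S map_cons -map_comp lpoint0; congr cons.
apply: eq_map => k /=.
congr pair; apply: set_nth_default; rewrite /= ltnS -cw -{2}(cat_take_drop k w) count_cat.
exact: leq_addr.
Qed.

Lemma path_tuple_false w g s h h' t : count id w = size s -> size w = (size s + size t)%N ->
  path_tuple (false :: w) g s h (h' :: t) = (g, h) :: path_tuple w g s h' t.
Proof.
move=> cw sw; rewrite /path_tuple iota0S map_cons -map_comp lpoint0; congr cons.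
apply: eq_map => k /=.
congr pair; apply: set_nth_default; rewrite /= ltnS.
have -> : size t = count negb w.
  apply/eqP; rewrite -(eqn_add2l (count id w)) count_predC.
  by rewrite [in X in (X + _)%N]cw -sw.
by rewrite -{2}(cat_take_drop k w) count_cat; apply: leq_addr.
Qed.

End Words.

Section ShuffleRec.
Variables (R : comNzRingType) (G H : digraph).
Implicit Types (g : G) (h : H).
Local Notation CB := (chain R (box G H)).

(** Prepends without the degeneracy test of [ccons], because [shuffle] does not normalize its terms;
    the two are compared in [ccons_shufw]. *)
Definition pcons (x : box G H) : {linear CB -> CB} :=
  @locked_with tt_key {linear CB -> CB} (free_lift (fun u : seq (box G H) => << x :: u >> : CB)).
Lemma pconsE x u : pcons x << u >> = << x :: u >>.
Proof. rewrite /pcons locked_withE; exact: free_liftU. Qed.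

Definition shufw : G -> seq G -> H -> seq H -> CB :=
  locked_with tt_key (fun g s h t =>
  \sum_(w <- words (size s + size t) | count id w == size s)
     (-1) ^+ below_count (size s) (size t) w *: << path_tuple w g s h t >>).

Lemma shufw_def g s h t : shufw g s h t =
  \sum_(w <- words (size s + size t) | count id w == size s)
     (-1) ^+ below_count (size s) (size t) w *: << path_tuple w g s h t >>.
Proof. by rewrite /shufw locked_withE. Qed.

Lemma shufwE g s h t : shuffle R (g :: s) (h :: t) = shufw g s h t.
Proof. by rewrite shufw_def -big_words. Qed.

Lemma shufw00 g h : shufw g [::] h [::] = << [:: (g, h)] >>.
Proof.
rewrite shufw_def big_cons big_nil /= addr0.
by case: (below_count_nil 0 0) => // ->; rewrite expr0 scale1r.
Qed.

Lemma shufw_rec g s h t : (0 < size s + size t)%N -> shufw g s h t =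
  (if s is g' :: s' then pcons (g, h) (shufw g' s' h t) else 0) +
  (if t is h' :: t' then (-1) ^+ size s *: pcons (g, h) (shufw g s h' t') else 0).
Proof.
move=> n0; rewrite [LHS]shufw_def; case sz: (size s + size t)%N n0 => [//|n] _.
rewrite big_cat !big_map /=; congr (_ + _).
  case: s sz => [|g' s] sz; first by rewrite big_pred0_eq.
  move: sz; rewrite /= addSn => -[sz]; rewrite shufw_def linear_sum /= sz.
  under [LHS]eq_bigl => w do rewrite add1n eqSS.
  rewrite big_seq_cond [RHS]big_seq_cond; apply: eq_bigr => w; rewrite mem_words.
  move=> /andP[/eqP sw /eqP cw]; rewrite (linearZZ (pcons _)) pconsE.
  by rewrite path_tuple_true ?sz // below_count_true.
case: t sz => [|h' t] sz.
  rewrite big_seq_cond big1 // => w; rewrite mem_words add0n => /andP[/eqP sw /eqP cw].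
  have := count_size id w; rewrite cw sw -ltnS -sz addn0 ltnn; by [].
move: sz; rewrite /= addnS => -[sz]; rewrite shufw_def linear_sum /= sz scaler_sumr.
under [LHS]eq_bigl => w do rewrite add0n.
rewrite big_seq_cond [RHS]big_seq_cond; apply: eq_bigr => w; rewrite mem_words.
move=> /andP[/eqP sw /eqP cw]; rewrite (linearZZ (pcons _)) pconsE scalerA -exprD.
by rewrite path_tuple_false ?sz // below_count_false.
Qed.

End ShuffleRec.

Section BilinearLift.
Variables (R : comNzRingType) (K L : choiceType) (V : lmodType R) (f : K -> L -> V).

Definition bifree (A : {malg R[K]}) (B : {malg R[L]}) : V :=
  free_lift (fun s => free_lift (f s) B) A.

Lemma bifree_linl B : linear (bifree^~ B).
Proof. exact: free_lift_is_linear. Qed.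

Lemma bifree_linr A : linear (bifree A).
Proof.
move=> a B B'; rewrite /bifree /free_lift scaler_sumr -big_split.
apply: eq_bigr => k _; rewrite -!/(free_lift _ _) free_lift_is_linear scalerDr.
by rewrite !scalerA mulrC.
Qed.

Lemma bifreeU s t : bifree << s >> << t >> = f s t.
Proof. by rewrite /bifree !free_liftU. Qed.
End BilinearLift.

Section ChainMaps.
Variables (R : comNzRingType) (G G' : digraph) (f : dimap G G').

Definition cmap : {linear chain R G -> chain R G'} :=
  @locked_with tt_key {linear chain R G -> chain R G'} (@chain_map R G G' f).
Lemma cmap_chain_map c : cmap c = chain_map R f c.
Proof. by rewrite /cmap locked_withE. Qed.
Lemma cmapE t : cmap << t >> = tuple_chain R (map f t).
Proof. by rewrite cmap_chain_map; apply: free_liftU. Qed.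

Lemma cmap1 x : cmap << [:: x] >> = << [:: f x] >>.
Proof. by rewrite cmapE. Qed.

Lemma cmap_ccons x c : c \in @nd R G -> cmap (ccons R x c) = ccons R (f x) (cmap c).
Proof.
apply: (@supp_ext R _ _ _ (cmap \o ccons R x) (ccons R (f x) \o cmap)) => -[|y t] // yt /=.
rewrite cconsE /=; case: eqP => [<-|_]; last by rewrite !cmapE -tuple_chain_cons.
rewrite linear0 cmapE; case: t {yt} => [|z t]; first by rewrite tuple_chainE //= ccons1.
by rewrite [map _ _]/= tuple_chain_cons // cconsK.
Qed.

Lemma nd_cmap c : cmap c \in @nd R G'.
Proof.
elim/malg_ind: c => [|a c d cn dn|t]; first by rewrite linear0 rpred0.
  by rewrite linearP rpredD ?rpredZ.
by rewrite cmapE nd_tuple_chain.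
Qed.

Lemma ceps_cmap c : c \in @nd R G -> ceps R G' (cmap c) = ceps R G c.
Proof.
elim/nd_ind => [|a u v e1 e2|x|x t ndt IH]; rewrite ?linear0 //.
- by rewrite !linearP e1 e2.
- by rewrite cmap1 !cepsE.
by rewrite cmap_ccons ?mem_ndU // !ceps_ccons.
Qed.

Lemma cbd_cmap c : c \in @nd R G -> cbd R G' (cmap c) = cmap (cbd R G c).
Proof.
elim/nd_ind => [|a u v e1 e2|x|x t ndt IH]; rewrite ?linear0 //.
- by rewrite !linearP e1 e2.
- by rewrite cmap1 !cbd1 linear0.
rewrite cmap_ccons ?mem_ndU // !cbd_ccons ?nd_cmap ?mem_ndU // IH !(linearB cmap).
rewrite (linearZZ cmap) cmap1 (cmap_ccons x (nd_cbd _)).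
have -> : ceps R G' (cmap << t >>) = ceps R G << t >> by apply: ceps_cmap; rewrite mem_ndU.
by [].
Qed.

Lemma csgn_cmap c : c \in @nd R G -> csgn R G' (cmap c) = cmap (csgn R G c).
Proof.
elim/nd_ind => [|a u v e1 e2|x|x t ndt IH]; rewrite ?linear0 //.
- by rewrite !linearP e1 e2.
- by rewrite cmap1 !csgn1 (linearN cmap) cmap1.
by rewrite cmap_ccons ?mem_ndU // !csgn_ccons IH (linearN cmap) cmap_ccons ?nd_csgn ?mem_ndU.
Qed.

End ChainMaps.

(** * The shuffle product of chains and its recursion on cones *)

Section Nabla.
Variables (R : comNzRingType) (G H : digraph).
Implicit Types (g : G) (h : H) (s : seq G) (t : seq H).
Local Notation CG := (chain R G).
Local Notation CH := (chain R H).
Local Notation CB := (chain R (box G H)).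
Local Notation bcons g h := (@ccons R (box G H) (g, h)).
Local Notation ccons := (ccons R).
Local Notation nd := (@nd R _).
(** The tensor product of the two chain modules in concrete form: both are free, so it is free on
    pairs of basis elements. *)
Definition T2 : lmodType R := {malg R[(seq G * seq H)%type]}.

Definition tp : CG -> CH -> T2 :=
  @locked_with tt_key (CG -> CH -> T2) (bifree (fun s t => << (s, t) >> : T2)).
Definition nab : CG -> CH -> CB :=
  @locked_with tt_key (CG -> CH -> CB) (bifree (@shuffle R G H)).
Definition nabT : {linear T2 -> CB} :=
  @locked_with tt_key {linear T2 -> CB} (free_lift (fun st : seq G * seq H => shuffle R st.1 st.2)).

Lemma tp_linl B : linear (tp^~ B).
Proof. rewrite /tp locked_withE; exact: bifree_linl. Qed.
Lemma tp_linr A : linear (tp A).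
Proof. rewrite /tp locked_withE; exact: bifree_linr. Qed.
Lemma tpU s t : tp << s >> << t >> = << (s, t) >>.
Proof. rewrite /tp locked_withE; exact: bifreeU. Qed.
Lemma nab_linl B : linear (nab^~ B).
Proof. rewrite /nab locked_withE; exact: bifree_linl. Qed.
Lemma nab_linr A : linear (nab A).
Proof. rewrite /nab locked_withE; exact: bifree_linr. Qed.
Lemma nabU s t : nab << s >> << t >> = shuffle R s t.
Proof. rewrite /nab locked_withE; exact: bifreeU. Qed.
Lemma nab_nabla A B : nab A B = nabla_chain A B.
Proof. by rewrite /nab locked_withE. Qed.

Definition tpl B : {linear CG -> T2} := @locked_with tt_key {linear CG -> T2} (mklin (tp_linl B)).
Definition tpr A : {linear CH -> T2} := @locked_with tt_key {linear CH -> T2} (mklin (tp_linr A)).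
Definition nabl B : {linear CG -> CB} := @locked_with tt_key {linear CG -> CB} (mklin (nab_linl B)).
Definition nabr A : {linear CH -> CB} := @locked_with tt_key {linear CH -> CB} (mklin (nab_linr A)).
Lemma tplE A B : tp A B = tpl B A. Proof. by rewrite /tpl locked_withE. Qed.
Lemma tprE A B : tp A B = tpr A B. Proof. by rewrite /tpr locked_withE. Qed.
Lemma nablE A B : nab A B = nabl B A. Proof. by rewrite /nabl locked_withE. Qed.
Lemma nabrE A B : nab A B = nabr A B. Proof. by rewrite /nabr locked_withE. Qed.

Lemma tp0l B : tp 0 B = 0. Proof. by rewrite tplE linear0. Qed.
Lemma tp0r A : tp A 0 = 0. Proof. by rewrite tprE linear0. Qed.
Lemma tpNl A B : tp (- A) B = - tp A B. Proof. by rewrite !tplE linearN. Qed.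
Lemma tpNr A B : tp A (- B) = - tp A B. Proof. by rewrite !tprE linearN. Qed.
Lemma tpDl A A' B : tp (A + A') B = tp A B + tp A' B. Proof. by rewrite !tplE linearD. Qed.
Lemma tpDr A B B' : tp A (B + B') = tp A B + tp A B'. Proof. by rewrite !tprE linearD. Qed.
Lemma tpZl a A B : tp (a *: A) B = a *: tp A B. Proof. by rewrite !tplE linearZZ. Qed.
Lemma tpZr a A B : tp A (a *: B) = a *: tp A B. Proof. by rewrite !tprE linearZZ. Qed.
Lemma nab0l B : nab 0 B = 0. Proof. by rewrite nablE linear0. Qed.
Lemma nab0r A : nab A 0 = 0. Proof. by rewrite nabrE linear0. Qed.
Lemma nabNl A B : nab (- A) B = - nab A B. Proof. by rewrite !nablE linearN. Qed.
Lemma nabNr A B : nab A (- B) = - nab A B. Proof. by rewrite !nabrE linearN. Qed.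
Lemma nabDl A A' B : nab (A + A') B = nab A B + nab A' B. Proof. by rewrite !nablE linearD. Qed.
Lemma nabDr A B B' : nab A (B + B') = nab A B + nab A B'. Proof. by rewrite !nabrE linearD. Qed.
Lemma nabZl a A B : nab (a *: A) B = a *: nab A B. Proof. by rewrite !nablE linearZZ. Qed.
Lemma nabZr a A B : nab A (a *: B) = a *: nab A B. Proof. by rewrite !nabrE linearZZ. Qed.

Lemma nabT_tp A B : nabT (tp A B) = nab A B.
Proof.
rewrite tplE nablE; apply: (@malg_ext R _ _ (nabT \o tpl B) (nabl B)) => s /=.
rewrite -tplE -nablE tprE nabrE.
apply: (@malg_ext R _ _ (nabT \o tpr << s >>) (nabr << s >>)) => t /=.
rewrite -tprE -nabrE tpU nabU /nabT locked_withE; exact: free_liftU.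
Qed.

Lemma shufw_head g s h t :
  shufw R g s h t \in supp_pred (fun u : seq (box G H) => ohead u == Some (g, h)).
Proof.
rewrite shufw_def rpred_sum // => w _; rewrite rpredZ // supp_predU.
by rewrite /path_tuple iota0S /= !take0.
Qed.

Lemma ccons_shufw x g s h t : ccons x (shufw R g s h t) =
  if x == (g, h) then 0 else pcons R x (shufw R g s h t).
Proof.
have hd := shufw_head g s h t; case: eqP => [->|/eqP xgh].
  apply: (supp_ext0 _ hd) => -[|y u] //= /eqP[->].
  by rewrite cconsE /= eqxx.
apply: (@supp_ext R _ _ _ (ccons x) (pcons R x) _ _ hd) => -[|y u] //= /eqP[->].
by rewrite pconsE ccons_neq.
Qed.

Lemma nab_cons g s h t : nab << g :: s >> << h :: t >> = shufw R g s h t.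
Proof. by rewrite nabU shufwE. Qed.

Lemma nab11 g h : nab << [:: g] >> << [:: h] >> = << [:: (g, h)] >>.
Proof. by rewrite nab_cons shufw00. Qed.

Lemma nab1c g h B : B \in nd ->
  nab << [:: g] >> (ccons h B) = bcons g h (nab << [:: g] >> B).
Proof.
rewrite !nabrE; apply: (@supp_ext R _ _ _ (nabr << [:: g] >> \o ccons h)
  (bcons g h \o nabr << [:: g] >>)) => -[|h' t] // ht.
rewrite /= -!nabrE cconsE /= nab_cons ccons_shufw xpair_eqE eqxx /=.
by case: eqP => _; rewrite ?nab0r // nab_cons shufw_rec //= add0r expr0 scale1r.
Qed.

Lemma nabc1 g h A : A \in nd ->
  nab (ccons g A) << [:: h] >> = bcons g h (nab A << [:: h] >>).
Proof.
rewrite !nablE; apply: (@supp_ext R _ _ _ (nabl << [:: h] >> \o ccons g)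
  (bcons g h \o nabl << [:: h] >>)) => -[|g' s] // gs.
rewrite /= -!nablE cconsE /= nab_cons ccons_shufw xpair_eqE eqxx andbT.
by case: eqP => _; rewrite ?nab0l // nab_cons shufw_rec //= addr0.
Qed.

(** This is [shufw_rec] in terms of cones, the sign of a vertical first step being carried by
    [csgn]. If a cone on the left is degenerate, the terms that remain on the right start with
    [(g, h)] and are killed by the outer cone. *)
Lemma nabcc_tuple g h g' s h' t :
  nab (ccons g << g' :: s >>) (ccons h << h' :: t >>) =
    bcons g h (nab << g' :: s >> (ccons h << h' :: t >>) +
                  nab (ccons g (csgn R G << g' :: s >>)) << h' :: t >>).
Proof.
rewrite csgnE linearZZ !cconsE /=.
have [->|gg'] := eqVneq g g'; have [->|hh'] := eqVneq h h'.
- by rewrite scaler0 !nab0l nab0r addr0 linear0.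
- by rewrite scaler0 !nab0l addr0 nab_cons ccons_shufw eqxx.
- by rewrite !nab0r add0r nabZl nab_cons linearZZ ccons_shufw eqxx scaler0.
rewrite nabZl (linearD (bcons g h)) (linearZZ (bcons g h)).
rewrite (nab_cons g (g' :: s)) (nab_cons g' s) (nab_cons g (g' :: s) h' t).
rewrite (@shufw_rec R G H g (g' :: s) h (h' :: t) isT).
have -> : bcons g h (shufw R g' s h (h' :: t)) = pcons R (g, h) (shufw R g' s h (h' :: t)).
  by rewrite ccons_shufw xpair_eqE (negPf gg').
have -> : bcons g h (shufw R g (g' :: s) h' t) = pcons R (g, h) (shufw R g (g' :: s) h' t).
  by rewrite ccons_shufw xpair_eqE (negPf hh') andbF.
by [].
Qed.

Lemma nabcc g h A B : A \in nd -> B \in nd ->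
  nab (ccons g A) (ccons h B) =
    bcons g h (nab A (ccons h B) + nab (ccons g (csgn R G A)) B).
Proof.
elim/supp_ind => [_|a A1 A2 e1 e2 nB|[|g' s] // _].
- by rewrite !linear0 !nab0l addr0 linear0.
- rewrite !linearP !nabDl !nabZl e1 // e2 // -linearP; congr (ccons _ _).
  by rewrite scalerDr addrACA.
elim/supp_ind => [|a B1 B2 e1 e2|[|h' t] // _].
- by rewrite !linear0 !nab0r addr0 linear0.
- rewrite !linearP !nabDr !nabZr e1 // e2 // -linearP; congr (ccons _ _).
  by rewrite scalerDr addrACA.
exact: nabcc_tuple.
Qed.

End Nabla.

Ltac malg_ring :=
  apply/malgP => ?; rewrite ?(mcoeffD, mcoeffB, mcoeffN, mcoeffZ, mcoeff0); ring.

(** * The Eilenberg-Zilber theorem *)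

Lemma snd_dimapP (G H : digraph) (u v : box G H) :
  edge u v -> u.2 = v.2 \/ edge u.2 v.2.
Proof. by case/orP => /andP[/eqP ? ?]; [right|left]. Qed.
Definition snd_dimap (G H : digraph) : dimap (box G H) H := Dimap (@snd_dimapP G H).

Section EilenbergZilber.
Variables (R : comNzRingType) (G H : digraph).
Implicit Types (g : G) (h : H) (s : seq G) (t : seq H).
Local Notation CG := (chain R G).
Local Notation CH := (chain R H).
Local Notation CB := (chain R (box G H)).
Local Notation bcons g h := (@ccons R (box G H) (g, h)).
Local Notation xcons := (@ccons R (box G H)).
Local Notation ccons := (ccons R).
Local Notation cbd := (cbd R _).
Local Notation csgn := (csgn R _).
Local Notation ceps := (ceps R _).
Local Notation nd := (@nd R _).
Local Notation nab := (@nab R G H).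
Local Notation nabT := (@nabT R G H).
Local Notation tp := (@tp R G H).
Local Notation T2 := (T2 R G H).

Section TensorLift.
Variables (V : lmodType R) (f : seq G -> seq H -> V).
Definition tpf : {linear T2 -> V} :=
  @locked_with tt_key {linear T2 -> V} (free_lift (fun st : seq G * seq H => f st.1 st.2)).

Lemma tpf_tp (F : CG -> CH -> V) :
  (forall B, linear (F^~ B)) -> (forall A, linear (F A)) ->
  (forall s t, F << s >> << t >> = f s t) -> forall A B, tpf (tp A B) = F A B.
Proof.
move=> Fl Fr FE A B; rewrite tplE.
apply: (@malg_ext R _ _ (tpf \o tpl G B) (mklin (Fl B))) => {A}s /=.
rewrite -tplE tprE.
apply: (@malg_ext R _ _ (tpf \o tpr H << s >>) (mklin (Fr << s >>))) => {B}t /=.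
rewrite -tprE tpU FE /tpf locked_withE; exact: free_liftU.
Qed.
End TensorLift.

(** Follows the recursion [nabcc]: a pair of cones is reduced to the two pairs in which one cone has
    been removed. *)
Lemma nd_ind2 (P : CG -> CH -> Prop) :
  (forall B, P 0 B) -> (forall a A A' B, P A B -> P A' B -> P (a *: A + A') B) ->
  (forall A, P A 0) -> (forall a A B B', P A B -> P A B' -> P A (a *: B + B')) ->
  (forall g h, P << [:: g] >> << [:: h] >>) ->
  (forall g h t, nondegen t -> P << [:: g] >> << t >> -> P << [:: g] >> (ccons h << t >>)) ->
  (forall g h s, nondegen s -> P << s >> << [:: h] >> -> P (ccons g << s >>) << [:: h] >>) ->
  (forall g h s t, nondegen s -> nondegen t -> P << s >> (ccons h << t >>) ->
    P (ccons g << s >>) << t >> -> P (ccons g << s >>) (ccons h << t >>)) ->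
  forall A B, A \in nd -> B \in nd -> P A B.
Proof.
move=> P0l PDl P0r PDr P11 P1c Pc1 Pcc A B nA; move: A nA B.
apply: nd_ind => [B _|a A A' IH IH' B nB|g|g s nds IH].
- exact: P0l.
- by apply: PDl; [apply: IH|apply: IH'].
- apply: nd_ind => [|a A A' IH IH'|h|h t ndt IH] //; [exact: PDr|exact: P1c].
apply: nd_ind => [|a A A' IH1 IH2|h|h t ndt IH'] //; first exact: PDr.
  by apply: Pc1 => //; apply: IH; rewrite mem_ndU.
by apply: Pcc => //; apply: IH; rewrite nd_ccons ?mem_ndU.
Qed.

Lemma nd_nab A B : A \in nd -> B \in nd -> nab A B \in nd.
Proof.
move: A B; apply: (nd_ind2 (P := fun A B => nab A B \in nd))
  => [B|a A A' B e1 e2|A|a A B B' e1 e2|g h|g h t ndt|g h s nds|g h s t nds ndt e1 e2].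
- by rewrite nab0l rpred0.
- by rewrite nabDl nabZl rpredD ?rpredZ.
- by rewrite nab0r rpred0.
- by rewrite nabDr nabZr rpredD ?rpredZ.
- by rewrite nab11 mem_ndU.
- by move=> n1; rewrite nab1c ?mem_ndU // nd_ccons.
- by move=> n1; rewrite nabc1 ?mem_ndU // nd_ccons.
rewrite nabcc ?mem_ndU // nd_ccons // rpredD //.
by rewrite csgnE (linearZZ (ccons g)) nabZl rpredZ.
Qed.

Lemma ceps_nab A B : A \in nd -> B \in nd -> ceps (nab A B) = (ceps A : R) * ceps B.
Proof.
move: A B; apply: (nd_ind2 (P := fun A B => ceps (nab A B) = (ceps A : R) * ceps B))
  => [B|a A A' B e1 e2|A|a A B B' e1 e2|g h|g h t ndt|g h s nds|g h s t nds ndt e1 e2].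
- by rewrite nab0l !linear0 mul0r.
- by rewrite nabDl nabZl !(linearP ceps) e1 e2 mulrDl -mulrA.
- by rewrite nab0r !linear0 mulr0.
- by rewrite nabDr nabZr !(linearP ceps) e1 e2 mulrDr mulrCA.
- by rewrite nab11 !cepsE mul1r.
- by move=> n1; rewrite nab1c ?mem_ndU // !ceps_ccons mulr0.
- by move=> n1; rewrite nabc1 ?mem_ndU // !ceps_ccons mul0r.
by rewrite nabcc ?mem_ndU // !ceps_ccons mul0r.
Qed.

Lemma cbd_nab_cc g h s t : nondegen s -> nondegen t ->
  (forall A B, A \in nd -> B \in nd -> A = << s >> -> B = ccons h << t >> ->
     cbd (nab A B) = nab (cbd A) B - nab (csgn A) (cbd B)) ->
  cbd (nab (ccons g << s >>) << t >>) =
    nab (cbd (ccons g << s >>)) << t >> - nab (csgn (ccons g << s >>)) (cbd << t >>) ->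
  cbd (nab (ccons g << s >>) (ccons h << t >>)) =
    nab (cbd (ccons g << s >>)) (ccons h << t >>) -
    nab (csgn (ccons g << s >>)) (cbd (ccons h << t >>)).
Proof.
rewrite -(mem_ndU R) -[in nondegen t](mem_ndU R) => nA nB /(_ _ _ nA (nd_ccons h nB) erefl erefl) IH1 IH2.
(* The recursion [nabcc] produces [csgn] of the tuple, which is a multiple of the tuple itself; the
   hypothesis is scaled accordingly. *)
have {}IH2 : cbd (nab (ccons g (csgn << s >>)) << t >>) =
    nab (cbd (ccons g (csgn << s >>))) << t >> - nab (csgn (ccons g (csgn << s >>))) (cbd << t >>).
  rewrite csgnE !(linearZZ (ccons g)) (linearZZ cbd) (linearZZ csgn) !nabZl (linearZZ cbd) IH2.
  by rewrite scalerBr.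
set A : CG := << s >> in nA IH1 IH2 *; set B : CH := << t >> in nB IH1 IH2 *.
clearbody A B => {s t}; rewrite nabcc //.
have nAs := nd_csgn nA; have nbA := nd_cbd A; have nbB := nd_cbd B.
have eA : cbd (ccons g A) = A - ccons g (cbd A) - (ceps A : R) *: << [:: g] >>.
  exact: cbd_ccons.
have eAs : cbd (ccons g (csgn A)) = csgn A + ccons g (csgn (cbd A)) + (ceps A : R) *: << [:: g] >>.
  rewrite (cbd_ccons g nAs) (cbd_csgn nA) ceps_csgn scaleNr opprK (linearN (ccons g)).
  by rewrite opprK.
have eB : cbd (ccons h B) = B - ccons h (cbd B) - (ceps B : R) *: << [:: h] >>.
  exact: cbd_ccons.
have eT1 : cbd (nab A (ccons h B)) = nab (cbd A) (ccons h B) - nab (csgn A) B +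
    nab (csgn A) (ccons h (cbd B)) + (ceps B : R) *: nab (csgn A) << [:: h] >>.
  rewrite IH1 eB 2!nabDr 2!nabNr nabZr; malg_ring.
have eT2 : cbd (nab (ccons g (csgn A)) B) = nab (csgn A) B + nab (ccons g (csgn (cbd A))) B +
    (ceps A : R) *: nab << [:: g] >> B + nab (ccons g A) (cbd B).
  rewrite IH2 eAs csgn_ccons csgnK nabNl opprK 2!nabDl nabZl; malg_ring.
have e1 := nabcc g h nbA nB; have e2 := nabcc g h nAs nbB.
have e3 := nab1c g h nB; have e4 := nabc1 g h nAs.
rewrite csgnK in e2.
(* The augmentation term of the cone formula drops out: each of the two products has a factor that
   is a cone, of augmentation zero. *)
have e5 : cbd (bcons g h (nab A (ccons h B) + nab (ccons g (csgn A)) B)) =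
   nab A (ccons h B) + nab (ccons g (csgn A)) B -
   bcons g h (cbd (nab A (ccons h B) + nab (ccons g (csgn A)) B)).
  rewrite cbd_ccons; last by rewrite rpredD ?nd_nab ?nd_ccons.
  by rewrite (linearD ceps) !ceps_nab ?nd_ccons // !ceps_ccons mulr0 mul0r addr0 scale0r subr0.
rewrite e5 eA eB csgn_ccons; set X := ccons h B in e1 e3 eT1 *; set Y := ccons g (csgn A) in e2 e4 eT2 *.
have -> : nab (- Y) (B - ccons h (cbd B) - (ceps B : R) *: << [:: h] >>) =
    nab Y (ccons h (cbd B)) + (ceps B : R) *: nab Y << [:: h] >> - nab Y B.
  rewrite nabNl 2!nabDr 2!nabNr nabZr; malg_ring.
have -> : nab (A - ccons g (cbd A) - (ceps A : R) *: << [:: g] >>) X =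
    nab A X - nab (ccons g (cbd A)) X - (ceps A : R) *: nab << [:: g] >> X.
  by rewrite 2!nabDl 2!nabNl nabZl.
have -> : bcons g h (cbd (nab A X + nab Y B)) = nab (ccons g (cbd A)) X +
    nab Y (ccons h (cbd B)) + (ceps B : R) *: nab Y << [:: h] >> +
    (ceps A : R) *: nab << [:: g] >> X.
  rewrite e1 e2 e3 e4 (linearD cbd) eT1 eT2 -2!(linearZZ (bcons g h)) -3!(linearD (bcons g h)).
  apply: congr1; malg_ring.
malg_ring.
Qed.

(** The Leibniz rule; the minus sign belongs to [csgn], whose exponent exceeds the degree by one. *)
Lemma cbd_nab A B : A \in nd -> B \in nd ->
  cbd (nab A B) = nab (cbd A) B - nab (csgn A) (cbd B).
Proof.
move: A B; apply: (nd_ind2 (P := fun A B => cbd (nab A B) = nab (cbd A) B - nab (csgn A) (cbd B)))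
  => [B|a A A' B e1 e2|A|a A B B' e1 e2|g h|g h t ndt IH|g h s nds IH|g h s t nds ndt e1 e2].
- by rewrite nab0l !linear0 !nab0l subr0.
- rewrite nabDl nabZl !(linearP cbd) (linearP csgn) e1 e2 2!nabDl 2!nabZl; malg_ring.
- by rewrite nab0r !linear0 !nab0r subr0.
- rewrite nabDr nabZr !(linearP cbd) e1 e2 2!nabDr 2!nabZr; malg_ring.
- by rewrite nab11 !cbd1 nab0l nab0r subr0.
- have ndT : << t >> \in nd :> bool by rewrite mem_ndU.
  have nd1 : << [:: g] >> \in nd :> bool by rewrite mem_ndU.
  rewrite (nab1c g h ndT) (cbd_ccons _ (nd_nab nd1 ndT)) IH cbd1 !nab0l !sub0r.
  rewrite csgn1 2!nabNl !opprK (ceps_nab nd1 ndT) cepsE mul1r (cbd_ccons h ndT).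
  by rewrite 2!nabDr 2!nabNr nabZr nab11 (nab1c g h (nd_cbd _)).
- have ndS : << s >> \in nd :> bool by rewrite mem_ndU.
  have nd1 : << [:: h] >> \in nd :> bool by rewrite mem_ndU.
  rewrite (nabc1 g h ndS) (cbd_ccons _ (nd_nab ndS nd1)) IH cbd1 !nab0r !subr0.
  rewrite (ceps_nab ndS nd1) [ceps << [:: h] >>]cepsE mulr1 (cbd_ccons g ndS).
  by rewrite 2!nabDl 2!nabNl nabZl nab11 (nabc1 g h (nd_cbd _)).
by apply: cbd_nab_cc => // A B _ _ -> ->.
Qed.

Definition ndT : {pred T2} :=
  supp_pred (fun st : seq G * seq H => nondegen st.1 && nondegen st.2).
HB.instance Definition _ := GRing.SubmodClosed.on ndT.

Lemma ndT_tp A B : A \in nd -> B \in nd -> tp A B \in ndT.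
Proof.
move=> nA; rewrite tprE; apply: supp_lin => t ndt; rewrite -tprE tplE.
apply: supp_lin nA => s nds.
by rewrite -tplE tpU supp_predU nds.
Qed.

Lemma ndT_ext (V : lmodType R) (f k : {linear T2 -> V}) :
  (forall A B, A \in nd -> B \in nd -> f (tp A B) = k (tp A B)) ->
  forall u, u \in ndT -> f u = k u.
Proof.
move=> e; apply: supp_ext => -[s t] /= /andP[nds ndt].
by rewrite -tpU; apply: e; rewrite mem_ndU.
Qed.

Definition cl g : {linear T2 -> T2} := tpf (fun s t => tp (ccons g << s >>) << t >>).
Lemma cl_tp g A B : cl g (tp A B) = tp (ccons g A) B.
Proof.
apply: (tpf_tp (F := fun A B => tp (ccons g A) B)) => // [{}B a u v|{}A a u v].
  by rewrite linearP tpDl tpZl.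
by rewrite tpDr tpZr.
Qed.

Definition dT : {linear T2 -> T2} :=
  tpf (fun s t => tp (cbd << s >>) << t >> - tp (csgn << s >>) (cbd << t >>)).
Lemma dT_tp A B : dT (tp A B) = tp (cbd A) B - tp (csgn A) (cbd B).
Proof.
apply: (tpf_tp (F := fun A B => tp (cbd A) B - tp (csgn A) (cbd B))) => // [{}B a u v|{}A a u v].
  rewrite (linearP cbd) (linearP csgn) 2!tpDl 2!tpZl; malg_ring.
rewrite (linearP cbd) 2!tpDr 2!tpZr; malg_ring.
Qed.

Definition epsT : {linear T2 -> CH} := tpf (fun s t => (ceps << s >> : R) *: << t >>).
Lemma epsT_tp A B : epsT (tp A B) = (ceps A : R) *: B.
Proof.
apply: (tpf_tp (F := fun A B => (ceps A : R) *: B)) => // [{}B a u v|{}A a u v].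
  by rewrite (linearP ceps) scalerDl scalerA.
by rewrite scalerDr !scalerA mulrC.
Qed.

Lemma cl_nd g u : u \in ndT -> cl g u \in ndT.
Proof.
apply: supp_lin => -[s t] /= /andP[nds ndt]; rewrite -tpU cl_tp.
by apply: ndT_tp; rewrite ?nd_ccons ?mem_ndU.
Qed.

Lemma clK g u : cl g (cl g u) = 0.
Proof.
apply: (@malg_ext0 R _ _ (cl g \o cl g)) u => -[s t] /=.
by rewrite -tpU !cl_tp cconsK tp0l.
Qed.

Lemma epsT_cl g u : epsT (cl g u) = 0.
Proof.
apply: (@malg_ext0 R _ _ (epsT \o cl g)) u => -[s t] /=.
by rewrite -tpU cl_tp epsT_tp ceps_ccons scale0r.
Qed.

Lemma cbd_nabT u : u \in ndT -> cbd (nabT u) = nabT (dT u).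
Proof.
apply: (@ndT_ext _ (cbd \o nabT) (nabT \o dT)) => A B nA nB /=.
by rewrite dT_tp (linearB nabT) !nabT_tp cbd_nab.
Qed.

(** The analogue of [cbd_ccons] for a cone on the first factor only: this cone contracts that factor
    to [g], and [epsT] records what is left. *)
Lemma dT_cl g u : u \in ndT -> dT (cl g u) = u - cl g (dT u) - tp << [:: g] >> (epsT u).
Proof.
rewrite [tp _ _]tprE.
apply: (@ndT_ext _ (dT \o cl g) ((idfun \- (cl g \o dT)) \- (tpr H << [:: g] >> \o epsT)))
  => A B nA nB.
rewrite /= -tprE epsT_tp cl_tp !dT_tp (cbd_ccons g nA) csgn_ccons (linearB (cl g)) !cl_tp.
rewrite 2!tpDl 3!tpNl tpZl tpZr; malg_ring.
Qed.

Definition psnd : {linear CB -> CH} := cmap R (snd_dimap G H).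

(** Unfolded, this is the usual Alexander-Whitney sum of [(g_0, ..., g_i) (x) (h_i, ..., h_n)] over
    [i]: the first summand is the term [i = 0], and in all other terms [g_0] is prepended to the
    front face. *)
Fixpoint aw_tuple (u : seq (box G H)) : T2 :=
  if u is x :: v then tp << [:: x.1] >> (psnd << u >>) + cl x.1 (aw_tuple v) else 0.
Definition aw : {linear CB -> T2} :=
  @locked_with tt_key {linear CB -> T2} (free_lift aw_tuple).
Lemma awE u : aw << u >> = aw_tuple u.
Proof. rewrite /aw locked_withE; exact: free_liftU. Qed.

Lemma aw1 x : aw << [:: x] >> = tp << [:: x.1] >> << [:: x.2] >>.
Proof. by rewrite awE /= linear0 addr0 /psnd cmap1. Qed.

Lemma psnd_ccons x c : c \in nd -> psnd (xcons x c) = ccons x.2 (psnd c).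
Proof. exact: cmap_ccons. Qed.

Lemma aw_ccons x c : c \in nd ->
  aw (xcons x c) = tp << [:: x.1] >> (ccons x.2 (psnd c)) + cl x.1 (aw c).
Proof.
rewrite tprE; apply: (@supp_ext R _ _ _ (aw \o xcons x)
  ((tpr H << [:: x.1] >> \o (ccons x.2 \o psnd)) \+ (cl x.1 \o aw))) => -[|y u] // yu /=.
rewrite -tprE cconsE /=; case: eqP => [<-|/eqP xy].
  rewrite linear0 awE /= (linearD (cl x.1)) clK cl_tp ccons1 tp0l !addr0.
  rewrite /psnd cmapE; case: u {yu} => [|z u]; first by rewrite tuple_chainE //= ccons1 tp0r.
  by rewrite [map _ _]/= tuple_chain_cons // cconsK tp0r.
have e : psnd << x :: y :: u >> = ccons x.2 (psnd << y :: u >>).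
  by rewrite -psnd_ccons ?mem_ndU // ccons_neq.
by rewrite -e !awE.
Qed.

Lemma nd_psnd c : psnd c \in nd. Proof. exact: nd_cmap. Qed.

Lemma aw_nd c : c \in nd -> aw c \in ndT.
Proof.
elim/nd_ind => [|a u v e1 e2|x|x t ndt IH]; first by rewrite linear0 rpred0.
- by rewrite linearP rpredD ?rpredZ.
- by rewrite aw1 ndT_tp ?mem_ndU.
rewrite aw_ccons ?mem_ndU // rpredD ?cl_nd //.
by apply: ndT_tp; rewrite ?nd_ccons ?mem_ndU ?nd_psnd.
Qed.

Lemma epsT_aw c : c \in nd -> epsT (aw c) = psnd c.
Proof.
elim/nd_ind => [|a u v e1 e2|x|x t ndt IH]; first by rewrite !linear0.
- by rewrite !linearP e1 e2.
- by rewrite aw1 epsT_tp cepsE scale1r /psnd cmap1.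
have nt : << t >> \in nd :> bool by rewrite mem_ndU.
by rewrite (aw_ccons x nt) (linearD epsT) epsT_cl addr0 epsT_tp cepsE scale1r psnd_ccons.
Qed.

Lemma aw_cbd c : c \in nd -> aw (cbd c) = dT (aw c).
Proof.
elim/nd_ind => [|a u v e1 e2|x|x t ndt IH]; first by rewrite !linear0.
- by rewrite !linearP e1 e2.
- by rewrite aw1 cbd1 linear0 dT_tp !cbd1 tp0l tp0r subr0.
have nt : << t >> \in nd :> bool by rewrite mem_ndU.
set A : CB := << t >> in nt IH *; clearbody A.
rewrite (cbd_ccons x nt) 2!(linearB aw) (linearZZ aw) aw1 (aw_ccons x (nd_cbd _)) IH.
rewrite (aw_ccons x nt) (linearD dT) dT_tp cbd1 tp0l (dT_cl _ (aw_nd nt)) (epsT_aw nt).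
rewrite (cbd_ccons _ (nd_psnd A)) csgn1 tpNl opprK 2!tpDr 2!tpNr tpZr.
rewrite (_ : ceps (psnd A) = ceps A); last exact: ceps_cmap.
rewrite (_ : cbd (psnd A) = psnd (cbd A)); last exact: cbd_cmap.
by malg_ring.
Qed.

(** A step in the first coordinate becomes a repetition after projection, so only one-vertex tuples
    in [G] contribute. *)
Lemma psnd_nab A B : A \in nd -> B \in nd -> psnd (nab A B) = (ceps A : R) *: B.
Proof.
move: A B; apply: (nd_ind2 (P := fun A B => psnd (nab A B) = (ceps A : R) *: B))
  => [B|a A A' B e1 e2|A|a A B B' e1 e2|g h|g h t ndt IH|g h s nds IH|g h s t nds ndt e1 e2].
- by rewrite nab0l !linear0 scale0r.
- by rewrite nabDl nabZl (linearP psnd) (linearP ceps) e1 e2 scalerDl scalerA.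
- by rewrite nab0r linear0 scaler0.
- by rewrite nabDr nabZr (linearP psnd) e1 e2 scalerDr !scalerA mulrC.
- by rewrite nab11 /psnd cmap1 cepsE scale1r.
- have ndT : << t >> \in nd :> bool by rewrite mem_ndU.
  have nd1 : << [:: g] >> \in nd :> bool by rewrite mem_ndU.
  by rewrite (nab1c g h ndT) (psnd_ccons _ (nd_nab nd1 ndT)) IH cepsE !scale1r.
- have ndS : << s >> \in nd :> bool by rewrite mem_ndU.
  have nd1 : << [:: h] >> \in nd :> bool by rewrite mem_ndU.
  rewrite (nabc1 g h ndS) (psnd_ccons _ (nd_nab ndS nd1)) IH ceps_ccons scale0r.
  by rewrite (linearZZ (ccons h)) ccons1 scaler0.
have ndS : << s >> \in nd :> bool by rewrite mem_ndU.
have ndT : << t >> \in nd :> bool by rewrite mem_ndU.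
rewrite (nabcc g h ndS ndT) psnd_ccons; last first.
  by rewrite rpredD ?nd_nab ?nd_ccons ?nd_csgn.
rewrite (linearD psnd) e1 csgnE (linearZZ (ccons g)) nabZl (linearZZ psnd) e2.
rewrite ceps_ccons !scale0r scaler0 addr0 (linearZZ (ccons h)) cconsK scaler0.
by [].
Qed.

(** On normalized chains this composite is the identity exactly, without a homotopy. For two cones,
    the projected term would start with [h] twice and the second shuffle term with [g] twice; both
    vanish by [cconsK]. *)
Lemma aw_nab A B : A \in nd -> B \in nd -> aw (nab A B) = tp A B.
Proof.
move: A B; apply: (nd_ind2 (P := fun A B => aw (nab A B) = tp A B))
  => [B|a A A' B e1 e2|A|a A B B' e1 e2|g h|g h t ndt IH|g h s nds IH|g h s t nds ndt e1 e2].
- by rewrite nab0l tp0l linear0.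
- by rewrite nabDl nabZl (linearP aw) e1 e2 tpDl tpZl.
- by rewrite nab0r linear0 tp0r.
- by rewrite nabDr nabZr (linearP aw) e1 e2 tpDr tpZr.
- by rewrite nab11 aw1.
- have ndT : << t >> \in nd :> bool by rewrite mem_ndU.
  have nd1 : << [:: g] >> \in nd :> bool by rewrite mem_ndU.
  rewrite (nab1c g h ndT) (aw_ccons _ (nd_nab nd1 ndT)) IH (psnd_nab nd1 ndT) cl_tp.
  by rewrite ccons1 tp0l addr0 cepsE scale1r.
- have ndS : << s >> \in nd :> bool by rewrite mem_ndU.
  have nd1 : << [:: h] >> \in nd :> bool by rewrite mem_ndU.
  rewrite (nabc1 g h ndS) (aw_ccons _ (nd_nab ndS nd1)) IH (psnd_nab ndS nd1) cl_tp.
  by rewrite (linearZZ (ccons h)) ccons1 scaler0 tp0r add0r.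
have ndS : << s >> \in nd :> bool by rewrite mem_ndU.
have ndT : << t >> \in nd :> bool by rewrite mem_ndU.
have ndhT := nd_ccons h ndT; have ndgS := nd_ccons g (nd_csgn ndS).
have e3 : aw (nab (ccons g (csgn << s >>)) << t >>) = tp (ccons g (csgn << s >>)) << t >>.
  by rewrite csgnE (linearZZ (ccons g)) nabZl (linearZZ aw) e2 tpZl.
rewrite (nabcc g h ndS ndT) (aw_ccons _ (rpredD (nd_nab ndS ndhT) (nd_nab ndgS ndT))).
rewrite (linearD psnd) (psnd_nab ndS ndhT) (psnd_nab ndgS ndT) ceps_ccons scale0r addr0.
rewrite (linearZZ (ccons h)) cconsK scaler0 tp0r add0r (linearD aw) e1 e3.
by rewrite (linearD (cl g)) !cl_tp cconsK tp0l addr0.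
Qed.

(* The homotopy between the identity and [nabT \o aw], by recursion on the tuple:
   prepending the first vertex [x] is a cone, [cbd (x :: c) = c - x :: cbd c]. *)
Fixpoint phi_tuple (u : seq (box G H)) : CB :=
  if u is x :: v then xcons x (nabT (aw_tuple u)) - xcons x (phi_tuple v) else 0.
Definition phi : {linear CB -> CB} :=
  @locked_with tt_key {linear CB -> CB} (free_lift phi_tuple).
Lemma phiE u : phi << u >> = phi_tuple u.
Proof. rewrite /phi locked_withE; exact: free_liftU. Qed.

Definition ez : {linear CB -> CB} := @locked_with tt_key {linear CB -> CB} (nabT \o aw).
Lemma ezE c : ez c = nabT (aw c). Proof. by rewrite /ez locked_withE. Qed.

Lemma ez1 x : ez << [:: x] >> = << [:: x] >>.
Proof. by rewrite ezE aw1 nabT_tp nab11 -surjective_pairing. Qed.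

Lemma nabT_nd u : u \in ndT -> nabT u \in nd.
Proof.
apply: supp_lin => -[s t] /= /andP[nds ndt].
by rewrite -tpU nabT_tp nd_nab ?mem_ndU.
Qed.

Lemma nd_ez c : c \in nd -> ez c \in nd.
Proof. by move=> nc; rewrite ezE nabT_nd ?aw_nd. Qed.

Lemma cbd_ez c : c \in nd -> cbd (ez c) = ez (cbd c).
Proof. by move=> nc; rewrite !ezE cbd_nabT ?aw_nd // aw_cbd. Qed.

Lemma phi1 x : phi << [:: x] >> = 0.
Proof. by rewrite phiE /= -/(aw_tuple [:: x]) -awE -ezE ez1 ccons1 linear0 subr0. Qed.

Lemma phi_ccons x c : c \in nd -> phi (xcons x c) = xcons x (ez (xcons x c)) - xcons x (phi c).
Proof.
apply: (@supp_ext R _ _ _ (phi \o xcons x) ((xcons x \o (ez \o xcons x)) \- (xcons x \o phi)))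
  => -[|y u] // yu /=.
rewrite cconsE /=; case: eqP => [<-|/eqP xy].
  by rewrite !linear0 phiE /= (linearB (xcons x)) !cconsK subr0 subrr.
by rewrite phiE ezE awE [LHS]/= phiE.
Qed.

Lemma ceps_ez_ccons x c : c \in nd -> ceps (ez (xcons x c)) = 0.
Proof.
move=> nc; rewrite ezE (aw_ccons x nc) (linearD nabT) nabT_tp (linearD ceps).
rewrite ceps_nab ?mem_ndU ?nd_ccons ?nd_psnd // ceps_ccons mulr0 add0r.
apply: (supp_ext0 (f := ceps \o (nabT \o cl x.1)) _ (aw_nd nc)) => -[s t] /= /andP[nds ndt].
by rewrite -tpU cl_tp nabT_tp ceps_nab ?nd_ccons ?mem_ndU // ceps_ccons mul0r.
Qed.

Lemma nd_phi c : c \in nd -> phi c \in nd.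
Proof.
elim/nd_ind => [|a u v e1 e2|x|x t ndt IH]; first by rewrite linear0 rpred0.
- by rewrite linearP rpredD ?rpredZ.
- by rewrite phi1 rpred0.
by rewrite phi_ccons ?mem_ndU // smB ?nd_ccons ?nd_ez ?nd_ccons ?mem_ndU.
Qed.

Lemma ceps_phi c : c \in nd -> ceps (phi c) = 0.
Proof.
elim/nd_ind => [|a u v e1 e2|x|x t ndt IH]; first by rewrite !linear0.
- by rewrite !linearP e1 e2 scaler0 addr0.
- by rewrite phi1 linear0.
by rewrite phi_ccons ?mem_ndU // (linearB ceps) !ceps_ccons subr0.
Qed.

Lemma phi_homotopy c : c \in nd -> cbd (phi c) + phi (cbd c) = ez c - c.
Proof.
elim/nd_ind => [|a u v e1 e2|x|x t ndt IH]; first by rewrite !linear0.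
- rewrite !(linearP cbd) !(linearP phi) (linearP cbd) (linearP ez).
  have -> : a *: cbd (phi u) + cbd (phi v) + (a *: phi (cbd u) + phi (cbd v)) =
      a *: (cbd (phi u) + phi (cbd u)) + (cbd (phi v) + phi (cbd v)) by malg_ring.
  by rewrite e1 e2; malg_ring.
- by rewrite phi1 cbd1 !linear0 ez1 subrr addr0.
have nt : << t >> \in nd :> bool by rewrite mem_ndU.
set A : CB := << t >> in nt IH *; clearbody A.
have nX := nd_ez (nd_ccons x nt).
have eb := cbd_ccons x nt.
rewrite eb 2!(linearB phi) (linearZZ phi) phi1 scaler0 subr0.
rewrite (phi_ccons x nt) (phi_ccons x (nd_cbd A)) (linearB cbd).
rewrite (cbd_ccons x nX) (cbd_ccons x (nd_phi nt)) (ceps_ez_ccons x nt) (ceps_phi nt).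
rewrite !scale0r !subr0 (cbd_ez (nd_ccons x nt)) eb 2!(linearB ez) (linearZZ ez) ez1.
rewrite 2!(linearB (xcons x)) (linearZZ (xcons x)) ccons1 scaler0 subr0.
(* The induction hypothesis under the cone expresses the cone over [ez A]; the remaining terms then
   cancel. *)
have := congr1 (xcons x) IH; rewrite (linearD (xcons x)) (linearB (xcons x)) => e.
have -> : xcons x (ez A) = xcons x (cbd (phi A)) + xcons x (phi (cbd A)) + xcons x A.
  by rewrite e subrK.
malg_ring.
Qed.

End EilenbergZilber.

(** * The length filtration *)

Section Walks.
Variable G : digraph.
Implicit Types (x y z : G) (t : seq G).

Lemma walk0 x : walk x x 0. Proof. by exists [::]. Qed.

Lemma walk_cat x y z m n : walk x y m -> walk y z n -> walk x z (m + n).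
Proof.
move=> [p [xp <- <-]] [q [yq <- <-]]; exists (p ++ q).
by rewrite cat_path xp yq last_cat size_cat.
Qed.

Lemma walk_dist x y n : walk x y n -> exists2 m, dist x y = Some m & (m <= n)%N.
Proof.
move=> w; rewrite /dist; case: pselect => [e|]; last by case; exists n; apply/asboolP.
by case: ex_minnP => m _ min; exists m => //; apply: min; apply/asboolP.
Qed.

Lemma dist_walk x y m : dist x y = Some m -> walk x y m.
Proof.
rewrite /dist; case: pselect => // e [<-]; by case: ex_minnP => k /asboolP.
Qed.

(** A length bound witnessed by arbitrary walks instead of minimal ones. Such bounds compose by
    concatenation, so the filtration estimates never have to compute a distance. *)
Fixpoint rlen x t n : Prop :=
  if t is y :: t' then exists a b, [/\ walk x y a, rlen y t' b & (a + b <= n)%N] else True.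

Lemma reachable_rlen x t n : reachable_tuple (x :: t) && (tuple_length (x :: t) <= n)%N <->
  nondegen (x :: t) /\ rlen x t n.
Proof.
elim: t x n => [|y t IH] x n; first by split.
rewrite [reachable_tuple _]/= [tuple_length _]/= [nondegen _]/= [rlen _ _ _]/=.
split=> [/andP[/andP[/andP[xy dxy] rt] len]|[/andP[xy nt] [a [b [w r ab]]]]].
  case dE: (dist x y) dxy len => [d|] // _ len.
  have [|nt r] := (IH y (n - d)%N).1.
    by rewrite [reachable_tuple _]/= rt [tuple_length _]/=; move: len => /=; lia.
  split; first by rewrite xy.
  exists d, (n - d)%N; split=> //; first exact: dist_walk.
  by move: len => /=; lia.
have [d dE da] := walk_dist w; have := (IH y b).2 (conj nt r).
rewrite [reachable_tuple _]/= [tuple_length _]/= => /andP[rt len].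
by rewrite rt xy dE /=; move: len da ab; lia.
Qed.

(** Estimates by induction on tuples must remember the first vertex, since a further cone pays for a
    walk to it. *)
Definition hr x n k : pred (seq G) := fun u =>
  `[< exists t, [/\ u = x :: t, nondegen u, rlen x t n & size u = k] >].

Lemma hrP x n k u : hr x n k u <-> exists t, [/\ u = x :: t, nondegen u, rlen x t n & size u = k].
Proof. by split=> [/asboolP|?]; last exact/asboolP. Qed.

Lemma hr1 x n : hr x n 1 [:: x]. Proof. by apply/hrP; exists [::]. Qed.

Lemma hr_reach x n k u : hr x n k u -> reachable_tuple u /\ (tuple_length u <= n)%N /\ size u = k.
Proof. by case/hrP=> t [-> nd r sz]; have [_ /(_ (conj nd r))/andP[]] := reachable_rlen x t n. Qed.

Lemma reach_hr u : reachable_tuple u -> exists x, hr x (tuple_length u) (size u) u.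
Proof.
case: u => // x t rt; exists x; apply/hrP; exists t.
by have := (reachable_rlen x t (tuple_length (x :: t))).1; rewrite rt leqnn => /(_ isT)[].
Qed.

(** The tuples over which a cone with apex [x] stays within length [n]. Chains whose first vertex
    has changed, such as boundaries, live here. *)
Definition hw x n k : pred (seq G) := fun u =>
  `[< exists z m n', [/\ walk x z m, hr z n' k u & (m + n' <= n)%N] >].

Lemma hwP x n k u : hw x n k u <-> exists z m n', [/\ walk x z m, hr z n' k u & (m + n' <= n)%N].
Proof. by split=> [/asboolP|?]; last exact/asboolP. Qed.

Section Chains.
Variable R : comNzRingType.
Implicit Type c : chain R G.
Local Notation HR x n k := (supp_pred (R := R) (hr x n k)).
Local Notation HW x n k := (supp_pred (R := R) (hw x n k)).
Local Notation ccons := (ccons R).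

Lemma HR1 x n : (<< [:: x] >> : chain R G) \in HR x n 1.
Proof. by rewrite supp_predU hr1. Qed.

Lemma HW_ccons x n k c : c \in HW x n k -> ccons x c \in HR x n k.+1.
Proof.
apply: supp_lin => u /hwP[z [m [n' [w /hrP[t [-> nt r sz]] le]]]].
rewrite cconsE /=; case: eqP => [_|/eqP xz]; first by rewrite rpred0.
rewrite supp_predU; apply/hrP; exists (z :: t); split=> //; last by rewrite -sz.
  by rewrite /= xz.
by exists m, n'.
Qed.

Lemma HR_HW x y m n k c : walk x y m -> c \in HR y n k -> c \in HW x (m + n) k.
Proof. by move=> w; apply: supp_predS => u hu; apply/hwP; exists y, m, n. Qed.

Lemma HW_HW x y m n k c : walk x y m -> c \in HW y n k -> c \in HW x (m + n) k.
Proof.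
move=> w; apply: supp_predS => u /hwP[z [m' [n' [w' hu le]]]]; apply/hwP.
by exists z, (m + m')%N, n'; split=> //; [apply: walk_cat w'|rewrite -addnA leq_add2l].
Qed.

Lemma HW_mono x n n' k c : (n <= n')%N -> c \in HW x n k -> c \in HW x n' k.
Proof.
move=> le; apply: supp_predS => u /hwP[z [m' [n1 [w' hu le1]]]]; apply/hwP.
by exists z, m', n1; split=> //; apply: leq_trans le.
Qed.

Lemma HR_ccons x y m n n' k c : walk x y m -> (m + n <= n')%N -> c \in HR y n k ->
  ccons x c \in HR x n' k.+1.
Proof. by move=> w le hc; apply: HW_ccons; apply: (HW_mono le); apply: HR_HW hc. Qed.

Lemma hr_ind (P : G -> nat -> nat -> chain R G -> Prop) :
  (forall x n, P x n 1%N << [:: x] >>) ->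
  (forall x y m n n' k u, walk x y m -> (m + n <= n')%N -> hr y n k u -> P y n k << u >> ->
    P x n' k.+1 (ccons x << u >>)) ->
  forall x n k u, hr x n k u -> P x n k << u >>.
Proof.
move=> P1 Pc x n k u /hrP[t [-> {u}]]; elim: t x n k => [|y t IH] x n k nt r <- //=.
have [ndt ->] := nd_cons R nt isT; have [a [b [w rb le]]] := r.
apply: (Pc _ y a b) => //; first by apply/hrP; exists t.
exact: IH.
Qed.

(** The face without the first vertex begins elsewhere, but the walk to its new first vertex is
    already part of the budget. *)
Lemma HR_cbd x n k u : hr x n k u -> cbd R G << u >> \in HW x n k.-1.
Proof.
elim/hr_ind => {x n k u} [x n|x y m n n' k u w le hu IH]; first by rewrite cbd1 rpred0.
have nu : (<< u >> : chain R G) \in @nd R G by case/hrP: hu => t [_ ndu _ _]; rewrite mem_ndU.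
rewrite (cbd_ccons x nu) !smB //.
- by apply: (HW_mono le); apply: (HR_HW w); rewrite supp_predU.
- case: k hu IH => [|k] hu IH; first by have [t [-> _ _]] := (hrP _ _ _ _).1 hu.
  apply: (@HW_mono _ (0 + n')) => //; apply: (HR_HW (walk0 x)).
  by apply: HW_ccons; apply: (HW_mono le); apply: HW_HW IH.
rewrite cepsE; have [_ [_ <-]] := hr_reach hu.
case: eqP => [-> /=|_]; last by rewrite scale0r rpred0.
rewrite scale1r; apply: (@HW_mono _ (0 + n')) => //; apply: (HR_HW (walk0 x)); exact: HR1.
Qed.

Lemma HR_FRC x n k c (l i : int) : n%:Z <= l -> k%:Z = i + 1 -> c \in HR x n k -> c \in @FRC R G l i.
Proof.
move=> nl ki /allP hc; apply/allP => u /hc /hr_reach[ru [len sz]].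
by rewrite ru sz ki eqxx /=; apply: le_trans nl; rewrite lez_nat.
Qed.

Lemma HW_FRC x n k c (l i : int) : n%:Z <= l -> k%:Z = i + 1 -> c \in HW x n k -> c \in @FRC R G l i.
Proof.
move=> nl ki /allP hc; apply/allP => u /hc /hwP[z [m [n' [_ /hr_reach[ru [len sz]] le]]]].
rewrite ru sz ki eqxx /=; apply: le_trans nl; rewrite lez_nat.
by apply: leq_trans len _; apply: leq_trans le; rewrite leq_addl.
Qed.

Lemma FRC_hr (l i : int) u : (<< u >> : chain R G) \in @FRC R G l i ->
  exists x n k, [/\ hr x n k u, n%:Z <= l & k%:Z = i + 1].
Proof.
move/allP => /(_ u); rewrite msuppU oner_eq0 in_fset1 eqxx => /(_ isT)/and3P[ru /eqP sz len].
by have [x hx] := reach_hr ru; exists x, (tuple_length u), (size u).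
Qed.

Lemma FRC_lin (V : lmodType R) (f : {linear chain R G -> V}) (S : submodClosed V) (l i : int) :
  (forall x n k u, hr x n k u -> n%:Z <= l -> k%:Z = i + 1 -> f << u >> \in S) ->
  forall c, c \in @FRC R G l i -> f c \in S.
Proof.
move=> h c cF; apply: (supp_lin _ (cF : c \in supp_pred _)) => u /= uF.
have [x [n [k [hu nl ki]]]] : exists x n k, [/\ hr x n k u, n%:Z <= l & k%:Z = i + 1].
  by apply: FRC_hr; rewrite -topredE /= /FRC; apply: (etrans (supp_predU R _ u)).
exact: h hu nl ki.
Qed.

Lemma FRC_nd (l i : int) c : c \in @FRC R G l i -> c \in @nd R G.
Proof.
move=> /allP hc; apply/allP => u /hc /and3P[ru _ _].
by have [x /hrP[t []]] := reach_hr ru.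
Qed.

Lemma FRC_cbd (l i : int) c : c \in @FRC R G l i -> cbd R G c \in @FRC R G l (i - 1).
Proof.
apply: FRC_lin => x n k u hu nl ki; apply: (HW_FRC nl _ (HR_cbd hu)).
by case/hrP: hu ki => t [-> _ _]; case: k => // k _; lia.
Qed.

Lemma FRC_mono (l l' i : int) c : l <= l' -> c \in @FRC R G l i -> c \in @FRC R G l' i.
Proof.
move=> le /allP hc; apply/allP => u /hc /and3P[-> -> len] /=; exact: le_trans le.
Qed.

Lemma FRC_csgn (l i : int) c : c \in @FRC R G l i -> csgn R G c \in @FRC R G l i.
Proof.
apply: FRC_lin => x n k u hu nl ki; rewrite csgnE rpredZ //.
by apply: (HR_FRC (x := x) nl ki); rewrite supp_predU.
Qed.

Lemma FRC_csgnE (l : int) (i : int) c : c \in @FRC R G l i -> csgn R G c = - ((-1) ^+ `|i|%N *: c).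
Proof.
move=> cF; apply: (@supp_ext R _ _ _ (csgn R G) (\- (GRing.scale ((-1) ^+ `|i|%N) \o idfun))
  _ _ (cF : c \in supp_pred _)) => u /= /and3P[ru /eqP sz _].
rewrite csgnE -scaleNr; congr (_ *: _).
have -> : size u = `|i|%N.+1 by case: u ru sz => //= x u _; lia.
by rewrite exprS mulN1r.
Qed.

End Chains.
End Walks.

Section DimapWalks.
Variables (R : comNzRingType) (G G' : digraph) (f : dimap G G').

Lemma walk_map x y n : walk x y n -> exists2 m, (m <= n)%N & walk (f x) (f y) m.
Proof.
move=> [p [xp <- <-]] {y n}; elim: p x xp => [|y p IH] x /=; first by move=> _; exists 0%N => //; exact: walk0.
case/andP=> exy yp; have [m le w] := IH y yp.
have [->|e] := dimapP f exy; first by exists m => //; apply: leqW.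
exists m.+1 => //; apply: (walk_cat (m := 1) _ w).
by exists [:: f y]; rewrite /= e.
Qed.

Lemma HR_cmap x n k u : hr x n k u -> cmap R f << u >> \in supp_pred (hr (f x) n k).
Proof.
elim/(@hr_ind G R) => {x n k u} [x n|x y m n n' k u w le hu IH].
  by rewrite cmap1 supp_predU hr1.
rewrite cmap_ccons; last by rewrite mem_ndU; case/hrP: hu => t [].
have [m' le' w'] := walk_map w; apply: (HR_ccons w' _ IH).
by apply: leq_trans le; rewrite leq_add2r.
Qed.

Lemma FRC_cmap (l i : int) c : c \in @FRC R G l i -> cmap R f c \in @FRC R G' l i.
Proof. by apply: FRC_lin => x n k u hu nl ki; apply: HR_FRC nl ki (HR_cmap hu). Qed.
End DimapWalks.

(** * Length estimates in a box product for shuffles, the Alexander-Whitney map and the homotopy *)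

Section BoxWalks.
Variables (G H : digraph).
Implicit Types (g : G) (h : H).

Lemma walk_boxl g g' h n : walk g g' n -> @walk (box G H) (g, h) (g', h) n.
Proof.
move=> [p [gp <- <-]] {g' n}; exists [seq (a, h) | a <- p]; rewrite size_map; split=> //.
  elim: p g gp => //= a p IH g /andP[ga ap]; rewrite IH // ga eqxx andbT.
  by rewrite orbT.
by elim: p g {gp} => //=.
Qed.

Lemma walk_boxr g h h' n : walk h h' n -> @walk (box G H) (g, h) (g, h') n.
Proof.
move=> [p [gp <- <-]] {h' n}; exists [seq (g, a) | a <- p]; rewrite size_map; split=> //.
  by elim: p h gp => //= a p IH h /andP[ga ap]; rewrite IH // ga eqxx.
by elim: p h {gp} => //=.
Qed.

(** Every edge of the box product moves exactly one coordinate, so the lengths of the two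
    projections add up without loss. The bound for the Alexander-Whitney map rests on this. *)
Lemma walk_box_split (x y : box G H) n : walk x y n ->
  exists a b, [/\ walk x.1 y.1 a, walk x.2 y.2 b & (a + b)%N = n].
Proof.
move=> [p [xp <- <-]] {y n}; elim: p x xp => [|y p IH] x /=.
  by move=> _; exists 0%N, 0%N; split=> //; exact: walk0.
case/andP=> e yp; have [a [b [wa wb ab]]] := IH y yp.
case/orP: e => /andP[/eqP exy e].
  exists a, b.+1; rewrite exy addnS ab; split=> //.
  by apply: (walk_cat (m := 1) _ wb); exists [:: y.2]; rewrite /= e.
exists a.+1, b; rewrite exy addSn ab; split=> //.
by apply: (walk_cat (m := 1) _ wa); exists [:: y.1]; rewrite /= e.
Qed.

Variable R : comNzRingType.
Local Notation HR x n k := (supp_pred (R := R) (hr x n k)).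
Local Notation HRb g h n k := (supp_pred (R := R) (@hr (box G H) (g, h) n k)).
Local Notation nab := (@nab R G H).
Local Notation tp := (@tp R G H).
Local Notation CG := (chain R G).
Local Notation CH := (chain R H).
Local Notation CB := (chain R (box G H)).
Local Notation xcons := (@ccons R (box G H)).

Lemma hr_mem_nd (K : digraph) (x : K) n k u : hr x n k u -> (<< u >> : chain R K) \in @nd R K.
Proof. by rewrite mem_ndU => /hrP[t []]. Qed.

(** By [nabcc] each step of a shuffle moves along one coordinate and costs what it costs in that
    factor. Degrees add, so sizes add up to one less. *)
Lemma HR_nab g h a b k1 k2 s t : hr g a k1 s -> hr h b k2 t ->
  nab << s >> << t >> \in HRb g h (a + b) (k1 + k2).-1.
Proof.
move=> hs; move: hs h b k2 t.
apply: (@hr_ind G R (fun g a k1 A => forall h b k2 t, hr h b k2 t ->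
  nab A << t >> \in HRb g h (a + b) (k1 + k2).-1)) => {g a k1 s}.
  move=> g a h b k2 t.
  apply: (@hr_ind H R (fun h b k2 B => nab << [:: g] >> B \in HRb g h (a + b) (1 + k2).-1))
    => {h b k2 t}.
    by move=> h b; rewrite nab11 supp_predU; apply: hr1.
  move=> h h' m b b' k2 t w le ht IH.
  rewrite nab1c ?(hr_mem_nd ht) //; rewrite !add1n /= in IH *.
  by apply: (HR_ccons (walk_boxr g w) _ IH); rewrite addnCA leq_add2l.
move=> g g' m a a' k1 s w le hs IHs h b k2 t.
apply: (@hr_ind H R (fun h b k2 B => nab (ccons R g << s >>) B \in HRb g h (a' + b) (k1.+1 + k2).-1))
  => {h b k2 t}.
  move=> h b; rewrite nabc1 ?(hr_mem_nd hs) //; have := IHs h b 1%N [:: h] (hr1 h b).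
  rewrite !addn1 /=; apply: (HR_ccons (walk_boxl h w)).
  by rewrite addnA leq_add2r.
move=> h h' m' b b' k2 t w' le' ht IH.
rewrite nabcc ?(hr_mem_nd hs, hr_mem_nd ht) // (linearD (xcons _)) rpredD //.
  have IHs' B : B \in HR h b' k2.+1 -> nab << s >> B \in HRb g' h (a + b') (k1 + k2.+1).-1.
    rewrite nabrE; apply: (supp_lin (f := nabr H << s >>)) => u hu; rewrite -nabrE; exact: IHs.
  have : ccons R h << t >> \in HR h b' k2.+1.
    by apply: (HR_ccons w' le'); rewrite supp_predU.
  move/IHs'; rewrite addSn /= addnS /=; apply: (HR_ccons (walk_boxl h w)).
  by rewrite addnA leq_add2r.
have -> : nab (ccons R g (csgn R G << s >>)) << t >> =
    (-1) ^+ size s *: nab (ccons R g << s >>) << t >>.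
  by rewrite csgnE (linearZZ (ccons R g)) nabZl.
rewrite (linearZZ (xcons _)) rpredZ // addnS /=.
have : nab (ccons R g << s >>) << t >> \in HRb g h' (a' + b) (k1.+1 + k2).-1 by [].
rewrite addSn /=; apply: (HR_ccons (walk_boxr g w')).
by rewrite addnCA leq_add2l.
Qed.

Lemma FRC_nab (l l' i i' : int) A B : A \in @FRC R G l i -> B \in @FRC R H l' i' ->
  nab A B \in @FRC R (box G H) (l + l') (i + i').
Proof.
rewrite nablE => AF BF.
apply: (FRC_lin (f := nabl G B) _ AF) => g a k1 s hs al k1i; rewrite -nablE nabrE.
apply: (FRC_lin (f := nabr H << s >>) _ BF) => h b k2 t ht bl k2i; rewrite -nabrE.
apply: (HR_FRC _ _ (HR_nab hs ht)); first by lia.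
case/hrP: hs k1i => ? [-> _ _]; case: k1 => // k1 _; lia.
Qed.

(** The pairs met in the Alexander-Whitney map: the front face starts at [x.1], while the back face
    starts at a vertex [h] for whose distance from [x.2] the budget must still pay. The sizes add up
    to [k + 1] because the splitting vertex occurs in both faces. *)
Definition awr (x : box G H) n k : pred (seq G * seq H) := fun st =>
  `[< exists h m a b k1 k2, [/\ hr x.1 a k1 st.1 /\ hr h b k2 st.2, walk x.2 h m,
       (m + (a + b) <= n)%N & (k1 + k2)%N = k.+1] >].
Lemma awrP x n k st : awr x n k st <-> exists h m a b k1 k2,
  [/\ hr x.1 a k1 st.1 /\ hr h b k2 st.2, walk x.2 h m,
       (m + (a + b) <= n)%N & (k1 + k2)%N = k.+1].
Proof. by split=> [/asboolP|?]; last exact/asboolP. Qed.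
Local Notation AWR x n k := (supp_pred (R := R) (awr x n k)).

Lemma AWR_tp x n k h m a b k1 k2 A B : A \in HR x.1 a k1 -> B \in HR h b k2 ->
  walk x.2 h m -> (m + (a + b) <= n)%N -> (k1 + k2)%N = k.+1 -> tp A B \in AWR x n k.
Proof.
move=> hA hB w le sz; rewrite tplE; apply: (supp_lin (f := tpl G B) _ hA) => s hs.
rewrite -tplE tprE; apply: (supp_lin (f := tpr H << s >>) _ hB) => t ht.
by rewrite -tprE tpU supp_predU; apply/awrP; exists h, m, a, b, k1, k2.
Qed.

Lemma AWR_cl (x y : box G H) d n n' k u : walk x y d -> (d + n <= n')%N -> u \in AWR y n k ->
  cl R H x.1 u \in AWR x n' k.+1.
Proof.
move=> w le; have [d1 [d2 [w1 w2 dd]]] := walk_box_split w.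
apply: supp_lin => -[s t] /awrP[h [m [a [b [k1 [k2 [[/= hs ht] wm le' sz]]]]]]].
rewrite -tpU cl_tp.
apply: (AWR_tp (h := h) (m := d2 + m) (a := d1 + a) (b := b) (k1 := k1.+1) (k2 := k2)).
- by apply: (HR_ccons w1 (leqnn _)); rewrite supp_predU.
- by rewrite supp_predU.
- exact: walk_cat w2 wm.
- by move: dd le le'; lia.
by rewrite addSn sz.
Qed.

Lemma AWR_aw x n k u : hr x n k u -> aw R G H << u >> \in AWR x n k.
Proof.
elim/(@hr_ind (box G H) R) => {x n k u} [x n|x y m n n' k u w le hu IH].
  rewrite aw1; apply: (AWR_tp (h := x.2) (m := 0) (a := 0) (b := 0) (k1 := 1) (k2 := 1)) => //;
    by [rewrite supp_predU hr1|apply: walk0].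
rewrite (aw_ccons x (hr_mem_nd hu)) rpredD //; last exact: AWR_cl w le IH.
have [d1 [d2 [w1 w2 dd]]] := walk_box_split w.
apply: (AWR_tp (h := x.2) (m := 0) (a := 0) (b := d2 + n) (k1 := 1) (k2 := k.+1)).
- by rewrite supp_predU hr1.
- exact: HR_ccons w2 (leqnn _) (HR_cmap R (snd_dimap G H) hu).
- exact: walk0.
- by move: dd le; lia.
by rewrite add1n.
Qed.

(** The shuffled tuples start at [(x.1, h)] rather than at [x]; this is harmless, because the
    homotopy immediately takes a cone with apex [x]. *)
Lemma AWR_nabT x n k u : u \in AWR x n k -> nabT R G H u \in supp_pred (hw x n k).
Proof.
apply: supp_lin => -[s t] /awrP[h [m [a [b [k1 [k2 [[/= hs ht] wm le' sz]]]]]]].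
rewrite -tpU nabT_tp; have := HR_nab hs ht; rewrite sz /=.
case: x wm {hs} => g h0 /= wm hn.
exact: (@HW_mono (box G H) R (g, h0) _ _ _ _ le' (HR_HW (walk_boxr g wm) hn)).
Qed.

Lemma HR_phi x n k u : hr x n k u -> phi R G H << u >> \in supp_pred (hr x n k.+1).
Proof.
elim/(@hr_ind (box G H) R) => {x n k u} [x n|x y m n n' k u w le hu IH].
  by rewrite phi1 rpred0.
rewrite (phi_ccons x (hr_mem_nd hu)) smB //; last exact: HR_ccons w le IH.
apply: HW_ccons; rewrite ezE; apply: AWR_nabT.
have : xcons x << u >> \in supp_pred (hr x n' k.+1).
  by apply: (HR_ccons w le); rewrite supp_predU.
by apply: (supp_lin (f := aw R G H)) => v hv; apply: AWR_aw.
Qed.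

Lemma FRC_phi (l i : int) c : c \in @FRC R (box G H) l i ->
  phi R G H c \in @FRC R (box G H) l (i + 1).
Proof.
apply: FRC_lin => x n k u hu nl ki; apply: (HR_FRC nl _ (HR_phi hu)).
by rewrite -ki -addn1 PoszD.
Qed.

(* Pairs of tuples spanning [F_l (RC G (x) RC H)] in degree [i]. *)
Definition pairF (l i : int) : pred (seq G * seq H) := fun st =>
  [&& reachable_tuple st.1, reachable_tuple st.2,
      (tuple_length st.1 + tuple_length st.2)%:Z <= l &
      (size st.1 + size st.2)%:Z == i + 2].

Lemma FRC_aw (l i : int) c : c \in @FRC R (box G H) l i -> aw R G H c \in supp_pred (pairF l i).
Proof.
apply: FRC_lin => x n k u hu nl ki; apply: (supp_predS _ (AWR_aw hu)).
move=> [s t] /awrP[h [m [a [b [k1 [k2 [[/= hs ht] wm le sz]]]]]]].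
have [rs [ls ss]] := hr_reach hs; have [rt [lt st]] := hr_reach ht.
by apply/and4P; split=> //=; lia.
Qed.

End BoxWalks.

Section NablaNatural.
Variables (R : comNzRingType) (G G' H H' : digraph) (f : dimap G G') (g : dimap H H').

Lemma cmap_nab A B : A \in @nd R G -> B \in @nd R H ->
  cmap R (box_map f g) (nab A B) = nab (cmap R f A) (cmap R g B).
Proof.
move: A B; apply: (nd_ind2 (P := fun A B =>
  cmap R (box_map f g) (nab A B) = nab (cmap R f A) (cmap R g B)))
  => [B|a A A' B e1 e2|A|a A B B' e1 e2|x h|x h t ndt IH|x h s nds IH|x h s t nds ndt e1 e2].
- by rewrite nab0l !linear0 nab0l.
- by rewrite nabDl nabZl !linearP e1 e2 nabDl nabZl.
- by rewrite nab0r !linear0 nab0r.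
- by rewrite nabDr nabZr !linearP e1 e2 nabDr nabZr.
- by rewrite nab11 !cmap1 nab11.
- have nt : (<< t >> : chain R H) \in @nd R H by rewrite mem_ndU.
  have n1 : (<< [:: x] >> : chain R G) \in @nd R G by rewrite mem_ndU.
  rewrite (nab1c x h nt) (cmap_ccons _ _ (nd_nab n1 nt)) IH cmap1 (cmap_ccons g h nt).
  by rewrite (nab1c _ _ (nd_cmap _ _)).
- have ns : (<< s >> : chain R G) \in @nd R G by rewrite mem_ndU.
  have n1 : (<< [:: h] >> : chain R H) \in @nd R H by rewrite mem_ndU.
  rewrite (nabc1 x h ns) (cmap_ccons _ _ (nd_nab ns n1)) IH cmap1 (cmap_ccons f x ns).
  by rewrite (nabc1 _ _ (nd_cmap _ _)).
have nt : (<< t >> : chain R H) \in @nd R H by rewrite mem_ndU.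
have ns : (<< s >> : chain R G) \in @nd R G by rewrite mem_ndU.
have e3 : cmap R (box_map f g) (nab (ccons R x (csgn R G << s >>)) << t >>) =
    nab (cmap R f (ccons R x (csgn R G << s >>))) (cmap R g << t >>).
  by rewrite csgnE (linearZZ (ccons R x)) nabZl (linearZZ (cmap R f)) nabZl -e2 linearZZ.
have nX := rpredD (nd_nab ns (nd_ccons h nt)) (nd_nab (nd_ccons x (nd_csgn ns)) nt).
rewrite (nabcc x h ns nt) (cmap_ccons _ _ nX) (linearD (cmap R (box_map f g))) e1 e3.
rewrite (cmap_ccons f x ns) (cmap_ccons g h nt) (cmap_ccons f x (nd_csgn ns)) -csgn_cmap //.
by rewrite (nabcc _ _ (nd_cmap f _) (nd_cmap g _)).
Qed.
End NablaNatural.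

(** * The graded Kunneth sequence *)

(** Direct sums as an interface, for the same reason as [tensor_theory]; [std_gsum] realizes it by
    [dsum]. *)
Record gsum (R : comNzRingType) (I : choiceType) (F : I -> lmodType R) := GSum {
  gt : lmodType R;
  gin : forall i, {linear F i -> gt};
  gpr : forall i, {linear gt -> F i};
  glift : forall (P : lmodType R) (f : forall i, {linear F i -> P}), {linear gt -> P};
  gpr_in : forall i x, gpr i (gin i x) = x;
  gpr_in0 : forall i j x, i != j -> gpr j (gin i x) = 0;
  g_ext : forall x y, (forall i, gpr i x = gpr i y) -> x = y;
  g_ind : forall P : gt -> Prop, P 0 -> (forall x y, P x -> P y -> P (x + y)) ->
    (forall i x, P (gin i x)) -> forall x, P x;
  glift_in : forall (P : lmodType R) (f : forall i, {linear F i -> P}) i x,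
    glift f (gin i x) = f i x
}.

Section GSumTheory.
Variables (R : comNzRingType) (I : choiceType) (F : I -> lmodType R) (M : gsum F).
Implicit Types (x y : gt M) (S : seq I).

Definition ge i : {linear gt M -> gt M} := gin M i \o gpr M i.

Lemma ge_in i (x : F i) : ge i (gin M i x) = gin M i x.
Proof. by rewrite /= gpr_in. Qed.

Lemma ge_in0 i j (x : F i) : i != j -> ge j (gin M i x) = 0.
Proof. by move=> ij; rewrite /= gpr_in0 // linear0. Qed.

Lemma gpr_ge i x : gpr M i (ge i x) = gpr M i x.
Proof. by rewrite /= gpr_in. Qed.

Lemma gin_inj i : injective (gin M i).
Proof. by move=> x y /(congr1 (gpr M i)); rewrite !gpr_in. Qed.

Lemma g_fin x : exists S : seq I, forall i, i \notin S -> gpr M i x = 0.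
Proof.
elim/g_ind: x => [|x y [S xS] [S' yS]|i x]; first by exists [::] => i _; rewrite linear0.
  exists (S ++ S') => i; rewrite mem_cat negb_or => /andP[iS iS'].
  by rewrite linearD xS ?yS ?addr0.
by exists [:: i] => j; rewrite inE => ji; rewrite gpr_in0 // eq_sym.
Qed.

Lemma g_mk (f : forall i, F i) S : (forall i, i \notin S -> f i = 0) ->
  exists x, forall i, gpr M i x = f i.
Proof.
move=> fS; exists (\sum_(i <- undup S) gin M i (f i)) => i; rewrite linear_sum.
have [iS|iS] := boolP (i \in undup S).
  rewrite (bigD1_seq i) ?undup_uniq //= gpr_in big1 ?addr0 // => j ji.
  by rewrite gpr_in0.
rewrite big_seq big1 => [|j jS]; first by rewrite fS // -(mem_undup S).
by rewrite gpr_in0 //; apply: contraNneq iS => <-.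
Qed.

(** The freedom to enlarge the list of indices lets several elements be decomposed along a common
    list. *)
Lemma g_decomp x : exists S : seq I, forall S', uniq S' -> {subset S <= S'} ->
  \sum_(i <- S') ge i x = x.
Proof.
have [S xS] := g_fin x; exists S => S' uS sub; apply: g_ext => i; rewrite linear_sum.
have [iS|iS] := boolP (i \in S').
  by rewrite (bigD1_seq i) //= gpr_in big1 ?addr0 // => j ji; rewrite gpr_in0.
rewrite big_seq big1 => [|j jS].
  by rewrite xS //; apply: contra iS; apply: sub.
by rewrite /= gpr_in0 //; apply: contraNneq iS => <-.
Qed.

End GSumTheory.

(* A homology presentation of the total module of a graded differential module
   whose differential lowers degrees by [dl]. *)
Record hgraded (R : comNzRingType) (I : zmodType) (dl : I) (E E' : I -> lmodType R)
    (M : gsum E) (M' : gsum E') (X : hdata (gt M) (gt M')) := HGraded {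
  geZ : forall i : I, {linear hZ X -> hZ X};
  geB : forall i : I, {linear hB X -> hB X};
  ge_i : forall i z, hi X (geZ i z) = ge M i (hi X z);
  ge_j : forall i b, hj X (geB i b) = geZ i (hj X b);
  ge_d : forall i m, hd X (ge M i m) = geB (i - dl) (hd X m);
  ge_h : forall i z, hh X (geZ i z) = ge M' i (hh X z)
}.

Section GradedKunneth.
Variables (R : idomainType) (T : tensor_theory R) (pidR : is_pid R).
Variables (Q : resolution_theory R) (flQ : forall N, tflat T (res0 Q N)).
Variables (I : zmodType) (dl : I).
Local Notation TT := (ten T).
Local Notation tm := (tm_of T).
Local Notation tmap := (tmap_of T).
Local Notation "1" := (idl _).
Local Notation TorT := (TorT T Q).
Local Notation tor_map := (@tor_map R T Q _ _ _ _).
Local Notation tor_mapl := (@tor_mapl R T Q _ _ _ _).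

Section TensorGraded.
Variables (E F : I -> lmodType R) (M : gsum E) (N : gsum F).

Lemma ten_gind (P : TT (gt M) (gt N) -> Prop) :
  P 0 -> (forall x y, P x -> P y -> P (x + y)) ->
  (forall i j x y, P (tm (gin M i x) (gin N j y))) -> forall t, P t.
Proof.
move=> P0 PD Pt; apply: ten_ind => // x y.
elim/g_ind: x => [|x x' IH IH'|i x]; [by rewrite tm0l|by rewrite tmDl; apply: PD|].
by elim/g_ind: y => [|y y' IH IH'|j y]; [rewrite tm0r|rewrite tmDr; apply: PD|].
Qed.

Definition homog (k : I) (t : TT (gt M) (gt N)) : Prop :=
  forall i j, i + j != k -> tmap (ge M i) (ge N j) t = 0.

Lemma ten_fin (P : I -> lmodType R) (K : lmodType R) (g : forall i, {linear K -> P i})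
    (t : TT (gt M) K) :
  exists S : seq I, forall i, i \notin S -> tmap (gpr M i) (g i) t = 0.
Proof.
elim/(@ten_ind R T): t => [|x y [S xS] [S' yS]|x y].
- by exists [::] => i _; rewrite linear0.
- exists (S ++ S') => i; rewrite mem_cat negb_or => /andP[iS iS'].
  by rewrite linearD xS ?yS ?addr0.
by have [S xS] := g_fin x; exists S => i iS; rewrite tm_mapE xS // tm0l.
Qed.
End TensorGraded.

Variables (E E' F F' X X' : I -> lmodType R).
Variables (gE : gsum E) (gE' : gsum E') (gF : gsum F) (gF' : gsum F').
Variables (gX : gsum X) (gX' : gsum X').
Variables (hE : hdata (gt gE) (gt gE')) (hF : hdata (gt gF) (gt gF')).
Variables (hX : hdata (gt gX) (gt gX')) (s : hsign hE).
Variables (grE : hgraded dl hE) (grF : hgraded dl hF) (grX : hgraded dl hX).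
Hypothesis flE : tflat T (gt gE).
Variables (nab : {linear TT (gt gE) (gt gF) -> gt gX}).
Variables (nab' : {linear TT (gt gE') (gt gF') -> gt gX'}).
Local Notation D := (kdiff s hF).

Hypothesis nab_d : forall t, nab (D t) = hdiff hX (nab t).
Hypothesis nab_h : forall t, exists x,
  hi hX x = nab (tmap (hi hE) (hi hF) t) /\ hh hX x = nab' (tmap (hh hE) (hh hF) t).
Hypothesis q1 : forall t x, D t = 0 -> nab t = hdiff hX x -> exists v, t = D v.
(** Surjectivity of [nab] on homology. That [t] can be homogeneous of the degree of the class is
    what gives the connecting map its degree. *)
Hypothesis q2 : forall k z x, hi hX z = gin gX k x ->
  exists t v, [/\ homog k t, D t = 0 & hi hX z = nab t + hdiff hX v].
Hypothesis nab'_gr : forall i j x y,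
  ge gX' (i + j) (nab' (tm (gin gE' i x) (gin gF' j y))) = nab' (tm (gin gE' i x) (gin gF' j y)).

Let flZ : tflat T (hZ hE). Proof. by have h := tflat_sub pidR (@hi_inj _ _ _ hE); apply: (h T flE). Qed.
Let flB : tflat T (hB hE). Proof. by have h := tflat_sub pidR (@hj_inj _ _ _ hE); apply: (h T flZ). Qed.
Let hhj0 := @hhj _ _ _ hE.

Let torI (b : TT (hB hE) (gt gF')) : tor_rel (Q := Q) (hj hE) (hh hE) b 0 -> b = 0.
Proof.
apply: tor_rel_inj => //; [exact: hj_inj|exact: hh_surj|exact: hh_ker].
Qed.

Let torS (th : TorT (gt gE') (gt gF')) :
  exists2 b : TT (hB hE) (gt gF'), tmap (hj hE) 1 b = 0 & tor_rel (hj hE) (hh hE) b th.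
Proof. by apply: tor_rel_surj; [exact: hh_surj|exact: hh_ker]. Qed.

(** The connecting map as a relation: from a class to its boundary component in [hB (x) F'], and
    from there to Tor by the snake lemma. It becomes a function through [drel_total] and
    [drel_uniq]. *)
Definition drel (y : gt gX') (th : TorT (gt gE') (gt gF')) : Prop :=
  exists2 b, kun_rel s hF hX nab y b & tor_rel (hj hE) (hh hE) b th.

Lemma drel_lin a y th y' th' : drel y th -> drel y' th' -> drel (a *: y + y') (a *: th + th').
Proof.
move=> [b yb bt] [b' yb' bt']; exists (a *: b + b'); first exact: kun_rel_lin.
exact: tor_rel_lin.
Qed.

Lemma drel0 : drel 0 0.
Proof.
have := kun_rel_im s nab_h 0; rewrite linear0 => k0; exists 0 => //.
by exists 0, 0; rewrite !linear0 tor_class_0.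
Qed.

Lemma drel_fun th : drel 0 th -> th = 0.
Proof. by move=> [b /(kun_rel_0 pidR flE q1) -> /(tor_rel_0 hhj0 flZ)]. Qed.

Lemma drel_uniq y th th' : drel y th -> drel y th' -> th = th'.
Proof.
move=> h h'; apply/eqP; rewrite -subr_eq0; apply/eqP/drel_fun.
have := drel_lin (-1) h' h; rewrite !scaleN1r addNr addrC; exact.
Qed.

Lemma drel_ker y : drel y 0 -> exists t, y = nab' t.
Proof.
move=> [b yb bt]; apply: (kun_ker pidR flE nab_d nab_h).
suff b0 : b = 0 by rewrite b0 in yb; exact: yb.
exact: torI bt.
Qed.

Lemma drel_im t : drel (nab' t) 0.
Proof.
exists 0; first exact: (kun_rel_im s nab_h).
by exists 0, 0; rewrite !linear0 tor_class_0.
Qed.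

Lemma drel_surj th : exists y, drel y th.
Proof.
have [b jb bt] := torS th.
have [y yb] := kun_surj (s := s) nab_d jb.
by exists y, b.
Qed.

(** The map [hd] lowers the degree of the first factor by [dl]. The component of [hd (x) 1] in
    bidegree [(i, j)] therefore comes from that of [t] in [(i + dl, j)], which is zero unless
    [i + dl + j = k]. *)
Lemma drel_homog k y : exists th, drel (gin gX' k y) th /\
  forall i j, i + j != k - dl -> tor_map (ge gE' i) (ge gF' j) th = 0.
Proof.
have [z0 z0y] := hh_surj hX (gin gX' k y).
have [z zy [x zx]] : exists2 z, hh hX z = gin gX' k y & exists x, hi hX z = gin gX k x.
  exists (geZ grX k z0); first by rewrite ge_h z0y ge_in.
  by exists (gpr gX k (hi hX z0)); rewrite ge_i.
have [t [v [ht t0 zt]]] := q2 zx.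
have [c tc jc] := kun_total pidR flE t0.
have [th bt] := tor_rel_total Q (hh hE) jc.
exists th; split.
  by exists (tmap 1 (hh hF) c) => //; exists z, t, v, c; rewrite zy.
move=> i j ijk; apply: (tor_rel_0 hhj0 flZ).
have := tor_rel_nat (fB := geB grE i) (fZ := geZ grE i) (fM := ge gE' i) (ge gF' j)
  hhj0 (fun b => esym (ge_j grE i b)) (fun z => esym (ge_h grE i z)) bt.
suff -> : tmap (geB grE i) (ge gF' j) (tmap 1 (hh hF) c) = 0 by [].
have c0 : tmap (geB grE i) (geZ grF j) c = 0.
  apply: (flB (@hi_inj _ _ _ hF)); rewrite linear0.
  rewrite (tmap_sq (h := 1) (h' := geB grE i) (k := hi hF) (k' := ge gF j)) //; last first.
    by move=> n; rewrite ge_i.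
  rewrite -tc (tmap_sq (h := ge gE (i + dl)) (h' := hd hE) (k := ge gF j) (k' := 1)) //.
    rewrite ht ?linear0 //; apply: contraNneq ijk => <-.
    by rewrite addrAC addrK.
  by move=> m; rewrite (ge_d grE) addrK.
rewrite (tmap_sq (h := geB grE i) (h' := 1) (k := geZ grF j) (k' := hh hF)) //.
  by rewrite c0 linear0.
by move=> n; rewrite ge_h.
Qed.

Lemma drel_total y : exists th, drel y th.
Proof.
elim/g_ind: y => [|y y' [th h] [th' h']|k y]; first by exists 0; apply: drel0.
  by exists (1%R *: th + th'); have := drel_lin 1%R h h'; rewrite scale1r.
by have [th [h _]] := drel_homog y; exists th.
Qed.

Definition dtot y := projT1 (cid (drel_total y)).
Lemma dtotP y : drel y (dtot y). Proof. by rewrite /dtot; case: cid. Qed.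

Lemma dtot_linear : linear dtot.
Proof. by move=> a x y; apply: drel_uniq (dtotP _) _; apply: drel_lin; apply: dtotP. Qed.
Definition dtotl : {linear gt gX' -> TorT (gt gE') (gt gF')} := mklin dtot_linear.

Lemma dtot_homog k y i j : i + j != k - dl ->
  tor_map (ge gE' i) (ge gF' j) (dtot (gin gX' k y)) = 0.
Proof.
by move=> ijk; have [th [h /(_ _ _ ijk)]] := drel_homog y; rewrite (drel_uniq (dtotP _) h).
Qed.

Lemma geB_decomp (b : hB hE) : exists S : seq I, forall S', uniq S' -> {subset S <= S'} ->
  \sum_(i <- S') geB grE i b = b.
Proof.
have [S h] := g_decomp (hi hE (hj hE b)); exists S => S' uS sub.
apply: (@hj_inj _ _ _ hE); apply: (@hi_inj _ _ _ hE); rewrite -[RHS](h S') // !linear_sum.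
by apply: eq_bigr => i _; rewrite ge_j ge_i.
Qed.

Lemma tens_joint_inj (b : TT (hB hE) (gt gF')) :
  (forall i j, tmap (geB grE i) (ge gF' j) b = 0) -> b = 0.
Proof.
move=> b0; suff [S h] : exists S : seq I, forall S', uniq S' -> {subset S <= S'} ->
    \sum_(i <- S') \sum_(j <- S') tmap (geB grE i) (ge gF' j) b = b.
  rewrite -(h (undup S) (undup_uniq S)) => [|i]; last by rewrite mem_undup.
  by rewrite big1 // => i _; rewrite big1.
elim/(@ten_ind R T): b {b0} => [|x y [S hx] [S2 hy]|x y].
- by exists [::] => S' _ _; rewrite big1 // => i _; rewrite big1 // => j _; rewrite linear0.
- exists (S ++ S2) => S' uS sub.
  have subl : {subset S <= S'} by move=> i iS; apply: sub; rewrite mem_cat iS.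
  have subr : {subset S2 <= S'} by move=> i iS; apply: sub; rewrite mem_cat iS orbT.
  rewrite -[in RHS](hx S') // -[in RHS](hy S') // -big_split; apply: eq_bigr => i _.
  by rewrite -big_split; apply: eq_bigr => j _; rewrite linearD.
have [S1 h1] := geB_decomp x; have [S2 h2] := g_decomp y.
exists (S1 ++ S2) => S' uS sub.
have subl : {subset S1 <= S'} by move=> i iS; apply: sub; rewrite mem_cat iS.
have subr : {subset S2 <= S'} by move=> i iS; apply: sub; rewrite mem_cat iS orbT.
rewrite -[in RHS](h1 S') // -[in RHS](h2 S') //.
rewrite tm_suml; apply: eq_bigr => i _.
rewrite tm_sumr; apply: eq_bigr => j _.
by rewrite tm_mapE.
Qed.

(** Transport through [tor_rel], which is natural for the projectors: a tensor in [hB (x) F']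
    visibly is the sum of its finitely many bihomogeneous components, so it vanishes with them. *)
Lemma tor_joint_inj th :
  (forall i j, tor_map (ge gE' i) (ge gF' j) th = 0) -> th = 0.
Proof.
move=> th0; have [b jb bt] :=
  torS th.
suff b0 : b = 0 by rewrite b0 in bt; apply: (tor_rel_0 hhj0 flZ bt).
apply: tens_joint_inj => i j.
have := tor_rel_nat (fB := geB grE i) (fZ := geZ grE i) (fM := ge gE' i) (ge gF' j)
  hhj0 (fun b => esym (ge_j grE i b)) (fun z => esym (ge_h grE i z)) bt.
rewrite th0 => h.
exact: torI h.
Qed.

Section Component.
(** The complementary degrees are kept abstract, because the index expressions in [mpss_tensor] and
    [mpss_tor] have a shape of their own. *)
Variables (k : I) (jt jj : I -> I).
Hypothesis jtE : forall i, jt i = k - i.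
Hypothesis jjE : forall i, i + jj i = k - dl.
Variable gT : gsum (fun i => TT (E' i) (F' (jt i))).
Variable gTor : gsum (fun i => TorT (E' i) (F' (jj i))).
Variable nabc : {linear gt gT -> X' k}.

Definition theta : {linear gt gT -> TT (gt gE') (gt gF')} :=
  glift gT (fun i => tmap (gin gE' i) (gin gF' (jt i))).
Hypothesis nabcE : forall t, gin gX' k (nabc t) = nab' (theta t).

Lemma theta_in i t : theta (gin gT i t) = tmap (gin gE' i) (gin gF' (jt i)) t.
Proof. by rewrite /theta glift_in. Qed.

Lemma theta_pr i t : tmap (gpr gE' i) (gpr gF' (jt i)) (theta t) = gpr gT i t.
Proof.
elim/g_ind: t => [|x y e1 e2|i' t]; first by rewrite !linear0.
  by rewrite !linearD e1 e2.
rewrite theta_in; have [->|ii'] := eqVneq i i'.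
  rewrite gpr_in (tmap_comp (h := 1) (k := 1)) ?tmap_id // => x; exact: gpr_in.
rewrite gpr_in0 1?eq_sym // (tmap_comp (h := gpr gE' i \o gin gE' i') (k := gpr gF' (jt i) \o gin gF' (jt i'))) //.
by rewrite tmap_0l // => x; rewrite /= gpr_in0 // eq_sym.
Qed.

Lemma theta_inj : injective theta.
Proof. by move=> x y e; apply: g_ext => i; rewrite -!theta_pr e. Qed.

Lemma theta_homog t : homog (M := gE') (N := gF') k (theta t).
Proof.
move=> i j ijk; elim/g_ind: t => [|x y e1 e2|i' t]; first by rewrite !linear0.
  by rewrite !linearD e1 e2 addr0.
rewrite theta_in (tmap_comp (h := ge gE' i \o gin gE' i') (k := ge gF' j \o gin gF' (jt i'))) //.
have [e|ii'] := eqVneq i i'; last first.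
  by apply: tmap_0l => x; rewrite [LHS]ge_in0 // eq_sym.
apply: tmap_0r => x; rewrite [LHS]ge_in0 //; apply: contraNneq ijk => <-.
by rewrite jtE e addrC subrK.
Qed.

Lemma nabc_inj : injective nabc.
Proof.
move=> x y /(congr1 (gin gX' k)); rewrite !nabcE.
by move/(kun_inj pidR flE nab_h q1)/theta_inj.
Qed.

Lemma nabc_proj w : exists t, nabc t = gpr gX' k (nab' w).
Proof.
elim/ten_gind: w => [|x y [t tx] [u uy]|i j x y]; first by exists 0; rewrite !linear0.
  by exists (t + u); rewrite !linearD tx uy.
exists (gin gT i (tm x (gpr gF' (jt i) (gin gF' j y)))).
apply: (@gin_inj _ _ _ gX' k); rewrite nabcE theta_in tm_mapE -[gin gX' k _]/(ge gX' k _).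
rewrite -[gin gF' _ _]/(ge gF' _ _); have [ijk|ijk] := eqVneq (i + j) k.
  have -> : jt i = j by rewrite jtE -ijk addrC addKr.
  by rewrite ge_in -ijk nab'_gr.
rewrite ge_in0; last by apply: contraNneq ijk => ->; rewrite jtE addrC subrK.
by rewrite tm0r linear0 -nab'_gr [RHS]ge_in0.
Qed.

(* The degree [k] part of the connecting relation, with [Tor] split into its
   bihomogeneous components. *)
Definition delta_rel (y : X' k) (th : gt gTor) : Prop := exists th0, drel (gin gX' k y) th0 /\
  forall i, gpr gTor i th = tor_map (gpr gE' i) (gpr gF' (jj i)) th0.

Lemma delta_total y : exists th, delta_rel y th.
Proof.
pose th0 := dtot (gin gX' k y).
have [S hS] : exists S : seq I, forall i, i \notin S ->
    tor_map (gpr gE' i) (gpr gF' (jj i)) th0 = 0.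
  elim/(@tor_ind R T Q): th0 => u u0.
  have [S hS] := ten_fin (M := gE') (fun i => res1m Q (gpr gF' (jj i))) u.
  by exists S => i iS; rewrite tor_mapE // hS // tor_class_0.
have [th thE] := g_mk gTor hS.
by exists th, th0; split=> //; apply: dtotP.
Qed.

Lemma delta_rel_dtot y th : delta_rel y th ->
  forall i, gpr gTor i th = tor_map (gpr gE' i) (gpr gF' (jj i)) (dtot (gin gX' k y)).
Proof. by move=> [th0 [h e]] i; rewrite e (drel_uniq h (dtotP _)). Qed.

Lemma delta_uniq y th th' : delta_rel y th -> delta_rel y th' -> th = th'.
Proof. by move=> /delta_rel_dtot h /delta_rel_dtot h'; apply: g_ext => i; rewrite h h'. Qed.

Lemma delta_lin a y th y' th' : delta_rel y th -> delta_rel y' th' ->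
  delta_rel (a *: y + y') (a *: th + th').
Proof.
move=> [t [h e]] [t' [h' e']]; exists (a *: t + t'); split.
  by rewrite linearP; apply: drel_lin.
by move=> i; rewrite linearP e e' (tor_map_linear (gpr gE' i) (gpr gF' (jj i))).
Qed.

Lemma gpr_ge_tor i j th : tor_map (ge gE' i) (ge gF' j) th = 0 ->
  tor_map (gpr gE' i) (gpr gF' j) th = 0.
Proof.
move=> h; rewrite -(tor_map_comp (f := ge gE' i) (f' := gpr gE' i) (g := ge gF' j) (g' := gpr gF' j)).
- by rewrite h -[tor_map _ _ 0]/(tor_mapl (gpr gE' i) (gpr gF' j) 0) linear0.
- by move=> x; rewrite gpr_ge.
by move=> x; rewrite gpr_ge.
Qed.

(** The components of the connecting element outside total degree [k - dl] vanish by homogeneity and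
    those inside by hypothesis, so the whole element vanishes and [drel_ker] applies. *)
Lemma delta_ker y : delta_rel y 0 -> exists t, y = nabc t.
Proof.
move=> /delta_rel_dtot h; have d0 : dtot (gin gX' k y) = 0.
  apply: tor_joint_inj => i j; have [ijk|] := eqVneq (i + j) (k - dl); last exact: dtot_homog.
  have -> : j = jj i by apply: (@addrI _ i); rewrite jjE.
  rewrite -(tor_map_comp (f := gpr gE' i) (f' := gin gE' i) (g := gpr gF' (jj i))
    (g' := gin gF' (jj i))) // -h linear0.
  by rewrite -[tor_map _ _ 0]/(tor_mapl (gin gE' i) (gin gF' (jj i)) 0) linear0.
have [w wE] : exists w, gin gX' k y = nab' w by apply: drel_ker; rewrite -d0; apply: dtotP.
have [t tE] := nabc_proj w; exists t.
by rewrite tE -wE gpr_in.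
Qed.

Lemma delta_im t : delta_rel (nabc t) 0.
Proof.
exists 0; rewrite nabcE; split=> [|i]; first exact: drel_im.
by rewrite linear0 -[tor_map _ _ 0]/(tor_mapl (gpr gE' i) (gpr gF' (jj i)) 0) linear0.
Qed.

(** Assemble [th] in the Tor module of the total modules, take a preimage there, and keep its part
    of degree [k]. The other parts have no component in the bidegrees [(i, jj i)]. *)
Lemma delta_surj th : exists y, delta_rel y th.
Proof.
pose sg := glift gTor (fun i => tor_mapl (gin gE' i) (gin gF' (jj i))).
have sgE i u : tor_map (gpr gE' i) (gpr gF' (jj i)) (sg u) = gpr gTor i u.
  pose p := tor_mapl (gpr gE' i) (gpr gF' (jj i)); rewrite -[LHS]/(p _).
  elim/g_ind: u => [|x y e1 e2|i' x]; first by rewrite !linear0.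
    by rewrite !linearD e1 e2.
  rewrite /sg glift_in; have [e|ii'] := eqVneq i' i.
    subst i'; rewrite gpr_in /p.
    apply: etrans (tor_map_comp (h := 1) (k := 1) _ _ x) (tor_map_id _ _ _) => // z;
      exact: gpr_in.
  rewrite gpr_in0 //.
  apply: etrans (tor_map_comp (h := gpr gE' i \o gin gE' i')
    (k := gpr gF' (jj i) \o gin gF' (jj i')) _ _ x) (tor_map_0l _ _ _) => // z.
  by rewrite /= gpr_in0.
have [y ysg] := drel_surj (sg th).
exists (gpr gX' k y), (dtot (gin gX' k (gpr gX' k y))); split=> [|i]; first exact: dtotP.
rewrite -sgE (drel_uniq ysg (dtotP y)) -[gin gX' k _]/(ge gX' k y).
pose p := tor_mapl (gpr gE' i) (gpr gF' (jj i)).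
rewrite -[LHS]/(p (dtotl y)) -[RHS]/(p (dtotl (ge gX' k y))).
elim/g_ind: y {ysg} => [|x y e1 e2|k' x]; first by rewrite !linear0.
  by rewrite (linearD dtotl) (linearD p) e1 e2 (linearD (ge gX' k)) (linearD dtotl) (linearD p).
have [e|kk'] := eqVneq k' k; first by subst k'; rewrite ge_in.
rewrite ge_in0 // !linear0; apply: gpr_ge_tor; apply: dtot_homog.
by apply: contraNneq kk'; rewrite jjE => /addIr ->.
Qed.

Lemma nabc_surj : tflat T (gt gE') -> forall y, exists t, y = nabc t.
Proof.
move=> fl y; apply: delta_ker; exists 0; split.
  by rewrite -(tor_flat0 fl (dtot (gin gX' k y))); apply: dtotP.
by move=> i; rewrite linear0 -[tor_map _ _ 0]/(tor_mapl (gpr gE' i) (gpr gF' (jj i)) 0) linear0.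
Qed.

Lemma nab'_homog_surj : tflat T (gt gE') -> forall y, exists2 t, homog (M := gE') (N := gF') k t &
  gin gX' k y = nab' t.
Proof.
move=> fl y; have [t ->] := nabc_surj fl y; exists (theta t); first exact: theta_homog.
exact: nabcE.
Qed.

End Component.

Lemma nab'_inj : injective nab'.
Proof. by have h := kun_inj pidR flE nab_h q1; apply: h. Qed.

End GradedKunneth.

(** * Direct sums and homology presentations *)

Section DirectSumTheory.
Variables (R : comNzRingType) (I : choiceType) (F : I -> lmodType R).
Implicit Types x y : dsum F.
Local Open Scope classical_set_scope.

Lemma dsum_ev_linear i : linear (fun x : dsum F => x i). Proof. by []. Qed.

Lemma dsum_inP i (v : F i) : `[< finite_set [set j | dfwith (fun j => 0 : F j) v j != 0] >].
Proof.
apply/asboolP/(sub_finite_set _ (finite_set1 i)) => j /=.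
by have [//|ij] := eqVneq j i; rewrite dfwith_out ?eqxx // eq_sym.
Qed.
Definition dsum_in i (v : F i) : dsum F := Dsum (dsum_inP v).

Lemma dsum_inE i (v : F i) : dsum_in v i = v.
Proof. exact: dfwith_in. Qed.

Lemma dsum_inN i j (v : F i) : i != j -> dsum_in v j = 0.
Proof. by move=> ij; rewrite /= dfwith_out. Qed.

Lemma dsum_in_linear i : linear (@dsum_in i).
Proof.
move=> a v w; apply: dsumP => j; have [e|ij] := eqVneq i j.
  by subst j; rewrite /= !dfwith_in.
by rewrite /= !dfwith_out // scaler0 addr0.
Qed.

Lemma dsum_support x : exists2 S : seq I, uniq S & forall i, i \notin S -> x i = 0.
Proof.
have /finite_seqP[S SE] := dsum_fin x; exists (undup S); first exact: undup_uniq.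
move=> i; rewrite mem_undup => iS; apply/eqP; apply: contraNT iS => xi.
by have : [set` S] i by rewrite -SE.
Qed.

Lemma dsum_liftEw (P : lmodType R) (f : forall i, {linear F i -> P}) x S :
  uniq S -> (forall i, i \notin S -> x i = 0) ->
  dsum_lift f x = \sum_(i <- S) f i (x i).
Proof.
move=> uS xS; rewrite /dsum_lift [RHS]fsbig_seq //; apply/esym.
apply: fsbig_widen => // i [_ /= iS].
by rewrite xS ?linear0 //; apply/negP.
Qed.

Lemma dsum_lift_linear (P : lmodType R) (f : forall i, {linear F i -> P}) :
  linear (dsum_lift f).
Proof.
move=> a x y; have [S uS xS] := dsum_support x; have [S' uS' yS'] := dsum_support y.
pose U := undup (S ++ S'); have uU : uniq U by apply: undup_uniq.
have xU i : i \notin U -> x i = 0 by rewrite mem_undup mem_cat negb_or => /andP[/xS].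
have yU i : i \notin U -> y i = 0 by rewrite mem_undup mem_cat negb_or => /andP[_ /yS'].
rewrite !(dsum_liftEw f uU) //; last by move=> i iU; rewrite /= xU ?yU ?scaler0 ?addr0.
rewrite scaler_sumr -big_split; apply: eq_bigr => i _; exact: linearP.
Qed.

Lemma dsum_lift_in (P : lmodType R) (f : forall i, {linear F i -> P}) i v :
  dsum_lift f (dsum_in v) = f i v.
Proof.
rewrite (@dsum_liftEw _ f _ [:: i]) ?big_seq1 ?dsum_inE // => j.
by rewrite inE eq_sym => ij; rewrite dsum_inN.
Qed.

Lemma dsum_ind (P : dsum F -> Prop) : P 0 -> (forall x y, P x -> P y -> P (x + y)) ->
  (forall i v, P (@dsum_in i v)) -> forall x, P x.
Proof.
move=> P0 PD Pi x; have [S uS xS] := dsum_support x.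
have -> : x = \sum_(i <- S) dsum_in (x i).
  apply: dsumP => i; rewrite -[RHS]/(mklin (dsum_ev_linear i) _) linear_sum /=.
  have [iS|iS] := boolP (i \in S).
    rewrite (bigD1_seq i) //= big1 ?addr0 => [|j ji]; first by rewrite dfwith_in.
    by rewrite dfwith_out.
  rewrite xS // big_seq big1 // => j jS; rewrite dfwith_out //.
  by apply: contraNneq iS => <-.
by elim/big_rec: _ => // i y _; apply: PD.
Qed.

Definition std_gsum : gsum F :=
  @GSum R I F (dsum F) (fun i => mklin (@dsum_in_linear i))
    (fun i => mklin (@dsum_ev_linear i))
    (fun P f => mklin (@dsum_lift_linear P f)) dsum_inE dsum_inN
    (fun x y => @dsumP R I F x y) dsum_ind dsum_lift_in.

End DirectSumTheory.

Lemma dsum_mapE (R : comNzRingType) (I : choiceType) (M N : I -> lmodType R)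
    (phi : forall i, {linear M i -> N i}) (x : dsum M) i :
  dsum_map phi x i = phi i (x i).
Proof.
rewrite /dsum_map -[LHS]/(val _ i) val_insubd ifT //.
apply/asboolP/(sub_finite_set _ (dsum_fin x)) => j /=.
by apply: contraNN => /eqP ->; rewrite linear0.
Qed.

Section GradedBilinear.
Variables (R : comNzRingType) (T : tensor_theory R) (I J : choiceType).
Variables (E : I -> lmodType R) (F : J -> lmodType R) (gE : gsum E) (gF : gsum F).
Variables (P : lmodType R) (b : forall i j, E i -> F j -> P).
Hypotheses (bl : forall i j y, linear (fun x => b (i := i) (j := j) x y))
  (br : forall i j x, linear (b (i := i) (j := j) x)).

Let rowl i (x : E i) : {linear gt gF -> P} := glift gF (fun j => mklin (@br i j x)).

Lemma gbilin_row_linear i y : linear (fun x : E i => rowl x y).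
Proof.
move=> a x x'; elim/g_ind: y => [|y y' e e'|j y].
- by rewrite /= !(linear0 (rowl _)) scaler0 addr0.
- by move: e e'; rewrite /= !(linearD (rowl _)) => -> ->; rewrite scalerDr addrACA.
by rewrite /= /rowl !glift_in; apply: bl.
Qed.

Let matl y : {linear gt gE -> P} := glift gE (fun i => mklin (@gbilin_row_linear i y)).
Let mat (x : gt gE) (y : gt gF) : P := matl y x.

Let mat_in i j x y : mat (gin gE i x) (gin gF j y) = b x y.
Proof. by rewrite /mat /matl glift_in [LHS]glift_in. Qed.

Let mat_l y : linear (mat^~ y). Proof. by move=> a x x'; apply: linearP. Qed.

Let mat_r x : linear (mat x).
Proof.
move=> a y y'; elim/g_ind: x => [|x x' e e'|i x].
- by rewrite /mat !(linear0 (matl _)) scaler0 addr0.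
- by rewrite /mat !(linearD (matl _)) -!/(mat _ _) e e' scalerDr addrACA.
by rewrite /mat /matl !glift_in; apply: (linearP (rowl x)).
Qed.

Definition gbilin : {linear ten T (gt gE) (gt gF) -> P} := tlift_of T mat_l mat_r.

Lemma gbilinE i j x y : gbilin (tm_of T (gin gE i x) (gin gF j y)) = b x y.
Proof. by rewrite /gbilin tm_liftE mat_in. Qed.

End GradedBilinear.

Lemma g_extl (R : comNzRingType) (I : choiceType) (E : I -> lmodType R) (gE : gsum E)
    (P : lmodType R) (f g : {linear gt gE -> P}) :
  (forall i x, f (gin gE i x) = g (gin gE i x)) -> forall x, f x = g x.
Proof.
move=> fg; apply: g_ind => [|x y e e'|//]; first by rewrite !linear0.
by rewrite !linearD e e'.
Qed.

Definition restr (R : comNzRingType) (U V : lmodType R) (f : {linear U -> V})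
    (S : submodClosed U) (S' : submodClosed V) (fS : forall x, x \in S -> f x \in S') :
    {linear submodule S -> submodule S'} :=
  @corestrict R (submodule S) V (f \o smv S) S' (fun x => fS _ (sm_valP x)).

(* The homology presentation of a graded differential module from the
   presentations [E i <- A i -> E' i] of its homology in each degree. *)
Section BuildHomology.
Variables (R : comNzRingType) (I : zmodType) (dl : I) (E E' A : I -> lmodType R).
Variables (gE : gsum E) (gE' : gsum E') (gA : gsum A).
Variables (a : forall i, {linear A i -> E i}) (a' : forall i, {linear A i -> E' i}).
Variable d : {linear gt gE -> gt gE}.

Record presents_homology : Prop := PresentsHomology {
  ph_d : forall i m, d (ge gE i m) = ge gE (i - dl) (d m);
  ph_dd : forall x, d (d x) = 0;
  ph_da : forall i u, d (gin gE i (a i u)) = 0;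
  ph_ker : forall i x, d (gin gE i x) = 0 -> exists u, x = a i u;
  ph_surj : forall i x, exists u, a' i u = x;
  ph_im : forall i u, a' i u = 0 <-> exists x, gin gE i (a i u) = d x
}.
Hypothesis PH : presents_homology.

Definition tota : {linear gt gA -> gt gE} := glift gA (fun i => gin gE i \o a i).
Definition tota' : {linear gt gA -> gt gE'} := glift gA (fun i => gin gE' i \o a' i).

Lemma tota_in i u : tota (gin gA i u) = gin gE i (a i u). Proof. exact: glift_in. Qed.
Lemma tota'_in i u : tota' (gin gA i u) = gin gE' i (a' i u). Proof. exact: glift_in. Qed.

Lemma tota_ge i u : ge gE i (tota u) = tota (ge gA i u).
Proof.
elim/g_ind: u => [|x y e e'|j u]; [by rewrite !linear0|by rewrite !linearD e e'|].
rewrite tota_in; have [e|ji] := eqVneq j i; last by rewrite !ge_in0 // linear0.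
by subst j; rewrite !ge_in tota_in.
Qed.

Lemma tota'_ge i u : ge gE' i (tota' u) = tota' (ge gA i u).
Proof.
elim/g_ind: u => [|x y e e'|j u]; [by rewrite !linear0|by rewrite !linearD e e'|].
rewrite tota'_in; have [e|ji] := eqVneq j i; last by rewrite !ge_in0 // linear0.
by subst j; rewrite !ge_in tota'_in.
Qed.

Lemma d_tota u : d (tota u) = 0.
Proof.
elim/g_ind: u => [|x y e e'|i u]; [by rewrite !linear0|by rewrite !linearD e e' addr0|].
by rewrite tota_in (ph_da PH).
Qed.

Lemma tota_ker x : d x = 0 -> exists u, x = tota u.
Proof.
move=> x0; have ex i : exists u, gpr gE i x = a i u.
  by apply: (ph_ker PH); rewrite -[gin _ _ _]/(ge gE i x) (ph_d PH) x0 linear0.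
have [S xS] := g_fin x.
pose c i : A i := if i \in S then projT1 (cid (ex i)) else 0.
have cE i : a i (c i) = gpr gE i x.
  by rewrite /c; case: ifPn => [_|/xS ->]; [case: cid|rewrite linear0].
have [u uc] : exists u, forall i, gpr gA i u = c i.
  by apply: (@g_mk _ _ _ gA c S) => i iS; rewrite /c (negPf iS).
exists u; apply: g_ext => i; rewrite -(gpr_ge (M := gE) i (tota u)) tota_ge.
by rewrite -[ge gA i u]/(gin gA i _) uc tota_in gpr_in cE.
Qed.

Lemma tota'_surj x : exists u, tota' u = x.
Proof.
elim/g_ind: x => [|_ _ [u <-] [v <-]|i x]; first by exists 0; rewrite linear0.
  by exists (u + v); rewrite linearD.
by have [u <-] := ph_surj PH x; exists (gin gA i u); rewrite tota'_in.
Qed.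

Lemma tota'_im u : tota' u = 0 <-> exists x, tota u = d x.
Proof.
split=> [u0|[x ux]].
  have ex i : exists x, tota (ge gA i u) = d x.
    rewrite [ge gA i u]/(gin gA i _) tota_in; apply/(ph_im PH).
    by apply: (@gin_inj _ _ _ gE'); rewrite -tota'_in -[gin gA _ _]/(ge gA i u) -tota'_ge u0 !linear0.
  have [S h] := g_decomp u; rewrite -(h (undup S)) ?undup_uniq // => [|i]; last first.
    by rewrite mem_undup.
  rewrite linear_sum; elim/big_rec: _ => [|i x _ [y ->]]; first by exists 0; rewrite linear0.
  by have [z ->] := ex i; exists (z + y); rewrite linearD.
apply: g_ext => i; rewrite linear0 -(gpr_ge (M := gE') i (tota' u)) tota'_ge.
rewrite -[ge gA i u]/(gin gA i _) tota'_in gpr_in; apply/(ph_im PH).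
(* The component of [d x] in degree [i] is the differential of the component of [x] in degree
   [i + dl]. *)
exists (ge gE (i + dl) x); rewrite (ph_d PH) addrK -ux tota_ge.
by rewrite -tota_in.
Qed.

Lemma mem_ker_d x : d x = 0 -> x \in kerp d. Proof. by rewrite mem_kerp => ->. Qed.
Lemma ker_d (z : submodule (kerp d)) : d (sm_val z) = 0.
Proof. by apply/eqP; rewrite -mem_kerp sm_valP. Qed.
Lemma mem_im_d x : d x \in imp d. Proof. by apply/mem_imp; exists x. Qed.
Lemma im_d (z : submodule (imp d)) : exists x, sm_val z = d x.
Proof. by apply/mem_imp/sm_valP. Qed.
Lemma im_ker_d x : x \in imp d -> x \in kerp d.
Proof. by move=> /mem_imp[y ->]; rewrite mem_kerp (ph_dd PH). Qed.

Definition hclass (z : submodule (kerp d)) : gt gE' :=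
  tota' (projT1 (cid (tota_ker (ker_d z)))).

Lemma hclassE z u : sm_val z = tota u -> hclass z = tota' u.
Proof.
rewrite /hclass; case: cid => v /= -> vu; apply/eqP; rewrite -subr_eq0 -linearB; apply/eqP.
by apply/tota'_im; exists 0; rewrite linearB vu subrr linear0.
Qed.

Lemma hclass_linear : linear hclass.
Proof.
move=> c z z'; have [u zu] := tota_ker (ker_d z); have [u' zu'] := tota_ker (ker_d z').
rewrite (hclassE zu) (hclassE zu') -linearP; apply: hclassE.
by rewrite !linearP /= zu zu'.
Qed.

Lemma hd_surj_im (b : submodule (imp d)) : exists m, corestrict mem_im_d m = b.
Proof. by have [x bx] := im_d b; exists x; apply: sm_val_inj; rewrite bx. Qed.

Lemma hd_ker_im m : corestrict mem_im_d m = 0 -> exists z, m = smv (kerp d) z.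
Proof.
by move/(congr1 (@sm_val _ _ _)); rewrite linear0 => /= /mem_ker_d mk; exists (Submodule mk).
Qed.

Lemma hclass_surj x : exists z, hclass z = x.
Proof.
have [u <-] := tota'_surj x; exists (Submodule (mem_ker_d (d_tota u))).
exact: hclassE.
Qed.

Lemma hclass_im b : hclass (restr (f := idl _) im_ker_d b) = 0.
Proof.
have [x bx] := im_d b; have [u zu] := tota_ker (ker_d (restr (f := idl _) im_ker_d b)).
by rewrite (hclassE zu); apply/tota'_im; exists x; rewrite -zu /= bx.
Qed.

Lemma hclass_ker z : hclass z = 0 -> exists b, z = restr (f := idl _) im_ker_d b.
Proof.
have [u zu] := tota_ker (ker_d z); rewrite (hclassE zu) => /tota'_im[x xE].
by exists (corestrict mem_im_d x); apply: sm_val_inj; rewrite zu xE.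
Qed.

Lemma restr_inj : injective (restr (f := idl _) im_ker_d).
Proof. by move=> b b' /(congr1 (@sm_val _ _ _)) /= /sm_val_inj. Qed.

Lemma corestrict0 z : corestrict mem_im_d (smv (kerp d) z) = 0.
Proof. by apply: sm_val_inj; rewrite /= ker_d. Qed.

Definition bhd : hdata (gt gE) (gt gE') :=
  @HData R (gt gE) (gt gE') (submodule (kerp d)) (submodule (imp d)) (smv (kerp d))
    (restr (f := idl _) im_ker_d) (corestrict mem_im_d) (mklin hclass_linear)
    (@sm_val_inj _ _ _) restr_inj hd_surj_im corestrict0 hd_ker_im hclass_surj hclass_im
    hclass_ker.

Lemma bhhE (z : hZ bhd) u : hi bhd z = tota u -> hh bhd z = tota' u.
Proof. exact: hclassE. Qed.

Lemma bhi_tota u : exists2 z : hZ bhd, hi bhd z = tota u & hh bhd z = tota' u.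
Proof. by exists (Submodule (mem_ker_d (d_tota u))) => //; apply: hclassE. Qed.

Lemma bhi_ex (z : hZ bhd) : exists2 u, hi bhd z = tota u & hh bhd z = tota' u.
Proof. by have [u zu] := tota_ker (ker_d z); exists u => //; apply: hclassE. Qed.

Lemma bhi_d (z : hZ bhd) : d (hi bhd z) = 0. Proof. exact: ker_d. Qed.

Lemma bge_ker i x : x \in kerp d -> ge gE i x \in kerp d.
Proof. by rewrite !mem_kerp (ph_d PH) => /eqP ->; rewrite linear0. Qed.

Lemma bge_im i x : x \in imp d -> ge gE i x \in imp d.
Proof.
move=> /mem_imp[y ->]; apply/mem_imp; exists (ge gE (i + dl) y).
by rewrite (ph_d PH) addrK.
Qed.

Lemma bgr_j i b : hj bhd (restr (@bge_im i) b) = restr (@bge_ker i) (hj bhd b).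
Proof. exact: sm_val_inj. Qed.

Lemma bgr_d i m : hd bhd (ge gE i m) = restr (@bge_im (i - dl)) (hd bhd m).
Proof. by apply: sm_val_inj; rewrite /= (ph_d PH). Qed.

Lemma bgr_h i z : hh bhd (restr (@bge_ker i) z) = ge gE' i (hh bhd z).
Proof.
have [u zu ->] := bhi_ex z; rewrite tota'_ge; apply: bhhE.
rewrite -tota_ge -zu //.
Qed.

Definition bgr : hgraded dl bhd :=
  @HGraded R I dl E E' gE gE' bhd (fun i => restr (@bge_ker i)) (fun i => restr (@bge_im i))
    (fun i z => erefl) bgr_j bgr_d bgr_h.

Section Sign.
Variable sg : I -> R.
Hypotheses (sg2 : forall i, sg i * sg i = 1) (sgd : forall i, sg (i - dl) = - sg i).

Lemma bsign_in_linear i : linear (fun x : E i => sg i *: gin gE i x).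
Proof. by move=> c x y; rewrite linearP scalerDr !scalerA mulrC. Qed.
Definition bsg : {linear gt gE -> gt gE} := glift gE (fun i => mklin (@bsign_in_linear i)).
Lemma bsg_in i x : bsg (gin gE i x) = sg i *: gin gE i x. Proof. exact: glift_in. Qed.

Lemma bsgK x : bsg (bsg x) = x.
Proof.
elim/g_ind: x => [|x y e e'|i x]; [by rewrite !linear0|by rewrite !linearD e e'|].
by rewrite bsg_in linearZZ bsg_in scalerA sg2 scale1r.
Qed.

Lemma d_bsg x : d (bsg x) = - bsg (d x).
Proof.
elim/g_ind: x => [|x y e e'|i x].
- by rewrite !linear0.
- by rewrite (linearD bsg) (linearD d) e e' (linearD d) (linearD bsg) opprD.
rewrite bsg_in linearZZ -[X in d X](ge_in gE x) (ph_d PH) -[ge gE (i - dl) _]/(gin gE _ _).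
by rewrite bsg_in sgd scaleNr opprK.
Qed.

Lemma bsg_ker x : x \in kerp d -> bsg x \in kerp d.
Proof. by rewrite !mem_kerp d_bsg => /eqP ->; rewrite linear0 oppr0. Qed.

Lemma bsg_im x : x \in imp d -> bsg x \in imp d.
Proof.
move=> /mem_imp[y ->]; apply/mem_imp; exists (- bsg y).
by rewrite linearN d_bsg opprK.
Qed.

Lemma bsg_d m : hd bhd (bsg m) = - restr bsg_im (hd bhd m).
Proof. by apply: sm_val_inj; rewrite linearN /= d_bsg. Qed.

Lemma bsg_j b : restr bsg_ker (hj bhd b) = hj bhd (restr bsg_im b).
Proof. exact: sm_val_inj. Qed.
Lemma bsg_BK b : restr bsg_im (restr bsg_im b) = b.
Proof. by apply: sm_val_inj; rewrite /= bsgK. Qed.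
Lemma bsg_ZK b : restr bsg_ker (restr bsg_ker b) = b.
Proof. by apply: sm_val_inj; rewrite /= bsgK. Qed.

Definition bsign : hsign bhd :=
  @HSign R (gt gE) (gt gE') bhd bsg (restr bsg_ker) (restr bsg_im) (fun z => erefl)
    bsg_j bsg_d bsg_BK bsg_ZK.
End Sign.
End BuildHomology.

Section BuildMorphism.
Variables (R : comNzRingType) (I : zmodType) (dl : I) (E E' A : I -> lmodType R).
Variables (gE : gsum E) (gE' : gsum E') (gA : gsum A).
Variables (a : forall i, {linear A i -> E i}) (a' : forall i, {linear A i -> E' i}).
Variable (d : {linear gt gE -> gt gE}) (PH : presents_homology dl a a' d).
Variables (F F' B : I -> lmodType R) (gF : gsum F) (gF' : gsum F') (gB : gsum B).
Variables (b : forall i, {linear B i -> F i}) (b' : forall i, {linear B i -> F' i}).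
Variable (e : {linear gt gF -> gt gF}) (PH1 : presents_homology dl b b' e).
Variables (f : forall i, {linear E i -> F i}) (f' : forall i, {linear E' i -> F' i}).

Definition gmap (G H : I -> lmodType R) (gG : gsum G) (gH : gsum H)
  (h : forall i, {linear G i -> H i}) : {linear gt gG -> gt gH} :=
  glift gG (fun i => gin gH i \o h i).

Lemma gmap_in G H (gG : gsum G) (gH : gsum H) h i x :
  gmap gG gH h (gin gG i x) = gin gH i (h i x).
Proof. exact: glift_in. Qed.

Lemma gpr_gmap G H (gG : gsum G) (gH : gsum H) h i x :
  gpr gH i (gmap gG gH h x) = h i (gpr gG i x).
Proof.
elim/g_ind: x => [|x y e1 e2|j x]; [by rewrite !linear0|by rewrite !linearD e1 e2|].
rewrite gmap_in; have [E0|ji] := eqVneq j i; last by rewrite !gpr_in0 // linear0.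
by subst j; rewrite !gpr_in.
Qed.

Hypothesis fd : forall x, e (gmap gE gF f x) = gmap gE gF f (d x).
Hypothesis fa : forall i u, exists v, f i (a i u) = b i v /\ f' i (a' i u) = b' i v.

Lemma gmap_ker x : x \in kerp d -> gmap gE gF f x \in kerp e.
Proof. by rewrite !mem_kerp fd => /eqP ->; rewrite linear0. Qed.

Lemma gmap_im x : x \in imp d -> gmap gE gF f x \in imp e.
Proof. by move=> /mem_imp[y ->]; apply/mem_imp; exists (gmap gE gF f y); rewrite fd. Qed.

Lemma gmap_tota (u : gt gA) : exists v : gt gB,
  gmap gE gF f (tota gE gA a u) = tota gF gB b v /\
  gmap gE' gF' f' (tota' gE' gA a' u) = tota' gF' gB b' v.
Proof.
elim/g_ind: u => [|x y [v [e1 e2]] [w [e3 e4]]|i u].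
- by exists 0; rewrite !linear0.
- by exists (v + w); rewrite !linearD e1 e2 e3 e4.
have [v [e1 e2]] := fa u; exists (gin gB i v).
by rewrite (tota_in gE gA a) (tota'_in gE' gA a') (gmap_in gE gF f) (gmap_in gE' gF' f') e1 e2
  (tota_in gF gB b) (tota'_in gF' gB b').
Qed.

Local Notation X := (bhd gE' gA PH).
Local Notation X1 := (bhd gF' gB PH1).

Lemma gmap_j z : restr gmap_ker (hj X z) = hj X1 (restr gmap_im z).
Proof. exact: sm_val_inj. Qed.
Lemma gmap_d m : hd X1 (gmap gE gF f m) = restr gmap_im (hd X m).
Proof. by apply: sm_val_inj; rewrite /= fd. Qed.
Lemma gmap_h z : gmap gE' gF' f' (hh X z) = hh X1 (restr gmap_ker z).
Proof.
have [u zu ->] := bhi_ex z; have [v [e1 e2]] := gmap_tota u; rewrite e2; apply/esym.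
by apply: bhhE; rewrite -e1 -zu.
Qed.

Definition bmor : hmor X X1 :=
  @HMor R (gt gE) (gt gE') (gt gF) (gt gF') X X1 (gmap gE gF f) (restr gmap_ker)
    (restr gmap_im) (gmap gE' gF' f') (fun z => erefl) gmap_j gmap_d gmap_h.
End BuildMorphism.

(** * Pages *)

(* Equations between chains in the context make [lia] diverge. *)
Ltac ilia := clear; lia.

Local Notation II := (int * int)%type.

Section Cycles.
Variables (R : comNzRingType) (G : digraph).
Local Notation cbd := (cbd R G).
Local Notation FRC := (@FRC R G).
Local Notation Zcyc := (@Zcyc R G).
Local Notation Bcyc := (@Bcyc R G).

Lemma FRC_le (l l' k k' : int) c : c \in FRC l k -> l <= l' -> k = k' -> c \in FRC l' k'.
Proof. by move=> cF ll <-; apply: FRC_mono cF. Qed.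

Lemma ZcycP (r p q : int) c :
  c \in Zcyc r p q <-> c \in FRC p (p + q) /\ cbd c \in FRC (p - r) (p + q - 1).
Proof. by rewrite cbd_bd; split=> [/andP|[h1 h2]] //; apply/andP. Qed.

Lemma BcycP (r p q : int) c : c \in Bcyc r p q <-> exists y z,
  [/\ y \in Zcyc (r - 1) (p - 1) (q + 1), z \in Zcyc (r - 1) (p + r - 1) (q - r + 2)
    & c = y + cbd z].
Proof.
split=> [/asboolP[y [z [h1 h2 h3]]]|[y [z [h1 h2 h3]]]]; [|apply/asboolP];
  by exists y, z; rewrite (cbd_bd, =^~ cbd_bd).
Qed.

Lemma Zcyc_nd (r p q : int) c : c \in Zcyc r p q -> c \in @nd R G.
Proof. by move=> /ZcycP[/FRC_nd]. Qed.

Lemma cbd_cbd (r p q : int) c : c \in Zcyc r p q -> cbd (cbd c) = 0.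
Proof. by move=> /Zcyc_nd; apply: cbdK. Qed.

Lemma Zcyc_bd0 (r p q : int) c : c \in FRC p (p + q) -> cbd c = 0 -> c \in Zcyc r p q.
Proof. by move=> cF c0; apply/ZcycP; rewrite c0 rpred0. Qed.

Lemma Zcyc_cbd (r r' p q : int) c : c \in Zcyc r p q -> cbd c \in Zcyc r' (p - r) (q + r - 1).
Proof.
move=> cZ; apply: Zcyc_bd0; last exact: cbd_cbd cZ.
move/ZcycP: cZ => [_ h]; apply: (FRC_le h) => //; ilia.
Qed.

Lemma Zcyc_mono (r p q : int) c : c \in Zcyc (r + 1) p q -> c \in Zcyc r p q.
Proof. by move=> /ZcycP[h1 h2]; apply/ZcycP; split=> //; apply: (FRC_le h2) => //; ilia. Qed.

Lemma Zcyc_Bcyc (r p q : int) c : c \in Zcyc (r - 1) (p - 1) (q + 1) -> c \in Bcyc r p q.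
Proof.
by move=> cZ; apply/BcycP; exists c, 0; rewrite rpred0 linear0 addr0.
Qed.

Lemma cbd_Bcyc (r p q : int) c : c \in Zcyc (r - 1) (p + r - 1) (q - r + 2) ->
  cbd c \in Bcyc r p q.
Proof. by move=> cZ; apply/BcycP; exists 0, c; rewrite rpred0 add0r. Qed.

Lemma Bcyc_cbd (r p q : int) c : c \in Bcyc r p q -> cbd c \in Bcyc r (p - r) (q + r - 1).
Proof.
move=> /BcycP[y [z [yZ zZ ->]]]; rewrite linearD (cbd_cbd zZ) addr0; apply: cbd_Bcyc.
have -> : p - r + r - 1 = p - 1 by ilia.
by have -> : q + r - 1 - r + 2 = q + 1 by ilia.
Qed.

(* Cycles of the page [r] are the classes of [Z^(r+1)]. *)
Lemma Zcyc_lift (r p q : int) c : c \in Zcyc r p q ->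
  cbd c \in Bcyc r (p - r) (q + r - 1) ->
  exists2 c', c' \in Zcyc (r + 1) p q & c - c' \in Bcyc r p q.
Proof.
move=> cZ /BcycP[y [z [yZ zZ cE]]].
have zZ' : z \in Zcyc (r - 1) (p - 1) (q + 1).
  have <- : p - r + r - 1 = p - 1 by ilia.
  by have <- : q + r - 1 - r + 2 = q + 1 by ilia.
(* The chain [z] has lower filtration and is zero on the page; subtracting it leaves the boundary
   [y], which lies one filtration step deeper. *)
exists (c - z); last by rewrite opprB addrC subrK; apply: Zcyc_Bcyc.
move/ZcycP: cZ => [cF _]; move/ZcycP: zZ' => [zF _]; move/ZcycP: yZ => [yF _].
apply/ZcycP; split.
  by apply: smB => //; apply: (FRC_le zF); ilia.
by rewrite linearB cE addrK; apply: (FRC_le yF); ilia.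
Qed.

Lemma Zcyc_cbd_B (r p q : int) c : c \in Zcyc (r + 1) p q ->
  cbd c \in Bcyc r (p - r) (q + r - 1).
Proof.
move=> cZ; apply: Zcyc_Bcyc; have := Zcyc_cbd (r - 1) cZ.
have -> : p - (r + 1) = p - r - 1 by ilia.
by have -> : q + (r + 1) - 1 = q + r - 1 + 1 by ilia.
Qed.

(* Boundaries of the page [r] are the classes of [B^(r+1)]. *)
Lemma Bcyc_next (r p q : int) c : c \in Zcyc (r + 1) p q ->
  c \in Bcyc (r + 1) p q <->
  exists2 x, x \in Zcyc r (p + r) (q - r + 1) & c - cbd x \in Bcyc r p q.
Proof.
move=> cZ; split=> [/BcycP[y [z [yZ zZ cE]]]|[x xZ /BcycP[y [z [yZ zZ cE]]]]].
  exists z.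
    move: zZ; rewrite addrK; have -> : p + (r + 1) - 1 = p + r by ilia.
    by have -> : q - (r + 1) + 2 = q - r + 1 by ilia.
  rewrite cE addrK; apply: Zcyc_Bcyc; apply: Zcyc_mono.
  by move: yZ; rewrite addrK subrK.
have cE' : c = y + cbd (x + z) by rewrite linearD addrCA -cE addrC subrK.
have [cF cF'] := (iffLR (ZcycP _ _ _ _)) cZ.
have [xF xF'] := (iffLR (ZcycP _ _ _ _)) xZ.
have [yF yF'] := (iffLR (ZcycP _ _ _ _)) yZ.
have [zF zF'] := (iffLR (ZcycP _ _ _ _)) zZ.
apply/BcycP; exists y, (x + z); split=> //; apply/ZcycP; split.
- by [].
(* The chains [y] and [c] differ by a boundary, so [y] inherits the bound on [cbd c]. *)
- have -> : cbd y = cbd c.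
    by rewrite cE' linearD (@cbdK R G) ?addr0 // rpredD ?(Zcyc_nd xZ) ?(Zcyc_nd zZ).
  by apply: (FRC_le cF'); ilia.
- by apply: rpredD; [apply: (FRC_le xF)|apply: (FRC_le zF)]; ilia.
have -> : cbd (x + z) = c - y by rewrite cE' [y + _]addrC addrK.
by apply: smB; [apply: (FRC_le cF)|apply: (FRC_le yF)]; ilia.
Qed.
End Cycles.

Section Pages.
Variables (R : comNzRingType) (G : digraph) (gS : forall F : II -> lmodType R, gsum F).
Local Notation cbd := (cbd R G).
Local Notation FRC := (@FRC R G).
Local Notation Z r i := (@Zcyc R G r i.1 i.2).
Local Notation B r i := (@Bcyc R G r i.1 i.2).

Definition page (r : nat) (i : II) : lmodType R := mpss R G r i.1 i.2.
Definition pcls r i (c : chain R G) : page r i := sq_class (Z r%:Z i) (B r%:Z i) c.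
(** The negative of the bidegree [(-r, r-1)] of d^r, in line with the convention that [dl] is
    subtracted. *)
Definition dldeg (r : nat) : II := (r%:Z, 1 - r%:Z).
Local Notation dl := dldeg.
Definition tpage r := gS (page r).
Definition gcl r i c : gt (tpage r) := gin (tpage r) i (pcls r i c).

Lemma gcl_eq r i j c : i = j -> gcl r i c = gcl r j c. Proof. by move=> ->. Qed.

Lemma pcls_lin r i a c c' : c \in Z r%:Z i -> c' \in Z r%:Z i ->
  pcls r i (a *: c + c') = a *: pcls r i c + pcls r i c'.
Proof. exact: sq_class_lin. Qed.

Lemma pcls_eq r i c c' : c \in Z r%:Z i -> c' \in Z r%:Z i ->
  pcls r i c = pcls r i c' <-> c - c' \in B r%:Z i.
Proof. exact: sq_class_eq. Qed.

Lemma pcls_eq0 r i c : c \in Z r%:Z i -> pcls r i c = 0 <-> c \in B r%:Z i.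
Proof. exact: sq_class_eq0. Qed.

Lemma pcls_ind r i (P : page r i -> Prop) :
  (forall c, c \in Z r%:Z i -> P (pcls r i c)) -> forall x, P x.
Proof. exact: sq_ind. Qed.

Lemma gcl_lin r i a c c' : c \in Z r%:Z i -> c' \in Z r%:Z i ->
  gcl r i (a *: c + c') = a *: gcl r i c + gcl r i c'.
Proof. by move=> cZ cZ'; rewrite /gcl pcls_lin // linearP. Qed.

Lemma gclD r i c c' : c \in Z r%:Z i -> c' \in Z r%:Z i -> gcl r i (c + c') = gcl r i c + gcl r i c'.
Proof. by move=> cZ cZ'; have := gcl_lin 1 cZ cZ'; rewrite !scale1r. Qed.

Lemma gcl0 r i : gcl r i 0 = 0.
Proof. by rewrite /gcl /pcls sq_class0 linear0. Qed.

Lemma gclB r i c c' : c \in Z r%:Z i -> c' \in Z r%:Z i -> gcl r i (c - c') = gcl r i c - gcl r i c'.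
Proof.
move=> cZ cZ'; have := gcl_lin (-1) cZ' cZ; rewrite !scaleN1r addrC => ->.
by rewrite addrC.
Qed.

Lemma gcl_eq0 r i c : c \in Z r%:Z i -> gcl r i c = 0 <-> c \in B r%:Z i.
Proof.
move=> cZ; rewrite -(pcls_eq0 cZ) /gcl; split=> [|->]; last exact: linear0.
by rewrite -(linear0 (gin (tpage r) i)) => /gin_inj.
Qed.

Lemma tpage_ind r (P : gt (tpage r) -> Prop) : P 0 -> (forall x y, P x -> P y -> P (x + y)) ->
  (forall i c, c \in Z r%:Z i -> P (gcl r i c)) -> forall x, P x.
Proof.
move=> P0 PD Pc; apply: g_ind => // i x.
by elim/pcls_ind: x => c cZ; apply: Pc.
Qed.

Lemma tpage_ext r (P : lmodType R) (f g : {linear gt (tpage r) -> P}) :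
  (forall i c, c \in Z r%:Z i -> f (gcl r i c) = g (gcl r i c)) -> forall x, f x = g x.
Proof. by move=> fg; apply: g_extl => i x; elim/pcls_ind: x; apply: fg. Qed.

Lemma dl2 (r : nat) i : (i - dl r).2 = i.2 + r%:Z - 1.
Proof. by rewrite /= opprB addrA. Qed.

Lemma Z_cbd (r : nat) (r' : int) i c : c \in Z r%:Z i -> cbd c \in Z r' (i - dl r).
Proof. by move=> /(Zcyc_cbd r'); rewrite dl2. Qed.

Lemma B_cbd (r : nat) i c : c \in B r%:Z i -> cbd c \in B r%:Z (i - dl r).
Proof. by move=> /Bcyc_cbd; rewrite dl2. Qed.

Definition pdiff r i : page r i -> page r (i - dl r) := sq_map cbd.

Lemma pdiff_cls r i c : c \in Z r%:Z i -> pdiff (pcls r i c) = pcls r (i - dl r) (cbd c).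
Proof. by apply: sq_mapE => v; [apply: Z_cbd|move=> _; apply: B_cbd]. Qed.

Lemma pdiff_linear r i : linear (@pdiff r i).
Proof. by apply: sq_map_linear => v; [apply: Z_cbd|move=> _; apply: B_cbd]. Qed.

Definition tdiff r : {linear gt (tpage r) -> gt (tpage r)} :=
  glift (tpage r) (fun i => gin (tpage r) (i - dl r) \o mklin (@pdiff_linear r i)).

Lemma tdiff_in r i x : tdiff r (gin (tpage r) i x) = gin (tpage r) (i - dl r) (pdiff x).
Proof. exact: glift_in. Qed.

Lemma tdiff_cl r i c : c \in Z r%:Z i -> tdiff r (gcl r i c) = gcl r (i - dl r) (cbd c).
Proof. by move=> cZ; rewrite /gcl tdiff_in pdiff_cls. Qed.

(** Z^(r+1) maps onto the cycles of page [r] and onto page [r + 1]. Comparing the two maps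
    identifies the latter page with the homology of the former. *)
Definition cyc r (i : II) : lmodType R := submodule (Z r.+1%:Z i).

Lemma intS1 (r : nat) : r.+1%:Z = r%:Z + 1. Proof. by rewrite intS addrC. Qed.

Lemma Z_mono (r : nat) i c : c \in Z r.+1%:Z i -> c \in Z r%:Z i.
Proof. by rewrite intS1; apply: Zcyc_mono. Qed.

Lemma pcyc_linear r i : linear (fun u : cyc r i => pcls r i (sm_val u)).
Proof. by move=> a u v; rewrite linearP pcls_lin // Z_mono // sm_valP. Qed.
Definition pcyc r i : {linear cyc r i -> page r i} := mklin (@pcyc_linear r i).

Lemma pcyc'_linear r i : linear (fun u : cyc r i => pcls r.+1 i (sm_val u)).
Proof. by move=> a u v; rewrite linearP pcls_lin // sm_valP. Qed.
Definition pcyc' r i : {linear cyc r i -> page r.+1 i} := mklin (@pcyc'_linear r i).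

Lemma pcyc_gcl r i (u : cyc r i) : gin (tpage r) i (pcyc r i u) = gcl r i (sm_val u).
Proof. by []. Qed.

Lemma ge_gcl r i c : ge (tpage r) i (gcl r i c) = gcl r i c. Proof. exact: ge_in. Qed.
Lemma ge_gcl0 r i j c : i != j -> ge (tpage r) j (gcl r i c) = 0. Proof. exact: ge_in0. Qed.

Lemma tdiff_ge r i m : tdiff r (ge (tpage r) i m) = ge (tpage r) (i - dl r) (tdiff r m).
Proof.
elim/g_ind: m => [|x y e e'|j x]; [by rewrite !linear0|by rewrite !linearD e e'|].
have [e|ji] := eqVneq j i; first by subst j; rewrite ge_in tdiff_in ge_in.
by rewrite ge_in0 // tdiff_in ge_in0 ?linear0 // (inj_eq (addIr _)).
Qed.

Lemma page_homology r : presents_homology (dl r) (pcyc r) (pcyc' r) (tdiff r).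
Proof.
split.
- exact: tdiff_ge.
- elim/tpage_ind => [|x y e e'|i c cZ]; [by rewrite !linear0|by rewrite !linearD e e' addr0|].
  by rewrite tdiff_cl // tdiff_cl ?(Z_cbd _ cZ) // (cbd_cbd cZ) gcl0.
- move=> i u; have uZ := sm_valP u; rewrite [X in tdiff r X]pcyc_gcl.
  rewrite (tdiff_cl (Z_mono uZ)); apply: (iffRL (gcl_eq0 (Z_cbd r (Z_mono uZ)))).
  by rewrite dl2; apply: Zcyc_cbd_B; rewrite -intS1.
- move=> i x; elim/pcls_ind: x => c cZ; rewrite -[gin _ _ _]/(gcl r i c) (tdiff_cl cZ).
  move/(iffLR (gcl_eq0 (Z_cbd r cZ))); rewrite dl2 => /(Zcyc_lift cZ)[c' c'Z cc'].
  rewrite -intS1 in c'Z; exists (Submodule c'Z).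
  exact: (iffRL (pcls_eq cZ (Z_mono c'Z))).
- by move=> i x; elim/pcls_ind: x => c cZ; exists (Submodule cZ).
move=> i u; rewrite pcyc_gcl -[pcyc' r i u]/(pcls r.+1 i (sm_val u)); have uZ := sm_valP u; move: (sm_val u) uZ => {u} u uZ.
have uZ1 := uZ; rewrite intS1 in uZ1.
have e2 : i.2 - r%:Z + 1 = (i + dl r).2 by rewrite /= addrA addrAC.
have Zd c : c \in Z r%:Z (i + dl r) -> cbd c \in Z r%:Z i.
  by move=> /(Z_cbd r); rewrite addrK.
have dE c : c \in Z r%:Z (i + dl r) -> tdiff r (gcl r (i + dl r) c) = gcl r i (cbd c).
  by move=> cZ; rewrite (tdiff_cl cZ); apply: gcl_eq; apply: addrK.
apply: (iff_trans (pcls_eq0 uZ)); rewrite intS1.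
apply: (iff_trans (Bcyc_next uZ1)); rewrite e2; split=> [[x xZ xB]|[x xE]].
  exists (gcl r (i + dl r) x); rewrite (dE _ xZ); apply/eqP; rewrite -subr_eq0.
  rewrite -(gclB (Z_mono uZ) (Zd _ xZ)); apply/eqP.
  have uxZ : u - cbd x \in Z r%:Z i by apply: smB; [apply: Z_mono|apply: Zd].
  exact: (iffRL (gcl_eq0 uxZ)).
have : gcl r i u = tdiff r (ge (tpage r) (i + dl r) x).
  by rewrite tdiff_ge addrK -xE ge_gcl.
rewrite -[ge _ _ x]/(gin (tpage r) _ (gpr (tpage r) (i + dl r) x)).
move: (gpr (tpage r) (i + dl r) x) => {xE}x; elim/pcls_ind: x => c cZ.
rewrite -[gin _ _ _]/(gcl r (i + dl r) c) (dE _ cZ) => /eqP.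
rewrite -subr_eq0 -(gclB (Z_mono uZ) (Zd _ cZ)) => /eqP.
have ucZ : u - cbd c \in Z r%:Z i by apply: smB; [apply: Z_mono|apply: Zd].
by move/(iffLR (gcl_eq0 ucZ)) => h; exists c.
Qed.

Definition pageH r : hdata (gt (tpage r)) (gt (tpage r.+1)) :=
  bhd (tpage r.+1) (gS (cyc r)) (page_homology r).

Definition pageHG r : hgraded (dl r) (pageH r) :=
  bgr (tpage r.+1) (gS (cyc r)) (page_homology r).

Lemma pageH_cl r i c (z : hZ (pageH r)) : c \in Z r.+1%:Z i ->
  hi (pageH r) z = gcl r i c -> hh (pageH r) z = gcl r.+1 i c.
Proof.
move=> cZ zc; rewrite /pageH (bhhE (u := gin (gS (cyc r)) i (Submodule cZ))).
  by rewrite tota'_in.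
by rewrite tota_in.
Qed.

Lemma pageH_ind r (P : hZ (pageH r) -> Prop) :
  P 0 -> (forall x y, P x -> P y -> P (x + y)) ->
  (forall i c z, c \in Z r.+1%:Z i -> hi (pageH r) z = gcl r i c -> P z) -> forall z, P z.
Proof.
move=> P0 PD Pc z; have [u zu _] := bhi_ex z.
elim/g_ind: u z zu => [|u v IHu IHv|i u] z zu.
- suff -> : z = 0 by [].
  by apply: (@hi_inj _ _ _ (pageH r)); rewrite zu !linear0.
- have [z1 z1u _] := bhi_tota (tpage r.+1) (page_homology r) u.
  have [z2 z2v _] := bhi_tota (tpage r.+1) (page_homology r) v.
  have -> : z = z1 + z2 by apply: (@hi_inj _ _ _ (pageH r)); rewrite zu !linearD z1u z2v.
  by apply: PD; [apply: IHu|apply: IHv].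
by apply: (Pc i (sm_val u) z (sm_valP u)); rewrite [LHS]zu tota_in.
Qed.

Definition degsign (i : II) : R := (-1) ^+ `|(i.1 + i.2)%R|%N.

Lemma degsign2 i : degsign i * degsign i = 1.
Proof. by rewrite /degsign -expr2 sqrr_sign. Qed.

Lemma degsign_dl r i : degsign (i - dl r) = - degsign i.
Proof.
rewrite /degsign; have -> : (i - dl r).1 + (i - dl r).2 = i.1 + i.2 - 1 by rewrite dl2 /=; ilia.
move: (i.1 + i.2) => n; rewrite -[in LHS]signr_odd -[in RHS]signr_odd.
have -> : odd `|(n - 1)%R|%N = ~~ odd `|n|%N by ilia.
by case: (odd _); rewrite ?opprK.
Qed.

Definition pageS r : hsign (pageH r) :=
  bsign (tpage r.+1) (gS (cyc r)) (page_homology r) degsign2 (degsign_dl r).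

Lemma pageS_cl r i c : hs (pageS r) (gcl r i c) = degsign i *: gcl r i c.
Proof. exact: bsg_in. Qed.

End Pages.

(** * The shuffle map on the pages *)

Section NablaCycles.
Variables (R : comNzRingType) (G H : digraph).
Local Notation nab := (@nab R G H).
Local Notation cbd := (cbd R _).
Local Notation csgn := (csgn R _).

Lemma Zcyc_csgn (K : digraph) (r p q : int) c : c \in @Zcyc R K r p q -> csgn c \in @Zcyc R K r p q.
Proof.
move=> cZ; move/ZcycP: (cZ) => [h1 h2]; apply/ZcycP; split; first exact: FRC_csgn.
by rewrite cbd_csgn ?(Zcyc_nd cZ) // smN // FRC_csgn.
Qed.

Variables (r m n u v p q : int).
Hypotheses (mup : m + u = p) (nvq : n + v = q).

Lemma Zcyc_nab A B : A \in @Zcyc R G r m n -> B \in @Zcyc R H r u v ->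
  nab A B \in @Zcyc R (box G H) r p q.
Proof.
move=> AZ BZ; rewrite -mup -nvq.
have [AF dA] := (iffLR (ZcycP _ _ _ _)) AZ; have [BF dB] := (iffLR (ZcycP _ _ _ _)) BZ.
apply/ZcycP; split; first by apply: (FRC_le (FRC_nab AF BF)); ilia.
rewrite (cbd_nab (Zcyc_nd AZ) (Zcyc_nd BZ)); apply: smB.
  by apply: (FRC_le (FRC_nab dA BF)); ilia.
by apply: (FRC_le (FRC_nab (FRC_csgn AF) dB)); ilia.
Qed.
End NablaCycles.

Section NablaBoundaries.
Variables (R : comNzRingType) (G H : digraph).
Local Notation nab := (@nab R G H).
Local Notation cbd := (cbd R _).
Local Notation csgn := (csgn R _).
Variables (r m n u v p q : int).
Hypotheses (mup : m + u = p) (nvq : n + v = q).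

Lemma Zcyc_pred (K : digraph) (p' q' : int) c : c \in @Zcyc R K r p' q' -> c \in @Zcyc R K (r - 1) p' q'.
Proof. by move=> cZ; apply: Zcyc_mono; rewrite subrK. Qed.

Lemma Bcyc_nabl A B : A \in @Bcyc R G r m n -> B \in @Zcyc R H r u v ->
  nab A B \in @Bcyc R (box G H) r p q.
Proof.
move=> /BcycP[y [z [yZ zZ ->]]] BZ; have BZ' := Zcyc_pred BZ.
(* The Leibniz rule solved for the product with [cbd z]. The correction lies in filtration [p - 1],
   because [z] is in [m + r - 1] and [cbd B] in [u - r]. *)
have -> : nab (y + cbd z) B = (nab y B + nab (csgn z) (cbd B)) + cbd (nab z B).
  rewrite (cbd_nab (Zcyc_nd zZ) (Zcyc_nd BZ)) nabDl -addrA; congr (_ + _).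
  by rewrite addrC subrK.
apply/BcycP; exists (nab y B + nab (csgn z) (cbd B)), (nab z B); split=> [||//].
  apply: rpredD.
    by apply: (Zcyc_nab _ _ yZ BZ'); rewrite -?mup -?nvq; ilia.
  by apply: (Zcyc_nab _ _ (Zcyc_csgn zZ) (Zcyc_cbd (r - 1) BZ)); rewrite -?mup -?nvq; ilia.
by apply: (Zcyc_nab _ _ zZ BZ'); rewrite -?mup -?nvq; ilia.
Qed.

Lemma Bcyc_nabr A B : A \in @Zcyc R G r m n -> B \in @Bcyc R H r u v ->
  nab A B \in @Bcyc R (box G H) r p q.
Proof.
move=> AZ /BcycP[y [z [yZ zZ ->]]]; have AZ' := Zcyc_pred AZ.
have cA := Zcyc_csgn AZ.
(* The same with the boundary on the right; [csgn (- A)] absorbs the Koszul sign, so that [A]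
   reappears unsigned. *)
have -> : nab A (y + cbd z) = (nab A y + nab (cbd (csgn A)) z) + cbd (nab (csgn (- A)) z).
  rewrite (cbd_nab _ (Zcyc_nd zZ)); last by rewrite nd_csgn // smN // (Zcyc_nd AZ).
  rewrite (linearN csgn) (linearN cbd) (linearN csgn) csgnK nabDr -addrA; congr (_ + _).
  by rewrite !nabNl opprK addNKr.
apply/BcycP; exists (nab A y + nab (cbd (csgn A)) z), (nab (csgn (- A)) z); split=> [||//].
  apply: rpredD.
    by apply: (Zcyc_nab _ _ AZ' yZ); rewrite -?mup -?nvq; ilia.
  by apply: (Zcyc_nab _ _ (Zcyc_cbd (r - 1) cA) zZ); rewrite -?mup -?nvq; ilia.
by apply: (Zcyc_nab _ _ (Zcyc_csgn (smN AZ')) zZ); rewrite -?mup -?nvq; ilia.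
Qed.
End NablaBoundaries.

Section NablaPage.
Variables (R : comNzRingType) (G H : digraph) (r : nat).
Local Notation nab := (@nab R G H).

Section Pair.
Variables (m n u v p q : int).
Hypotheses (mup : m + u = p) (nvq : n + v = q).
Local Notation npair := (@nabla_pair R G H r m n u v p q).

Lemma nabla_pairE A B : A \in @Zcyc R G r m n -> B \in @Zcyc R H r u v ->
  npair (sq_class _ _ A) (sq_class _ _ B) = sq_class _ _ (nab A B).
Proof.
move=> AZ BZ; rewrite /nabla_pair -nab_nabla.
set A' := sq_repr _; set B' := sq_repr _.
have A'Z : A' \in @Zcyc R G r m n by apply: sq_reprP.
have B'Z : B' \in @Zcyc R H r u v by apply: sq_reprP.
have AA : A' - A \in @Bcyc R G r m n by rewrite -opprB smN // sq_repr_class.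
have BB : B' - B \in @Bcyc R H r u v by rewrite -opprB smN // sq_repr_class.
apply: (iffRL (sq_class_eq _ (Zcyc_nab mup nvq A'Z B'Z) (Zcyc_nab mup nvq AZ BZ))).
have -> : nab A' B' - nab A B = nab (A' - A) B' + nab A (B' - B).
  by rewrite nabDl nabDr nabNl nabNr addrA subrK.
by apply: rpredD; [apply: (Bcyc_nabl mup nvq AA)|apply: (Bcyc_nabr mup nvq AZ)].
Qed.

Lemma nabla_pair_linl y : linear (fun x => npair x y).
Proof.
move=> a x x'; elim/sq_ind: x => A AZ; elim/sq_ind: x' => A' A'Z; elim/sq_ind: y => B BZ.
rewrite -(sq_class_lin _ a AZ A'Z) (nabla_pairE AZ BZ) (nabla_pairE A'Z BZ).
rewrite (nabla_pairE _ BZ); last by rewrite rpredD ?rpredZ.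
rewrite nabDl nabZl; apply: sq_class_lin; exact: (Zcyc_nab mup nvq).
Qed.

Lemma nabla_pair_linr x : linear (npair x).
Proof.
move=> a y y'; elim/sq_ind: x => A AZ; elim/sq_ind: y => B BZ; elim/sq_ind: y' => B' B'Z.
rewrite -(sq_class_lin _ a BZ B'Z) (nabla_pairE AZ BZ) (nabla_pairE AZ B'Z).
have aB : a *: B + B' \in @Zcyc R H r u v by apply: rpredD => //; apply: rpredZ.
rewrite (nabla_pairE AZ aB) nabDr nabZr; apply: sq_class_lin; exact: (Zcyc_nab mup nvq).
Qed.
End Pair.
End NablaPage.

Section TotalNabla.
Variables (R : idomainType) (T : tensor_theory R).
Variable (gS : forall F : II -> lmodType R, gsum F).
Variables (G H : digraph).
Local Notation nab := (@nab R G H).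
Local Notation TT := (ten T).
Local Notation tm := (tm_of T).
Local Notation tmap := (tmap_of T).
Local Notation gb := (@box G H).
Local Notation Z r K i := (@Zcyc R K r%:Z i.1 i.2).

Section Page.
Variable r : nat.

Definition npage (i j : II) (x : page R G r i) (y : page R H r j) : page R gb r (i + j) :=
  @nabla_pair R G H r i.1 i.2 j.1 j.2 (i + j).1 (i + j).2 x y.

Lemma npage_cls i j A B : A \in Z r G i -> B \in Z r H j ->
  npage (pcls r i A) (pcls r j B) = pcls r (i + j) (nab A B).
Proof. by move=> AZ BZ; exact: (nabla_pairE (erefl _) (erefl _) AZ BZ). Qed.

Lemma npage_linl i j (y : page R H r j) : linear (fun x : page R G r i => npage x y).
Proof. exact: nabla_pair_linl. Qed.

Lemma npage_linr i j (x : page R G r i) : linear (@npage i j x).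
Proof. exact: nabla_pair_linr. Qed.

Lemma gnpage_linl i j (y : page R H r j) :
  linear (fun x : page R G r i => gin (tpage gb gS r) (i + j) (npage x y)).
Proof. by move=> a x x'; rewrite -linearP (npage_linl y). Qed.

Lemma gnpage_linr i j (x : page R G r i) :
  linear (fun y : page R H r j => gin (tpage gb gS r) (i + j) (npage x y)).
Proof. by move=> a y y'; rewrite -linearP (npage_linr x). Qed.

Definition tnab : {linear TT (gt (tpage G gS r)) (gt (tpage H gS r)) -> gt (tpage gb gS r)} :=
  gbilin T (tpage G gS r) (tpage H gS r) gnpage_linl gnpage_linr.

Lemma tnab_in i j x y : tnab (tm (gin (tpage G gS r) i x) (gin (tpage H gS r) j y)) =
  gin (tpage gb gS r) (i + j) (npage x y).
Proof. exact: gbilinE. Qed.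

Lemma tnab_cl i j A B : A \in Z r G i -> B \in Z r H j ->
  tnab (tm (gcl gS r i A) (gcl gS r j B)) = gcl gS r (i + j) (nab A B).
Proof. by move=> AZ BZ; rewrite /gcl tnab_in npage_cls. Qed.

Lemma ttpage_ext (P : lmodType R)
    (f g : {linear TT (gt (tpage G gS r)) (gt (tpage H gS r)) -> P}) :
  (forall i j A B, A \in Z r G i -> B \in Z r H j ->
    f (tm (gcl gS r i A) (gcl gS r j B)) = g (tm (gcl gS r i A) (gcl gS r j B))) ->
  forall t, f t = g t.
Proof.
move=> fg; apply: (@ten_gind _ _ _ _ _ (tpage G gS r) (tpage H gS r) (fun t => f t = g t)) =>
  [|x y e e'|i j x y]; first by rewrite !linear0.
  by rewrite !linearD e e'.
elim/pcls_ind: x => A AZ; elim/pcls_ind: y => B BZ.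
exact: fg.
Qed.

Lemma tnab_gr i j x y : ge (tpage gb gS r) (i + j) (tnab (tm (gin (tpage G gS r) i x)
  (gin (tpage H gS r) j y))) = tnab (tm (gin (tpage G gS r) i x) (gin (tpage H gS r) j y)).
Proof. by rewrite tnab_in ge_in. Qed.

Local Notation D := (kdiff (pageS G gS r) (pageH H gS r)).
Let Dl := mklin (kdiff_linear (T := T) (pageS G gS r) (pageH H gS r)).

Lemma D_cl i j A B : A \in Z r G i -> B \in Z r H j ->
  D (tm (gcl gS r i A) (gcl gS r j B)) =
    tm (gcl gS r (i - dldeg r) (cbd R G A)) (gcl gS r j B) +
    degsign R i *: tm (gcl gS r i A) (gcl gS r (j - dldeg r) (cbd R H B)).
Proof.
move=> AZ BZ; rewrite /kdiff !tm_mapE pageS_cl tmZl.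
congr (tm _ _ + _ *: tm _ _); exact: tdiff_cl.
Qed.

Lemma tnab_D t : tnab (D t) = hdiff (pageH gb gS r) (tnab t).
Proof.
apply: (@ttpage_ext _ (tnab \o Dl) (hdiff (pageH gb gS r) \o tnab)) => i j A B AZ BZ.
rewrite -[LHS]/(tnab (D _)) (D_cl AZ BZ) (linearD tnab) (linearZZ tnab).
have dA := Z_cbd r AZ; have dB := Z_cbd r BZ.
rewrite (tnab_cl dA BZ) (tnab_cl AZ dB).
rewrite -[RHS]/(tdiff gb gS r (tnab _)) (tnab_cl AZ BZ).
have nZ : nab A B \in Z r gb (i + j) by exact: (Zcyc_nab (erefl _) (erefl _) AZ BZ).
rewrite (tdiff_cl gS nZ) (cbd_nab (Zcyc_nd AZ) (Zcyc_nd BZ)).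
have [AF _] := (iffLR (ZcycP _ _ _ _)) AZ.
rewrite (FRC_csgnE AF) nabNl opprK nabZl.
have e1 : i - dldeg r + j = i + j - dldeg r by rewrite addrAC.
have e2 : i + (j - dldeg r) = i + j - dldeg r by rewrite addrA.
rewrite (gcl_eq gS r (nab (cbd R G A) B) e1) (gcl_eq gS r (nab A (cbd R H B)) e2).
have Z1 : nab (cbd R G A) B \in Z r gb (i + j - dldeg r) by rewrite -e1; exact: (Zcyc_nab (erefl _) (erefl _) dA BZ).
have Z2 : nab A (cbd R H B) \in Z r gb (i + j - dldeg r) by rewrite -e2; exact: (Zcyc_nab (erefl _) (erefl _) AZ dB).
rewrite [nab (cbd R G A) B + _]addrC -/(degsign R i) (gcl_lin gS (degsign R i) Z2 Z1).
exact: addrC.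
Qed.
End Page.

Lemma tnab_h r (t : TT (hZ (pageH G gS r)) (hZ (pageH H gS r))) : exists x,
  hi (pageH gb gS r) x = tnab r (tmap (hi (pageH G gS r)) (hi (pageH H gS r)) t) /\
  hh (pageH gb gS r) x = tnab r.+1 (tmap (hh (pageH G gS r)) (hh (pageH H gS r)) t).
Proof.
elim/(@ten_ind R T): t => [|x y [u [u1 u2]] [v [v1 v2]]|x y].
- by exists 0; rewrite !linear0.
- by exists (u + v); rewrite !linearD u1 u2 v1 v2.
rewrite !tm_mapE.
elim/pageH_ind: x => [|x x' [u [u1 u2]] [v [v1 v2]]|i A z AZ zA].
- by exists 0; rewrite !linear0 !tm0l !linear0.
- by exists (u + v); rewrite !linearD u1 u2 v1 v2 !tmDl !linearD.
elim/pageH_ind: y => [|x x' [u [u1 u2]] [v [v1 v2]]|j B w BZ wB].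
- by exists 0; rewrite !linear0 !tm0r !linear0.
- by exists (u + v); rewrite !linearD u1 u2 v1 v2 !tmDr !linearD.
rewrite zA wB (pageH_cl AZ zA) (pageH_cl BZ wB) (tnab_cl (Z_mono AZ) (Z_mono BZ)) (tnab_cl AZ BZ).
have nZ : nab A B \in Z r.+1 gb (i + j) by exact: (Zcyc_nab (erefl _) (erefl _) AZ BZ).
have [x xE] : exists x, hi (pageH gb gS r) x = gcl gS r (i + j) (nab A B).
  have [u uE _] := bhi_tota (tpage gb gS r.+1) (page_homology gb gS r)
    (gin (gS (cyc R gb r)) (i + j) (Submodule nZ)).
  by exists u; rewrite [LHS]uE tota_in.
by exists x; split=> //; apply: pageH_cl.
Qed.

End TotalNabla.

(** * The page zero *)

Section PageZero.
Variables (R : comNzRingType) (K : digraph).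

Lemma FRC_U (l k : int) u : (<< u >> : chain R K) \in @FRC R K l k =
  [&& reachable_tuple u, (size u)%:Z == k + 1 & (tuple_length u)%:Z <= l].
Proof. exact: supp_predU. Qed.

Lemma FRC_ind (l k : int) (P : chain R K -> Prop) : P 0 ->
  (forall a x y, x \in @FRC R K l k -> y \in @FRC R K l k -> P x -> P y -> P (a *: x + y)) ->
  (forall u, (<< u >> : chain R K) \in @FRC R K l k -> P << u >>) ->
  forall c, c \in @FRC R K l k -> P c.
Proof.
move=> P0 PD PU c cF; suff [] : c \in @FRC R K l k /\ P c by [].
apply: (@supp_ind R _ _ (fun c => c \in @FRC R K l k /\ P c) _ _ _ c cF).
- by split=> //; apply: rpred0.
- by move=> a x y [xF Px] [yF Py]; split; [apply: rpredD => //; apply: rpredZ|apply: PD].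
move=> u pu; have uF : (<< u >> : chain R K) \in @FRC R K l k by rewrite supp_predU.
by split=> //; apply: PU.
Qed.

Lemma Z0_FRC (p q : int) c : c \in @FRC R K p (p + q) -> c \in @Zcyc R K 0%N%:Z p q.
Proof. by move=> cF; apply/ZcycP; split=> //; rewrite subr0; apply: FRC_cbd. Qed.

Lemma Z0P (p q : int) c : c \in @Zcyc R K 0%N%:Z p q -> c \in @FRC R K p (p + q).
Proof. by move=> /ZcycP[]. Qed.

Lemma B0_FRC (p q : int) c : c \in @FRC R K (p - 1) (p + q) -> c \in @Bcyc R K 0%N%:Z p q.
Proof.
move=> cF; apply: Zcyc_Bcyc; apply/ZcycP; split; first by apply: (FRC_le cF); ilia.
by apply: (FRC_le (FRC_cbd cF)); ilia.
Qed.

Lemma B0P (p q : int) c : c \in @Bcyc R K 0%N%:Z p q -> c \in @FRC R K (p - 1) (p + q).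
Proof.
move=> /BcycP[y [z [/ZcycP[yF _] /ZcycP[zF _] ->]]]; apply: rpredD.
  by apply: (FRC_le yF); ilia.
by apply: (FRC_le (FRC_cbd zF)); ilia.
Qed.

Section Lift.
Variables (gS : forall F : II -> lmodType R, gsum F) (P : lmodType R).
Variable phi : II -> {linear chain R K -> P}.
Hypothesis phi0 : forall i c, c \in @FRC R K (i.1 - 1) (i.1 + i.2) -> phi i c = 0.

Let lift i (x : page R K 0 i) : P := phi i (sq_repr x).

Lemma page0_liftE i c : c \in @FRC R K i.1 (i.1 + i.2) -> lift (pcls 0 i c) = phi i c.
Proof.
move=> cF; apply/eqP; rewrite eq_sym -subr_eq0 -linearB; apply/eqP/phi0/B0P.
exact: (sq_repr_class _ (Z0_FRC cF)).
Qed.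

Lemma page0_lift_linear i : linear (@lift i).
Proof.
move=> a x y; elim/pcls_ind: x => c cZ; elim/pcls_ind: y => c' cZ'.
have aZ : a *: c + c' \in @Zcyc R K 0%N%:Z i.1 i.2 by apply: rpredD => //; apply: rpredZ.
rewrite -(pcls_lin a cZ cZ') (page0_liftE (Z0P aZ)) (page0_liftE (Z0P cZ)) (page0_liftE (Z0P cZ')).
exact: linearP.
Qed.

Definition page0_lift : {linear gt (tpage K gS 0) -> P} :=
  glift (tpage K gS 0) (fun i => mklin (@page0_lift_linear i)).

Lemma page0_lift_cl i c : c \in @FRC R K i.1 (i.1 + i.2) ->
  page0_lift (gcl gS 0 i c) = phi i c.
Proof. by move=> cF; rewrite /page0_lift /gcl glift_in; apply: page0_liftE. Qed.
End Lift.
End PageZero.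

(** * The Eilenberg-Zilber equivalence on page zero *)

Section BasePage.
Variables (R : idomainType) (T : tensor_theory R).
Variable (gS : forall F : II -> lmodType R, gsum F).
Variables (G H : digraph).
Local Notation TT := (ten T).
Local Notation tm := (tm_of T).
Local Notation tmap := (tmap_of T).
Local Notation gb := (@box G H).
Local Notation Z K i := (@Zcyc R K 0%N%:Z i.1 i.2).
Local Notation nab := (@nab R G H).
Local Notation tp := (@tp R G H).
Local Notation T2 := (T2 R G H).
Local Notation tG := (tpage G gS 0).
Local Notation tH := (tpage H gS 0).
Local Notation tX := (tpage gb gS 0).
Local Notation cbd := (cbd R _).
Local Notation aw := (aw R G H).

Definition tupi (K : digraph) (u : seq K) : II :=
  ((tuple_length u)%:Z, (size u)%:Z - 1 - (tuple_length u)%:Z).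
Definition clt (K : digraph) (u : seq K) : gt (tpage K gS 0) := gcl gS 0 (tupi u) << u >>.

(** The passage from the tensor product of chains in filtration [p] to its quotient by filtration
    [p - 1], identified with the part of filtration degree [p] in the tensor product of the zeroth
    pages. Hence shorter pairs go to zero. *)
Definition kap (p : int) : {linear T2 -> TT (gt tG) (gt tH)} :=
  @locked_with tt_key {linear T2 -> TT (gt tG) (gt tH)} (free_lift (fun st : seq G * seq H =>
    if (tuple_length st.1 + tuple_length st.2)%:Z == p then tm (clt st.1) (clt st.2) else 0)).

Lemma kapU p s t : kap p << (s, t) >> =
  if (tuple_length s + tuple_length t)%:Z == p then tm (clt s) (clt t) else 0.
Proof. rewrite /kap locked_withE; exact: free_liftU. Qed.

Lemma clt_cl (K : digraph) (u : seq K) (i : II) :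
  (<< u >> : chain R K) \in @FRC R K i.1 (i.1 + i.2) ->
  gcl gS 0 i (<< u >> : chain R K) = if (tuple_length u)%:Z == i.1 then clt u else 0.
Proof.
move=> uF; have := uF; rewrite FRC_U => /and3P[ru /eqP su lu]; case: eqP => lui.
  apply: gcl_eq; rewrite [i]surjective_pairing /tupi su lui; congr pair; ilia.
apply/gcl_eq0; first exact: Z0_FRC.
apply: B0_FRC; rewrite FRC_U ru su eqxx /=; move: lui lu; move: (tuple_length _) => l; ilia.
Qed.

Lemma kap_tp (i j : II) p A B : i.1 + j.1 = p ->
  A \in @FRC R G i.1 (i.1 + i.2) -> B \in @FRC R H j.1 (j.1 + j.2) ->
  kap p (tp A B) = tm (gcl gS 0 i A) (gcl gS 0 j B).
Proof.
move=> <- AF BF; move: A AF.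
apply: FRC_ind => [|a A A' AF AF' e e'|s sF]; first by rewrite tp0l gcl0 tm0l linear0.
  by rewrite tpDl tpZl (linearP (kap _)) e e' (gcl_lin gS a (Z0_FRC AF) (Z0_FRC AF')) tmDl tmZl.
move: B BF; apply: FRC_ind => [|a B B' BF BF' e e'|t tF]; first by rewrite tp0r gcl0 tm0r linear0.
  by rewrite tpDr tpZr (linearP (kap _)) e e' (gcl_lin gS a (Z0_FRC BF) (Z0_FRC BF')) tmDr tmZr.
rewrite tpU kapU (clt_cl sF) (clt_cl tF).
move: sF tF; rewrite !FRC_U => /and3P[_ _ ls] /and3P[_ _ lt].
(* Both lengths are bounded by the filtration degrees, so their sum reaches [p] only if both bounds
   are attained; otherwise one of the two classes is zero as well. *)
case: (eqVneq (tuple_length s)%:Z i.1) => es; case: (eqVneq (tuple_length t)%:Z j.1) => et.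
- by rewrite PoszD es et eqxx.
- rewrite tm0r ifF //; move: et lt ls; move: (tuple_length _) (tuple_length _) => l l'; ilia.
- rewrite tm0l ifF //; move: es lt ls; move: (tuple_length _) (tuple_length _) => l l'; ilia.
- rewrite tm0l ifF //; move: es lt ls; move: (tuple_length _) (tuple_length _) => l l'; ilia.
Qed.

Lemma kap_lt (a b m n p : int) A B : a + b < p ->
  A \in @FRC R G a m -> B \in @FRC R H b n -> kap p (tp A B) = 0.
Proof.
move=> abp AF BF; move: A AF.
apply: FRC_ind => [|c A A' AF AF' e e'|s sF]; first by rewrite tp0l linear0.
  by rewrite tpDl tpZl (linearP (kap _)) e e' scaler0 addr0.
move: B BF; apply: FRC_ind => [|c B B' BF BF' e e'|t tF]; first by rewrite tp0r linear0.
  by rewrite tpDr tpZr (linearP (kap _)) e e' scaler0 addr0.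
rewrite tpU kapU ifF //; move: sF tF; rewrite !FRC_U => /and3P[_ _ ls] /and3P[_ _ lt].
by move: abp ls lt; move: (tuple_length _) (tuple_length _) => l l'; ilia.
Qed.

Lemma kap_pairF_lt (p n : int) w : w \in supp_pred (pairF (p - 1) n) -> kap p w = 0.
Proof.
apply: supp_ext0 => -[s t] /and4P[_ _ /= le _]; rewrite kapU ifF //.
by move: le; move: (tuple_length _) (tuple_length _) => l l'; ilia.
Qed.

Lemma pairF_FRC (p n : int) (s : seq G) (t : seq H) : pairF p n (s, t) ->
  [/\ (<< s >> : chain R G) \in @FRC R G (tupi s).1 ((tupi s).1 + (tupi s).2),
      (<< t >> : chain R H) \in @FRC R H (tupi t).1 ((tupi t).1 + (tupi t).2),
      (tuple_length s + tuple_length t)%:Z <= p & (tupi s + tupi t).2 =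
        n - (tuple_length s + tuple_length t)%:Z].
Proof.
move=> /and4P[/= rs rt le /eqP sz]; rewrite !FRC_U rs rt /=; split=> //.
- by rewrite lexx andbT /tupi /=; apply/eqP; ilia.
- by rewrite lexx andbT /tupi /=; apply/eqP; ilia.
move: sz; rewrite /tupi /=; ilia.
Qed.

Lemma kap_dT (p n : int) w : w \in supp_pred (pairF p n) ->
  kap p (dT R G H w) = kdiff (pageS G gS 0) (pageH H gS 0) (kap p w).
Proof.
pose Dl := mklin (kdiff_linear (T := T) (pageS G gS 0) (pageH H gS 0)).
apply: (@supp_ext R _ _ _ (kap p \o dT R G H) (Dl \o kap p)) => -[s t] /pairF_FRC[sF tF le _].
rewrite -[LHS]/(kap p (dT R G H _)) -[RHS]/(kdiff _ _ (kap p _)).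
rewrite -{1}tpU dT_tp kapU (FRC_csgnE sF) tpNl opprK tpZl (linearD (kap p)) (linearZZ (kap p)).
have dsF := FRC_cbd sF; have dtF := FRC_cbd tF.
case: eqP => lp; last first.
  have lt : (tuple_length s)%:Z + (tuple_length t)%:Z < p.
    by move: lp le; move: (tuple_length s) (tuple_length t) => l l'; ilia.
  rewrite (kap_lt lt dsF tF) (kap_lt lt sF dtF) scaler0 addr0.
  by rewrite -[RHS]/(Dl 0) linear0.
rewrite (D_cl T gS (Z0_FRC sF) (Z0_FRC tF)); congr (_ + _ *: _).
  apply: kap_tp => //; first by rewrite /= subr0 -PoszD.
  by apply: (FRC_le dsF); rewrite /tupi /=; ilia.
apply: kap_tp => //; first by rewrite /= subr0 -PoszD.
by apply: (FRC_le dtF); rewrite /tupi /=; ilia.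
Qed.

Lemma tupi_pair (p n : int) (s : seq G) (t : seq H) : (tupi s + tupi t).2 =
    n - (tuple_length s + tuple_length t)%:Z ->
  (tuple_length s + tuple_length t)%:Z = p -> tupi s + tupi t = (p, n - p).
Proof. by move=> e2 <-; rewrite -e2. Qed.

Lemma kap_homog (p n : int) w : w \in supp_pred (pairF p n) ->
  homog (M := tG) (N := tH) (p, n - p) (kap p w).
Proof.
move=> wF i j ijk.
apply: (@supp_ext0 R _ _ _ (tmap (ge tG i) (ge tH j) \o kap p) _ w wF) => -[s t].
move=> /pairF_FRC[_ _ _ e2]; rewrite -[LHS]/(tmap _ _ (kap p _)) kapU.
case: eqP => [lp|_]; last by rewrite linear0.
rewrite tm_mapE; have [e|ne] := eqVneq (tupi s) i; last by rewrite (ge_gcl0 gS 0 _ ne) tm0l.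
rewrite (ge_gcl0 gS 0 (j := j)) ?tm0r //; apply: contraNneq ijk => <-.
by rewrite -e (tupi_pair e2 lp).
Qed.

Lemma tnab_kap (p n : int) w : w \in supp_pred (pairF p n) ->
  tnab T gS G H 0 (kap p w) = gcl gS 0 (p, n - p) (nabT R G H w) /\
  nabT R G H w \in @FRC R gb p n.
Proof.
move: w; apply: supp_ind => [|a x y [e eF] [e' eF']|[s t]].
- by rewrite !linear0 gcl0 rpred0.
- split; last by rewrite linearP; apply: rpredD => //; apply: rpredZ.
  rewrite (linearP (kap p)) (linearP (tnab _ _ _ _ _)) e e' (linearP (nabT R G H)).
  by apply/esym; apply: gcl_lin; apply: Z0_FRC => /=; rewrite addrC subrK.
move=> /pairF_FRC[sF tF le e2]; rewrite -tpU nabT_tp; have nF := FRC_nab sF tF.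
have nF' : nab << s >> << t >> \in @FRC R gb p n.
  apply: (FRC_le nF) => //=; move: e2 => /=.
  by move: (tuple_length s) (size s) (tuple_length t) (size t) => a b c d; ilia.
split=> //; rewrite tpU kapU; case: eqP => [lp|lp].
  by rewrite (tnab_cl _ _ (Z0_FRC sF) (Z0_FRC tF)) (tupi_pair e2 lp).
rewrite linear0; apply/esym/gcl_eq0; first by apply: Z0_FRC => /=; rewrite addrC subrK.
apply: B0_FRC; apply: (FRC_le nF) => /=.
  by move: le lp; move: (tuple_length s) (tuple_length t) => l l'; ilia.
move: e2 => /=; move: (tuple_length s) (size s) (tuple_length t) (size t) => a b c d; ilia.
Qed.

Definition awtot : {linear gt tX -> TT (gt tG) (gt tH)}.
apply: (@page0_lift R gb gS _ (fun i => kap i.1 \o aw)) => i c cF.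
exact: kap_pairF_lt (FRC_aw cF).
Defined.

Lemma awtot_cl i c : c \in @FRC R gb i.1 (i.1 + i.2) ->
  awtot (gcl gS 0 i c) = kap i.1 (aw c).
Proof. by move=> cF; rewrite page0_lift_cl. Qed.

Lemma awtot_tnab t : awtot (tnab T gS G H 0 t) = t.
Proof.
apply: (@ttpage_ext R T gS G H 0 _ (awtot \o tnab T gS G H 0) (idl _)) => i j A B AZ BZ.
rewrite -[LHS]/(awtot (tnab _ _ _ _ _ _)) (tnab_cl _ _ AZ BZ).
have nF : nab A B \in @FRC R gb (i + j).1 ((i + j).1 + (i + j).2).
  by apply: (FRC_le (FRC_nab (Z0P AZ) (Z0P BZ))) => //=; ilia.
rewrite (awtot_cl nF) (aw_nab (Zcyc_nd AZ) (Zcyc_nd BZ)).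
exact: (kap_tp (erefl _) (Z0P AZ) (Z0P BZ)).
Qed.

Lemma awtot_diff x : awtot (tdiff gb gS 0 x) =
  kdiff (pageS G gS 0) (pageH H gS 0) (awtot x).
Proof.
pose Dl := mklin (kdiff_linear (T := T) (pageS G gS 0) (pageH H gS 0)).
apply: (@tpage_ext R gb gS 0 _ (awtot \o tdiff gb gS 0) (Dl \o awtot)) => i c cZ.
rewrite -[LHS]/(awtot (tdiff _ _ _ _)) -[RHS]/(kdiff _ _ (awtot _)).
rewrite (awtot_cl (Z0P cZ)) (tdiff_cl gS cZ) (awtot_cl (Z0P (Z_cbd 0 cZ))).
by rewrite [X in kap X _]subr0 (aw_cbd (Zcyc_nd cZ)) (kap_dT (FRC_aw (Z0P cZ))).
Qed.

(** The Alexander-Whitney map is a left inverse on the page and commutes with the differentials, so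
    it carries [x] to the required [v]. *)
Lemma base_q1 t x : kdiff (pageS G gS 0) (pageH H gS 0) t = 0 ->
  tnab T gS G H 0 t = hdiff (pageH gb gS 0) x ->
  exists v, t = kdiff (pageS G gS 0) (pageH H gS 0) v.
Proof.
by move=> _ e; exists (awtot x); rewrite -awtot_diff -[tdiff _ _ _ _]e awtot_tnab.
Qed.

(** Take the Alexander-Whitney image of a representing chain [c] for [t]; it is homogeneous because
    this map preserves length and degree. The homotopy supplies [v], with a minus sign because it
    equals [ez c - c]. *)
Lemma base_q2 k z x : hi (pageH gb gS 0) z = gin tX k x ->
  exists t v, [/\ homog (M := tG) (N := tH) k t,
    kdiff (pageS G gS 0) (pageH H gS 0) t = 0 &
    hi (pageH gb gS 0) z = tnab T gS G H 0 t + hdiff (pageH gb gS 0) v].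
Proof.
have z0 : tdiff gb gS 0 (hi (pageH gb gS 0) z) = 0 by apply: bhi_d.
move: (hi _ z) z0 => y y0 yx; rewrite {}yx in y0 *.
elim/pcls_ind: x y0 => c cZ; rewrite -[gin _ _ _]/(gcl gS 0 k c) => c0.
have cF := Z0P cZ; have awF := FRC_aw cF.
exists (kap k.1 (aw c)), (- gcl gS 0 (k + dldeg 0) (phi R G H c)).
have ke : (k.1, k.1 + k.2 - k.1) = k.
  by rewrite [RHS]surjective_pairing; congr pair; ilia.
split.
- by rewrite -[k in homog k]ke; apply: kap_homog.
- by rewrite -(awtot_cl cF) -awtot_diff c0 linear0.
have [-> ezF] := tnab_kap awF; rewrite ke -ezE.
have pF := FRC_phi cF.
have pZ : phi R G H c \in Z gb (k + dldeg 0).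
  by apply: Z0_FRC; apply: (FRC_le pF) => /=; ilia.
rewrite linearN -[hdiff _ _]/(tdiff gb gS 0 _) (tdiff_cl gS pZ) (gcl_eq _ _ _ (addrK _ _)).
have dpZ : cbd (phi R G H c) \in Z gb k by rewrite -[k in Z _ k](addrK (dldeg 0)) Z_cbd.
(* A cycle of page zero has its boundary in the next lower filtration. The term [phi (cbd c)] of the
   homotopy formula is thereby zero on the page. *)
have dcF : cbd c \in @FRC R gb (k.1 - 1) (k.1 + k.2 - 1).
  move: c0; rewrite (tdiff_cl gS cZ) => /(iffLR (gcl_eq0 gS (Z_cbd 0 cZ))) /B0P h.
  by apply: (FRC_le h) => /=; ilia.
have pdB : phi R G H (cbd c) \in @Bcyc R gb 0%N%:Z k.1 k.2.
  by apply: B0_FRC; apply: (FRC_le (FRC_phi dcF)); ilia.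
have pdZ : phi R G H (cbd c) \in Z gb k.
  by apply: Z0_FRC; apply: (FRC_le (FRC_phi dcF)); ilia.
have ezZ : ez R G H c \in Z gb k by apply: Z0_FRC; rewrite ezE.
rewrite -(gclB gS ezZ dpZ) -[LHS]addr0 -(iffRL (gcl_eq0 gS pdZ) pdB) -(gclD gS cZ pdZ).
congr gcl; have := phi_homotopy (Zcyc_nd cZ) => /(congr1 (fun x => x - cbd (phi R G H c))).
by rewrite addrC addKr => ->; rewrite addrA addrCA subrr addr0 addrC.
Qed.
End BasePage.

(** * Induction on the pages *)

(** Over a principal ideal domain flatness can be tested as torsion-freeness, which a direct sum
    inherits component by component. *)
Lemma gsum_tflat (R : idomainType) (T : tensor_theory R) (pidR : is_pid R) (I : choiceType)
    (F : I -> lmodType R) (gF : gsum F) : (forall i, tflat T (F i)) -> tflat T (gt gF).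
Proof.
move=> fl; have h : torsion_free (gt gF).
  move=> a x ax0; have [->|a0] := eqVneq a 0; [by left|right].
  apply: g_ext => i; rewrite linear0.
  have : a *: gpr gF i x = 0 by rewrite -linearZZ ax0 linear0.
  by move=> /(tflat_torsion_free (fl i))[/eqP|//]; rewrite (negPf a0).
have h' := torsion_free_tflat (T := T) pidR h; exact: h'.
Qed.

Section PageKunneth.
Variables (R : idomainType) (T : tensor_theory R) (pidR : is_pid R).
Variables (Q : resolution_theory R) (flQ : forall N, tflat T (res0 Q N)).
Variable (gS : forall F : II -> lmodType R, gsum F).

Definition compT (k i : II) : II := (k.1 - i.1, k.2 - i.2).
Definition compTor (r : nat) (k i : II) : II :=
  (k.1 - i.1 - r%:Z + 1, k.2 - i.2 + r%:Z - 2).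

Lemma compTE k i : compT k i = k - i. Proof. by []. Qed.
Lemma compT1 (k i : II) : i.1 + (compT k i).1 = k.1. Proof. by rewrite /= addrC subrK. Qed.
Lemma compT2 (k i : II) : i.2 + (compT k i).2 = k.2. Proof. by rewrite /= addrC subrK. Qed.
(** With [s = r + 1] the shift [(1 - s, s - 2)] of the Tor term is exactly the bidegree of d^r. *)
Lemma compTorE r k i : i + compTor r.+1 k i = k - dldeg r.
Proof.
rewrite [LHS]surjective_pairing [RHS]surjective_pairing dl2 /=; congr pair; ilia.
Qed.

Section Graphs.
Variables (G H : digraph).
Local Notation TT := (ten T).
Local Notation tm := (tm_of T).
Local Notation tmap := (tmap_of T).
Local Notation gb := (@box G H).
Local Notation tG := (tpage G gS).
Local Notation tH := (tpage H gS).
Local Notation tX := (tpage gb gS).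
Local Notation hG := (pageH G gS).
Local Notation hH := (pageH H gS).
Local Notation hX := (pageH gb gS).
Local Notation tnab := (tnab T gS G H).
Local Notation D r := (kdiff (pageS G gS r) (pageH H gS r)).

Definition tensT r k := gS (fun i => TT (page R G r i) (page R H r (compT k i))).
Definition torT r k := gS (fun i => TorT T Q (page R G r i) (page R H r (compTor r k i))).

Definition nabk_in r k i : {linear TT (page R G r i) (page R H r (compT k i)) -> page R gb r k} :=
  tlift_of T (@nabla_pair_linl R G H r _ _ _ _ _ _ (compT1 k i) (compT2 k i))
    (@nabla_pair_linr R G H r _ _ _ _ _ _ (compT1 k i) (compT2 k i)).

Definition nabk r k : {linear gt (tensT r k) -> page R gb r k} :=
  glift (tensT r k) (nabk_in r k).

Lemma nabk_in_cls (r : nat) k i A B : A \in @Zcyc R G r%:Z i.1 i.2 ->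
  B \in @Zcyc R H r%:Z (compT k i).1 (compT k i).2 ->
  nabk_in r k i (tm (pcls r i A) (pcls r (compT k i) B)) = pcls r k (@nab R G H A B).
Proof.
by move=> AZ BZ; rewrite tm_liftE; exact: (nabla_pairE (compT1 k i) (compT2 k i) AZ BZ).
Qed.

Lemma nabkE r k t : gin (tX r) k (nabk r k t) = tnab r (theta (tG r) (tH r) (tensT r k) t).
Proof.
elim/g_ind: t => [|x y e e'|i t]; first by rewrite !linear0.
  by rewrite (linearD (nabk r k)) (linearD (gin _ _)) e e' (linearD (theta _ _ _)) (linearD (tnab r)).
rewrite /nabk glift_in theta_in.
elim/(@ten_ind R T): t => [|x y e e'|x y]; first by rewrite !linear0.
  rewrite (linearD (nabk_in r k i)) (linearD (gin _ _)) e e'.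
  by rewrite (linearD (tmap _ _)) (linearD (tnab r)).
elim/pcls_ind: x => A AZ; elim/pcls_ind: y => B BZ.
rewrite (nabk_in_cls AZ BZ) tm_mapE -![gin _ _ (pcls _ _ _)]/(gcl _ _ _ _).
rewrite (tnab_cl T gS AZ BZ); apply: gcl_eq.
by rewrite compTE addrC subrK.
Qed.

(** The induction hypothesis: the total nabla^r is a quasi-isomorphism for the page differentials,
    in the two forms [q1] and [q2] of the Kunneth argument. Page zero gives no more than this. *)
Definition kunneth_page r : Prop :=
  (forall t x, D r t = 0 -> tnab r t = hdiff (hX r) x -> exists v, t = D r v) /\
  (forall k z x, hi (hX r) z = gin (tX r) k x -> exists t v,
    [/\ homog (M := tG r) (N := tH r) k t, D r t = 0 & hi (hX r) z = tnab r t + hdiff (hX r) v]).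

Lemma kunneth_page0 : kunneth_page 0.
Proof. by split=> [t x|k z x]; [apply: base_q1|apply: base_q2]. Qed.

Section Page.
Variables (r : nat) (KH : kunneth_page r) (flr : tflat T (gt (tG r))).
Let q1 := KH.1.
Let q2 := KH.2.

Lemma nabk_inj k : injective (nabk r.+1 k).
Proof.
have h := nabc_inj pidR flr (@tnab_h R T gS G H r) q1 (nabkE (r := r.+1) (k := k)); exact: h.
Qed.

Lemma nabk_surj k : tflat T (gt (tG r.+1)) -> forall y, exists t, y = nabk r.+1 k t.
Proof.
move=> fl; have h := nabc_surj pidR flQ (pageHG G gS r) (pageHG H gS r) (pageHG gb gS r) flr
  (@tnab_D R T gS G H r) (@tnab_h R T gS G H r) q1 q2 (@tnab_gr R T gS G H r.+1)
  (compTE k) (compTorE r k) (torT r.+1 k) (nabkE (r := r.+1) (k := k)) fl.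
exact: h.
Qed.

(** Flatness of page [r + 1] kills Tor, so the total nabla^(r+1) is bijective and respects degrees.
    Both halves of the hypothesis then follow by pulling back along it, the second with [v = 0]. *)
Lemma kunneth_page_next : tflat T (gt (tG r.+1)) -> kunneth_page r.+1.
Proof.
move=> fl; have inj : injective (tnab r.+1).
  by have h := nab'_inj pidR flr (@tnab_h R T gS G H r) q1; exact: h.
have surj k y : exists2 t, homog (M := tG r.+1) (N := tH r.+1) k t & gin (tX r.+1) k y = tnab r.+1 t.
  have h := nab'_homog_surj pidR flQ (pageHG G gS r) (pageHG H gS r) (pageHG gb gS r) flr
    (@tnab_D R T gS G H r) (@tnab_h R T gS G H r) q1 q2 (@tnab_gr R T gS G H r.+1)
    (compTE k) (compTorE r k) (torT r.+1 k) (nabkE (r := r.+1) (k := k)) fl.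
  exact: h.
have tsurj x : exists t, x = tnab r.+1 t.
  elim/g_ind: x => [|_ _ [t ->] [u ->]|k x]; first by exists 0; rewrite linear0.
    by exists (t + u); rewrite linearD.
  by have [t _ ->] := surj k x; exists t.
split=> [t x _ tx|k z x zx].
  have [v xv] := tsurj x; exists v; apply: inj.
  by rewrite tnab_D tx xv.
have [t ht tx] := surj k x; exists t, 0; split=> //.
  apply: inj; rewrite tnab_D linear0 -tx -zx; exact: bhi_d.
by rewrite linear0 addr0 zx tx.
Qed.

Definition pdelta k (y : page R gb r.+1 k) (th : gt (torT r.+1 k)) : Prop :=
  delta_rel (hH r) (hX r) (pageS G gS r) (tnab r) y th.

Lemma pdelta_lin k a y th y' th' : @pdelta k y th -> @pdelta k y' th' ->
  @pdelta k (a *: y + y') (a *: th + th').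
Proof. exact: delta_lin. Qed.

Lemma pdelta_total k y : exists th, @pdelta k y th.
Proof.
have h := delta_total pidR (pageHG G gS r) (pageHG H gS r) (pageHG gb gS r) flr
  (@tnab_h R T gS G H r) q2 (torT r.+1 k); exact: h.
Qed.

Lemma pdelta_uniq k y th th' : @pdelta k y th -> @pdelta k y th' -> th = th'.
Proof.
have h := delta_uniq pidR (pageHG G gS r) (pageHG H gS r) (pageHG gb gS r) flr
  (@tnab_h R T gS G H r) q1 q2 (k := k) (gTor := torT r.+1 k) (y := y) (th := th) (th' := th').
exact: h.
Qed.

Lemma pdelta_surj k th : exists y, @pdelta k y th.
Proof.
have h := delta_surj pidR (pageHG G gS r) (pageHG H gS r) (pageHG gb gS r) flr
  (@tnab_D R T gS G H r) (@tnab_h R T gS G H r) q1 q2 (compTorE r k) th; exact: h.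
Qed.

Lemma pdelta_im k t : @pdelta k (nabk r.+1 k t) 0.
Proof.
have h := delta_im (Q := Q) (pageS G gS r) (@tnab_h R T gS G H r)
  (torT r.+1 k) (nabkE (r := r.+1) (k := k)) t.
exact: h.
Qed.

Lemma pdelta_ker k y : @pdelta k y 0 -> exists t, y = nabk r.+1 k t.
Proof.
have h := delta_ker pidR flQ (pageHG G gS r) (pageHG H gS r) (pageHG gb gS r) flr
  (@tnab_D R T gS G H r) (@tnab_h R T gS G H r) q1 q2 (@tnab_gr R T gS G H r.+1)
  (compTE k) (compTorE r k) (gTor := torT r.+1 k) (nabkE (r := r.+1) (k := k)) (y := y).
exact: h.
Qed.
End Page.
End Graphs.
End PageKunneth.

(** * Naturality *)

Section PageMap.
Variables (R : comNzRingType) (G G' : digraph) (f : dimap G G').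
Variable (gS : forall F : II -> lmodType R, gsum F).

(** Left unsealed, in contrast to [cmap], so that [mpss_map] is recognized by conversion. *)
Definition chmap : {linear chain R G -> chain R G'} := @chain_map R G G' f.
Lemma chmapE c : chmap c = cmap R f c. Proof. by rewrite cmap_chain_map. Qed.

Lemma Zcyc_chmap (r p q : int) c : c \in @Zcyc R G r p q -> chmap c \in @Zcyc R G' r p q.
Proof.
move=> cZ; rewrite chmapE; have [cF dF] := (iffLR (ZcycP _ _ _ _)) cZ.
apply/ZcycP; split; first exact: FRC_cmap.
by rewrite (cbd_cmap _ (Zcyc_nd cZ)); apply: FRC_cmap.
Qed.

Lemma Bcyc_chmap (r p q : int) c : c \in @Bcyc R G r p q -> chmap c \in @Bcyc R G' r p q.
Proof.
move=> /BcycP[y [z [yZ zZ ->]]]; apply/BcycP; exists (chmap y), (chmap z).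
split; [exact: Zcyc_chmap|exact: Zcyc_chmap|].
by rewrite linearD !chmapE (cbd_cmap _ (Zcyc_nd zZ)).
Qed.

Lemma mpss_map_linear r p q : linear (@mpss_map R G G' f r p q).
Proof.
by apply: (@sq_map_linear R _ _ _ _ _ _ chmap) => c; [apply: Zcyc_chmap|move=> _; apply: Bcyc_chmap].
Qed.

Definition page_map r i : {linear page R G r i -> page R G' r i} :=
  mklin (@mpss_map_linear r i.1 i.2).

Lemma page_map_cls (r : nat) i c : c \in @Zcyc R G r%:Z i.1 i.2 ->
  page_map r i (pcls r i c) = pcls r i (cmap R f c).
Proof.
move=> cZ; rewrite -chmapE.
by apply: (@sq_mapE R _ _ _ _ _ _ chmap) => // v; [apply: Zcyc_chmap|move=> _; apply: Bcyc_chmap].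
Qed.

Definition tpmap r : {linear gt (tpage G gS r) -> gt (tpage G' gS r)} :=
  gmap (tpage G gS r) (tpage G' gS r) (page_map r).

Lemma Z_cmap (r : nat) (i : II) c : c \in @Zcyc R G r%:Z i.1 i.2 ->
  cmap R f c \in @Zcyc R G' r%:Z i.1 i.2.
Proof. by rewrite -chmapE; apply: Zcyc_chmap. Qed.

Lemma tpmap_cl (r : nat) i c : c \in @Zcyc R G r%:Z i.1 i.2 ->
  tpmap r (gcl gS r i c) = gcl gS r i (cmap R f c).
Proof. by move=> cZ; rewrite /tpmap /gcl gmap_in page_map_cls. Qed.

Lemma tpmap_diff r x : tdiff G' gS r (tpmap r x) = tpmap r (tdiff G gS r x).
Proof.
apply: (@tpage_ext R G gS r _ (tdiff G' gS r \o tpmap r) (tpmap r \o tdiff G gS r)) => i c cZ.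
rewrite -[LHS]/(tdiff _ _ _ (tpmap _ _)) -[RHS]/(tpmap _ (tdiff _ _ _ _)).
rewrite (tpmap_cl cZ) (tdiff_cl gS cZ) (tpmap_cl (Z_cbd r cZ)) (tdiff_cl gS (Z_cmap cZ)).
by rewrite (cbd_cmap _ (Zcyc_nd cZ)).
Qed.

Lemma page_map_pcyc r i (u : cyc R G r i) : exists v : cyc R G' r i,
  page_map r i (pcyc R G r i u) = pcyc R G' r i v /\ page_map r.+1 i (pcyc' R G r i u) = pcyc' R G' r i v.
Proof.
exists (Submodule (Z_cmap (r := r.+1) (sm_valP u))); split.
  exact: (page_map_cls (Z_mono (sm_valP u))).
exact: (page_map_cls (sm_valP u)).
Qed.

Definition pageM r : hmor (pageH G gS r) (pageH G' gS r) :=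
  bmor (tpage G gS r.+1) (gS (cyc R G r)) (page_homology G gS r)
    (tpage G' gS r.+1) (gS (cyc R G' r)) (page_homology G' gS r)
    (tpmap_diff (r := r)) (page_map_pcyc (r := r)).

Lemma pageM_sign r m : hs (pageS G' gS r) (hmM (pageM r) m) = hmM (pageM r) (hs (pageS G gS r) m).
Proof.
apply: (@tpage_ext R G gS r _ (hs (pageS G' gS r) \o tpmap r) (tpmap r \o hs (pageS G gS r))) => i c cZ.
rewrite -[LHS]/(hs _ (tpmap _ _)) -[RHS]/(tpmap _ (hs _ _)).
by rewrite (tpmap_cl cZ) !pageS_cl linearZZ (tpmap_cl cZ).
Qed.
End PageMap.

Section PageNatural.
Variables (R : idomainType) (T : tensor_theory R) (Q : resolution_theory R).
Variable (gS : forall F : II -> lmodType R, gsum F).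
Variables (G G' H H' : digraph) (f : dimap G G') (g : dimap H H').
Local Notation TT := (ten T).
Local Notation tmap := (tmap_of T).
Local Notation bm := (box_map f g).

Lemma tpmap_tnab r t : tpmap bm gS r (tnab T gS G H r t) =
  tnab T gS G' H' r (tmap (tpmap f gS r) (tpmap g gS r) t).
Proof.
apply: (@ttpage_ext R T gS G H r _ (tpmap bm gS r \o tnab T gS G H r)
  (tnab T gS G' H' r \o tmap (tpmap f gS r) (tpmap g gS r))) => i j A B AZ BZ.
rewrite -[LHS]/(tpmap _ _ _ (tnab _ _ _ _ _ _)) -[RHS]/(tnab _ _ _ _ _ (tmap _ _ _)).
rewrite tm_mapE (tpmap_cl _ _ AZ) (tpmap_cl _ _ BZ) (tnab_cl _ _ AZ BZ).
rewrite (tnab_cl _ _ (Z_cmap f AZ) (Z_cmap g BZ)).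
have nZ : nab A B \in @Zcyc R (box G H) r%:Z (i + j).1 (i + j).2.
  exact: (Zcyc_nab (erefl _) (erefl _) AZ BZ).
rewrite (tpmap_cl bm gS nZ).
by rewrite (cmap_nab f g (Zcyc_nd AZ) (Zcyc_nd BZ)).
Qed.

Lemma nabk_nat r k i (t : TT (page R G r i) (page R H r (compT k i))) :
  page_map R bm r k (nabk_in T G H r k i t) =
  nabk_in T G' H' r k i (tmap (page_map R f r i) (page_map R g r (compT k i)) t).
Proof.
elim/(@ten_ind R T): t => [|x y e e'|x y]; first by rewrite !linear0.
  rewrite (linearD (nabk_in _ _ _ _ _ _)) (linearD (page_map _ _ _ _)) e e'.
  by rewrite (linearD (tmap _ _)) (linearD (nabk_in _ _ _ _ _ _)).
elim/pcls_ind: x => A AZ; elim/pcls_ind: y => B BZ.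
rewrite (nabk_in_cls _ AZ BZ) tm_mapE (page_map_cls f AZ) (page_map_cls g BZ).
rewrite (nabk_in_cls _ (Z_cmap f AZ) (Z_cmap g BZ)) -(cmap_nab f g (Zcyc_nd AZ) (Zcyc_nd BZ)).
by rewrite page_map_cls //; apply: (Zcyc_nab (compT1 k i) (compT2 k i) AZ BZ).
Qed.

(** A witness consists of cycles and lifts, all of which the maps carry along; naturality of
    [kun_rel] and [tor_rel] combine without comparing any choices. *)
Lemma pdelta_nat r k y th (th' : gt (torT T Q gS G' H' r.+1 k)) :
  (forall i, gpr _ i th' = tor_map (page_map R f r.+1 i) (page_map R g r.+1 (compTor r.+1 k i)) (gpr _ i th)) ->
  @pdelta R T Q gS G H r k y th -> @pdelta R T Q gS G' H' r k (page_map R bm r.+1 k y) th'.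
Proof.
move=> thE [th0 [[b yb bt] e]].
exists (tor_map (tpmap f gS r.+1) (tpmap g gS r.+1) th0); split.
  have nat := kun_rel_nat (f := pageM f gS r) (g := pageM g gS r) (k := pageM bm gS r)
    (@pageM_sign R G G' f gS r) (@tpmap_tnab r) yb.
  have nat' := tor_rel_nat (fB := hmB (pageM f gS r)) (fZ := hmZ (pageM f gS r))
    (fM := hmH (pageM f gS r)) (tpmap g gS r.+1) (@hhj _ _ _ (pageH G gS r))
    (@hm_j _ _ _ _ _ _ _ (pageM f gS r)) (@hm_h _ _ _ _ _ _ _ (pageM f gS r)) bt.
  exists (tmap (hmB (pageM f gS r)) (hmH (pageM g gS r)) b); last exact: nat'.
  have <- : hmH (pageM bm gS r) (gin (tpage (box G H) gS r.+1) k y) =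
    gin (tpage (box G' H') gS r.+1) k (page_map R bm r.+1 k y) by exact: gmap_in.
  exact: nat.
move=> i; rewrite thE e.
rewrite (tor_map_comp (h := page_map R f r.+1 i \o gpr _ i)
  (k := page_map R g r.+1 (compTor r.+1 k i) \o gpr _ (compTor r.+1 k i))) //.
apply/esym; apply: tor_map_comp => x; exact: gpr_gmap.
Qed.
End PageNatural.

(** * The theorem *)

Section TorComponents.
Variables (R : comNzRingType) (I : zmodType) (E F : I -> lmodType R).
Local Notation T := (std_tensor R).
Local Notation Q := (std_resolution R).
Local Notation TorG E F := (gt (std_gsum (fun i => TorT T Q (E i) (F i)))).
Local Notation TorD E F := (dsum (fun i => Tor (E i) (F i))).

(* [Tor] is convertible to [TorT] over the standard tensor product and resolution,
   but only the kernel checks this quickly, hence [exact_no_check] below. *)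
Definition to_Tor (x : TorG E F) : TorD E F := x.
End TorComponents.

Lemma to_Tor_exact (R : comNzRingType) (I : zmodType) (E F : I -> lmodType R) (L M : lmodType R)
    (f : L -> M) (g : M -> gt (std_gsum (fun i => TorT (std_tensor R) (std_resolution R) (E i) (F i)))) :
  short_exact f g -> short_exact f (fun y => to_Tor (g y)).
Proof. move=> h; exact_no_check h. Qed.

Lemma dsum_map_gmap (R : comNzRingType) (I : zmodType) (A B : I -> lmodType R)
    (h : forall i, {linear A i -> B i}) (x : dsum A) :
  dsum_map h x = gmap (std_gsum A) (std_gsum B) h x.
Proof.
apply: dsumP => i; rewrite dsum_mapE.
have e := @gpr_gmap R I A B (std_gsum A) (std_gsum B) h i x.
exact (esym e).
Qed.

Lemma to_Tor_natural (R : comNzRingType) (I : zmodType) (E F E' F' : I -> lmodType R)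
    (f : forall i, {linear E i -> E' i}) (g : forall i, {linear F i -> F' i}) x :
  dsum_map (fun i => Tor_map (f i) (g i)) (to_Tor x) =
  to_Tor (gmap (std_gsum _) (std_gsum _)
    (fun i => tor_mapl (std_tensor R) (std_resolution R) (f i) (g i)) x).
Proof.
have h := dsum_map_gmap (fun i => tor_mapl (std_tensor R) (std_resolution R) (f i) (g i)) x.
exact_no_check h.
Qed.

Section Standard.
Variables (R : idomainType) (pidR : is_pid R).
Local Notation T := (std_tensor R).
Local Notation Q := (std_resolution R).
Local Notation gS := (@std_gsum R II).

Lemma std_res0_flat N : tflat T (res0 Q N).
Proof. exact: tflat_free. Qed.

Lemma flat_below_total (G : digraph) s : flat_below R G s -> forall r, (r < s)%N ->
  tflat T (gt (tpage G gS r)).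
Proof.
move=> fl r rs; have h := gsum_tflat (T := T) pidR (gF := tpage G gS r) (fun i => fl r i.1 i.2 rs).
exact: h.
Qed.

Lemma flat_below_kunneth (G H : digraph) s : flat_below R G s -> forall r, (r < s)%N ->
  kunneth_page T gS G H r.
Proof.
move=> fl; elim=> [|r IH] rs; first exact: kunneth_page0.
have rs' := ltnW rs.
exact: (kunneth_page_next pidR std_res0_flat (IH rs') (flat_below_total fl rs')
  (flat_below_total fl rs)).
Qed.

Lemma nablaE (G H : digraph) r p q x :
  nabla R G H r p q x = nabk T gS G H r (p, q) x.
Proof. by []. Qed.

(** The connecting map must be given for all graphs before any flatness is assumed; the value [0]
    fills in where the relation has no value. *)
Definition pconnect (G H : digraph) r k (y : page R (box G H) r.+1 k) :
    gt (torT T Q gS G H r.+1 k) :=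
  if pselect (exists th, @pdelta R T Q gS G H r k y th) is left e then projT1 (cid e) else 0.

Section Flat.
Variables (G H : digraph) (r : nat) (flG : flat_below R G r.+1).

Lemma pconnectP k (y : page R (box G H) r.+1 k) : @pdelta R T Q gS G H r k y (pconnect y).
Proof.
rewrite /pconnect; case: pselect => [e|]; first by case: cid.
case; exact: (pdelta_total pidR Q (flat_below_kunneth H flG (ltnSn r)) (flat_below_total flG (ltnSn r))).
Qed.

Lemma pconnect_eq k (y : page R (box G H) r.+1 k) th :
  @pdelta R T Q gS G H r k y th -> pconnect y = th.
Proof.
exact: (pdelta_uniq pidR (flat_below_kunneth H flG (ltnSn r))
  (flat_below_total flG (ltnSn r)) (pconnectP y)).
Qed.

Lemma pconnect_exact k : short_exact (nabk T gS G H r.+1 k) (@pconnect G H r k).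
Proof.
have KH := flat_below_kunneth H flG (ltnSn r); have fl := flat_below_total flG (ltnSn r).
split.
- split; first exact: (linearP (nabk T gS G H r.+1 k)).
  by move=> a y y'; apply: pconnect_eq; apply: pdelta_lin; apply: pconnectP.
- exact: (nabk_inj pidR KH fl).
- move=> y; split=> [y0|[x ->]].
    by have := pconnectP y; rewrite y0 => /(pdelta_ker pidR std_res0_flat KH fl).
  by apply: pconnect_eq; exact: pdelta_im.
move=> z; have [y yz] := pdelta_surj pidR KH fl z.
by exists y; apply: pconnect_eq.
Qed.
End Flat.

Definition connecting (G H : digraph) r p q (y : mpss R (box G H) r.+1 p q) :
    mpss_tor R G H r.+1 p q :=
  to_Tor (@pconnect G H r (p, q) y).

Lemma nabla_connecting (G H : digraph) r p q : flat_below R G r.+1 ->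
  short_exact (nabla R G H r.+1 p q) (@connecting G H r p q).
Proof.
move=> fl; have h := to_Tor_exact (pconnect_exact H fl (p, q)).
exact_no_check h.
Qed.

Lemma nabla_iso (G H : digraph) s r p q : flat_below R G s -> (r.+1 < s)%N ->
  linear_iso (nabla R G H r.+1 p q).
Proof.
move=> fl rs; have rs' := ltnW rs.
have KH := flat_below_kunneth H fl rs'; have flr := flat_below_total fl rs'.
split; first exact: (linearP (nabk T gS G H r.+1 (p, q))).
have inj := nabk_inj pidR KH flr (k := (p, q)).
have surj := nabk_surj pidR std_res0_flat KH flr (k := (p, q)) (flat_below_total fl rs).
pose inv y := projT1 (cid (surj y)).
have invK y : nabk T gS G H r.+1 (p, q) (inv y) = y by rewrite /inv; case: cid.
by exists inv => [x|y]; [apply: inj; rewrite invK|exact: invK].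
Qed.

Section Natural.
Variables (G G' H H' : digraph) (f : dimap G G') (g : dimap H H') (r : nat) (p q : int).

Local Notation tmaps := (fun i => tmap_of T (page_map R f r i) (page_map R g r (compT (p, q) i))).

Lemma mpss_tensor_mapE (x : gt (tensT T gS G H r (p, q))) : mpss_tensor_map f g x =
  gmap (tensT T gS G H r (p, q)) (tensT T gS G' H' r (p, q)) tmaps x.
Proof. exact: (dsum_map_gmap tmaps). Qed.

Lemma nabla_natural x : nabla R G' H' r p q (mpss_tensor_map f g x) =
  mpss_map (box_map f g) (nabla R G H r p q x).
Proof.
rewrite !nablaE mpss_tensor_mapE.
rewrite -[RHS]/(page_map R (box_map f g) r (p, q) (nabk T gS G H r (p, q) x)).
move: x; apply: (@g_extl _ _ _ (tensT T gS G H r (p, q)) _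
  (nabk T gS G' H' r (p, q) \o gmap (tensT T gS G H r (p, q)) (tensT T gS G' H' r (p, q))
    (fun i => tmap_of T (page_map R f r i) (page_map R g r (compT (p, q) i))))
  (page_map R (box_map f g) r (p, q) \o nabk T gS G H r (p, q))) => i t.
rewrite -[LHS]/(nabk _ _ _ _ _ _ (gmap _ _ _ _)) -[RHS]/(page_map _ _ _ _ (nabk _ _ _ _ _ _ _)).
rewrite gmap_in /nabk !glift_in; apply/esym; exact: nabk_nat.
Qed.
End Natural.

Lemma pconnect_natural (G G' H H' : digraph) (f : dimap G G') (g : dimap H H') r k
    (y : page R (box G H) r.+1 k) :
  flat_below R G r.+1 -> flat_below R G' r.+1 ->
  pconnect (page_map R (box_map f g) r.+1 k y) =
  gmap (torT T Q gS G H r.+1 k) (torT T Q gS G' H' r.+1 k)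
    (fun i => tor_mapl T Q (page_map R f r.+1 i) (page_map R g r.+1 (compTor r.+1 k i)))
    (pconnect y).
Proof.
move=> fl fl'; apply: (pconnect_eq fl').
apply: (pdelta_nat _ (pconnectP fl y)) => i.
exact: gpr_gmap.
Qed.

Lemma connecting_natural (G G' H H' : digraph) (f : dimap G G') (g : dimap H H') r p q
    (y : mpss R (box G H) r.+1 p q) :
  flat_below R G r.+1 -> flat_below R G' r.+1 ->
  connecting (mpss_map (box_map f g) y) = mpss_tor_map f g (connecting y).
Proof.
move=> fl fl'; have nat := to_Tor_natural (page_map R f r.+1)
  (fun i => page_map R g r.+1 (compTor r.+1 (p, q) i)) (pconnect (k := (p, q)) y).
have e := @pconnect_natural _ _ _ _ f g r (p, q) y fl fl'.
have h := etrans (congr1 (@to_Tor _ _ _ _) e) (esym nat).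
exact_no_check h.
Qed.
End Standard.

Theorem theorem5p6 (R : idomainType) (pidR : is_pid R) (s : nat) (s_ge1 : (1 <= s)%N) :
  exists delta : forall (G H : digraph) (p q : int),
      mpss R (box G H) s p q -> mpss_tor R G H s p q,
  [/\ forall G H : digraph, flat_below R G s ->
        (forall (r : nat) (p q : int), (1 <= r < s)%N ->
           linear_iso (nabla R G H r p q)) /\
        (forall p q : int, short_exact (nabla R G H s p q) (delta G H p q)),
      forall (G H H' : digraph) (g : dimap H H'), flat_below R G s ->
        forall p q : int,
          (forall x, nabla R _ _ s p q (mpss_tensor_map (id_dimap G) g x) =
                     mpss_map (box_map (id_dimap G) g) (nabla R G H s p q x)) /\
          (forall y, delta G H' p q (mpss_map (box_map (id_dimap G) g) y) =
                     mpss_tor_map (id_dimap G) g (delta G H p q y))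
    & forall (G G' H : digraph) (f : dimap G G'), flat_below R G s -> flat_below R G' s ->
        forall p q : int,
          (forall x, nabla R _ _ s p q (mpss_tensor_map f (id_dimap H) x) =
                     mpss_map (box_map f (id_dimap H)) (nabla R G H s p q x)) /\
          (forall y, delta G' H p q (mpss_map (box_map f (id_dimap H)) y) =
                     mpss_tor_map f (id_dimap H) (delta G H p q y)) ].
Proof.
(* The sequence for page [s] comes from taking homology of page [s - 1], the last page of [G] whose
   flatness is assumed. *)
case: s s_ge1 => // s _; exists (fun G H p q => @connecting R G H s p q); split.
- move=> G H fl; split=> [[//|r] p q /andP[_ rs]|p q]; first exact: (@nabla_iso R pidR G H _ r p q fl rs).
  exact: nabla_connecting.
- move=> G H H' g fl p q; split=> [x|y]; first exact: nabla_natural.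
  exact: connecting_natural.
move=> G G' H f fl fl' p q; split=> [x|y]; first exact: nabla_natural.
exact: connecting_natural.
Qed.
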